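(* Let $n\ge 1$ be an integer and let $\gamma:[0,\infty)\to[0,\infty)$ be strictly increasing and continuous with $\gamma(0)=0$. Let $R\ge 1$ and let $\varphi:\mathbf{R}^n\to\mathbf{R}$ be a measurable function whose radial derivatives $\varphi'(r,\omega)$ and $\varphi''(r,\omega)$ of first and second order exist and are continuous for $r>R$, $\omega\in S^{n-1}$, and satisfy $$\liminf_{r\to\infty}\Big(\inf_{|\omega|=1}|\varphi'(r,\omega)|\Big)=\infty$$ and, for some constant $C<\infty$, $$\sup_{r> R}\Big(\sup_{|\omega|=1}\frac{r\,|\varphi''(r,\omega)|}{|\varphi'(r,\omega)|^2(\log r)^{3/4}}\Big)<C .$$ Then there exists a function $f\in H^{n/2}(\mathbf{R}^n)$ such that $S^{\varphi}f$ is continuous in $\{(x,t): x\in\mathbf{R}^n,\ t>0\}$ and, for all $x\in\mathbf{R}^n$, $$\limsup_{(y,t)\to(x,0)}|S^{\varphi}f(y,t)|=+\infty,$$ where the limit superior is taken over those $(y,t)$ for which $|y-x|<\gamma(t)$ and $t>0$.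
   Context: Polar coordinates: for $\xi=r\omega$ with $r=|\xi|>0$, $\omega\in S^{n-1}=\{|\omega|=1\}$, write $\varphi(r,\omega)=\varphi(r\omega)$; $\varphi'(r,\omega)$ and $\varphi''(r,\omega)$ denote the first and second derivatives with respect to $r$ (continuity is joint in $(r,\omega)$). The quotient condition includes that the quotient is well-defined, i.e. $\varphi'(r,\omega)\neq0$ for $r>R$. Fourier transform: $\widehat f(\xi)=\mathcal{F}f(\xi)=\int_{\mathbf{R}^n}e^{-ix\cdot\xi}f(x)\,dx$ for $f\in L^1(\mathbf{R}^n)$, extended as usual to tempered distributions. Sobolev space: $H^s(\mathbf{R}^n)$ consists of all $f\in\mathcal{S}'(\mathbf{R}^n)$ with $\|f\|_{H^s}=\big(\int_{\mathbf{R}^n}(1+|\xi|^2)^s|\widehat f(\xi)|^2\,d\xi\big)^{1/2}<\infty$. Operator: $S^{\varphi}f(\cdot,t)=\mathcal{F}^{-1}\big(e^{it\varphi(\xi)}\mathcal{F}f\big)$, $t\in\mathbf{R}$; thus $S^\varphi f(x,t)=(2\pi)^{-n}\int_{\mathbf{R}^n}e^{ix\cdot\xi}e^{it\varphi(\xi)}\widehat f(\xi)\,d\xi$ when $\widehat f$ is integrable. For $f\in H^{n/2}(\mathbf{R}^n)\subset L^2(\mathbf{R}^n)$, $S^\varphi f(\cdot,t)$ is an $L^2$ function for each $t$. The statement that $S^\varphi f$ is continuous in $\{t>0\}$ means that there is a continuous function on $\{(x,t):t>0\}$ which for each $t>0$ coincides with $S^\varphi f(\cdot,t)$ almost everywhere;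 pointwise values of $S^\varphi f$ refer to this continuous function. *)

(* Defs.v *)
(* MathComp-Analysis. R^n is 'rV[R]_n: its library norm is the sup norm, which
   gives the usual topology; the Euclidean norm is enorm below. *)
From HB Require Import structures.
From mathcomp Require Import all_boot all_order all_algebra.
From mathcomp Require Import complex.
From mathcomp Require Import all_classical all_reals all_analysis.
From mathcomp Require Import measurable_realfun.

Set Implicit Arguments.
Unset Strict Implicit.
Unset Printing Implicit Defensive.

Import Order.TTheory GRing.Theory Num.Theory.
Import numFieldNormedType.Exports.

Local Open Scope classical_set_scope.
Local Open Scope ring_scope.

(* The Borel sigma-algebra of R^n, generated by the coordinates. *)
Definition rV_display : measure_display.
Proof. exact: default_measure_display. Qed.

Section measurable_rV.
Context {R : realType} (n : nat).

Let coord : 'I_n -> 'rV[R]_n -> R := fun i v => v ord0 i.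

Let rV_set0 : g_sigma_preimage coord set0.
Proof. exact: sigma_algebra0. Qed.

Let rV_setC A : g_sigma_preimage coord A -> g_sigma_preimage coord (~` A).
Proof. exact: sigma_algebraC. Qed.

Let rV_bigcup (F : _^nat) : (forall i, g_sigma_preimage coord (F i)) ->
  g_sigma_preimage coord (\bigcup_i (F i)).
Proof. exact: sigma_algebra_bigcup. Qed.

HB.instance Definition _ := @isMeasurable.Build rV_display
  'rV[R]_n (g_sigma_preimage coord) rV_set0 rV_setC rV_bigcup.

End measurable_rV.

Lemma measurable_coord (R : realType) n (i : 'I_n) :
  measurable_fun [set: 'rV[R]_n] (fun v : 'rV[R]_n => v ord0 i).
Proof.
move=> _ Y mY; rewrite setTI; apply: sub_sigma_algebra => /=.
rewrite -bigcup_seq/=; exists i => /=; first by rewrite mem_index_enum.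
by exists Y => //; rewrite setTI.
Qed.

Lemma measurable_fun_rVP d (T : measurableType d) (R : realType) n
    (f : T -> 'rV[R]_n) :
  measurable_fun [set: T] f <->
  forall i, measurable_fun [set: T] (fun x => f x ord0 i).
Proof.
split=> [mf i|mf].
  exact: (measurableT_comp (measurable_coord i) mf).
have : g_sigma_preimage (fun (i : 'I_n) (x : T) => f x ord0 i) `<=` measurable.
  apply: smallest_sub; first exact: sigma_algebra_measurable.
  rewrite -bigcup_seq/= => A [i _ [B mB <-]]; exact: mf.
rewrite (g_sigma_preimage_comp (fun i (v : 'rV[R]_n) => v ord0 i) f) => sub.
by move=> _ A mA; apply: sub; exists A.
Qed.

Section lebesgue_rV.
Context {R : realType}.
Local Open Scope ereal_scope.

Definition rV_cons n (p : R * 'rV[R]_n) : 'rV[R]_n.+1 :=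
  \row_i (if unlift ord0 i is Some j then p.2 ord0 j else p.1).

Definition rV_uncons n (v : 'rV[R]_n.+1) : R * 'rV[R]_n :=
  (v ord0 ord0, \row_i v ord0 (lift ord0 i)).

Lemma rV_consE0 n (p : R * 'rV[R]_n) : rV_cons p ord0 ord0 = p.1.
Proof. by rewrite mxE unlift_none. Qed.

Lemma rV_consES n (p : R * 'rV[R]_n) i :
  rV_cons p ord0 (lift ord0 i) = p.2 ord0 i.
Proof. by rewrite mxE liftK. Qed.

Lemma rV_consK n : cancel (@rV_cons n) (@rV_uncons n).
Proof.
move=> [x v]; rewrite /rV_uncons rV_consE0; congr pair.
by apply/rowP => i; rewrite mxE rV_consES.
Qed.

Lemma measurable_rV_cons n : measurable_fun setT (@rV_cons n).
Proof.
apply/measurable_fun_rVP => i; have [j ->|->] := unliftP ord0 i.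
  rewrite (_ : (fun _ => _) = (fun v : 'rV[R]_n => v ord0 j) \o snd).
    exact: (measurableT_comp (measurable_coord j)).
  by apply/funext => p /=; rewrite rV_consES.
by rewrite (_ : (fun _ => _) = fst)//; apply/funext => p /=; rewrite rV_consE0.
Qed.

Lemma measurable_rV_uncons n : measurable_fun setT (@rV_uncons n).
Proof.
apply/measurable_fun_pairP; split; first exact: measurable_coord.
apply/measurable_fun_rVP => i.
rewrite (_ : (fun _ => _) = fun v : 'rV[R]_n.+1 => v ord0 (lift ord0 i)).
  exact: measurable_coord.
by apply/funext => v /=; rewrite mxE.
Qed.

Section step.
Context n (mu : {sigma_finite_measure set 'rV[R]_n -> \bar R}).

Definition lebesgue_rV_step : set 'rV[R]_n.+1 -> \bar R :=
  pushforward (@lebesgue_measure R \x mu) (@rV_cons n).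

Let step0 : lebesgue_rV_step set0 = 0.
Proof. by rewrite /lebesgue_rV_step /pushforward preimage_set0 measure0. Qed.

Let step_ge0 A : 0 <= lebesgue_rV_step A.
Proof. by rewrite /lebesgue_rV_step /pushforward measure_ge0. Qed.

Let step_sigma_additive : semi_sigma_additive lebesgue_rV_step.
Proof.
have mcons (A : set 'rV[R]_n.+1) : measurable A ->
    measurable (@rV_cons n @^-1` A).
  by move=> mA; rewrite -[X in measurable X]setTI; exact: measurable_rV_cons.
move=> F mF tF mUF; rewrite /lebesgue_rV_step /pushforward preimage_bigcup.
apply: measure_semi_sigma_additive.
- by move=> k; exact: mcons.
- apply/trivIsetP => /= i j _ _ ij; rewrite -preimage_setI.
  by move/trivIsetP : tF => /(_ _ _ _ _ ij) ->//; rewrite preimage_set0.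
- by rewrite -preimage_bigcup; exact: mcons.
Qed.

HB.instance Definition _ := isMeasure.Build _ _ _ lebesgue_rV_step
  step0 step_ge0 step_sigma_additive.

Let step_sigma_finite : sigma_finite setT lebesgue_rV_step.
Proof.
have /sigma_finiteP[F [TF ndF Foo]] := sigma_finiteT (@lebesgue_measure R).
have /sigma_finiteP[G [TG ndG Goo]] := sigma_finiteT mu.
exists (fun k => @rV_uncons n @^-1` (F k `*` G k)).
  rewrite -preimage_bigcup -[LHS](preimage_setT (@rV_uncons n)); congr preimage.
  rewrite -setXTT TF TG predeqE => -[x y]; split.
    move=> [/= [k _ Fkx] [l _ Gly]]; exists (maxn k l) => //; split.
    - by move: x Fkx; exact/subsetPset/ndF/leq_maxl.
    - by move: y Gly; exact/subsetPset/ndG/leq_maxr.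
  by move=> [k _ []/= ? ?]; split; exists k.
move=> k; have [mF Fk] := Foo k; have [mG Gk] := Goo k; split.
  rewrite -[X in measurable X]setTI; apply: measurable_rV_uncons => //.
  exact: measurableX.
rewrite /lebesgue_rV_step /pushforward -comp_preimage.
rewrite (_ : @rV_uncons n \o _ = id); last first.
  by apply/funext => p /=; rewrite rV_consK.
by rewrite preimage_id product_measure1E// lte_mul_pinfty// ge0_fin_numE.
Qed.

HB.instance Definition _ := Measure_isSigmaFinite.Build _ _ _ lebesgue_rV_step
  step_sigma_finite.

End step.

Let rV0_sigma_finite : sigma_finite setT (@dirac _ 'rV[R]_0 0%R R).
Proof.
by apply: fin_num_fun_sigma_finite; rewrite ?measure0//; exact: fin_num_measure.
Qed.

(* Lebesgue measure on R^n, by recursion on n: the Dirac mass on the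
   one-point space R^0, then the product with the Lebesgue measure of R. *)
Fixpoint lebesgue_rV n : {sigma_finite_measure set 'rV[R]_n -> \bar R} :=
  match n with
  | 0%N => @dirac _ 'rV[R]_0 0%R R
  | m.+1 => lebesgue_rV_step (lebesgue_rV m)
  end.

Lemma lebesgue_rV_box n (A : 'I_n -> set R) :
  (forall i, measurable (A i)) ->
  lebesgue_rV n [set v | forall i, A i (v ord0 i)] =
  \prod_(i < n) lebesgue_measure (A i).
Proof.
elim: n A => [|n IH] A mA.
  rewrite big_ord0 /= diracE mem_set//; by case.
rewrite big_ord_recl /= /lebesgue_rV_step /pushforward.
pose B := [set v : 'rV[R]_n | forall i, A (lift ord0 i) (v ord0 i)].
have mB : measurable B.
  rewrite (_ : B = \bigcap_(i in [set: 'I_n])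
      ((fun v : 'rV[R]_n => v ord0 i) @^-1` A (lift ord0 i))); last first.
    by apply/seteqP; split=> v /= H; [move=> i _; exact: H|move=> i; exact: H].
  apply: fin_bigcap_measurable => // i _.
  by rewrite -[X in measurable X]setTI; exact: measurable_coord.
rewrite -(IH (fun i => A (lift ord0 i)))// -product_measure1E//; last exact: mA.
congr ((_ \x _) _); apply/seteqP; split => -[x v] /=.
  move=> H; split; first by have := H ord0; rewrite rV_consE0.
  by move=> i; have := H (lift ord0 i); rewrite rV_consES.
move=> [Ax Av] i; have [j ->|->] := unliftP ord0 i.
  by rewrite rV_consES; exact: Av.
by rewrite rV_consE0.
Qed.

End lebesgue_rV.

Section euclidean.
Context {R : realType} {n : nat}.
Implicit Types x y : 'rV[R]_n.

Definition dot x y : R := \sum_(i < n) x ord0 i * y ord0 i.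

Definition enorm x : R := Num.sqrt (dot x x).

Definition unit_sphere : set 'rV[R]_n := [set w | enorm w = 1].

(* Measurable with respect to the completion of the Borel sigma-algebra. *)
Definition lebesgue_measurable (f : 'rV[R]_n -> R) : Prop :=
  forall Y : set R, measurable Y ->
    completed_algebra_gen (@lebesgue_rV R n) (f @^-1` Y).

End euclidean.

Section complex_valued.
Context {R : realType} {n : nat}.
Local Notation Rn := 'rV[R]_n.
Local Notation C := R[i].
Implicit Types (f g : Rn -> C).
Local Open Scope complex_scope.

Definition cmod (z : C) : R := Normc.normc z.

Definition cexpi (a : R) : C := cos a +i* sin a.

Definition cmeasurable f : Prop :=
  measurable_fun setT (fun x => complex.Re (f x)) /\
  measurable_fun setT (fun x => complex.Im (f x)).

(* Meaningful when |f| is integrable. *)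
Definition cintegral f : C :=
  (\int[@lebesgue_rV R n]_x complex.Re (f x)) +i*
  (\int[@lebesgue_rV R n]_x complex.Im (f x)).

Definition L2 f : Prop :=
  cmeasurable f /\
  (\int[@lebesgue_rV R n]_x (cmod (f x) ^+ 2)%:E < +oo)%E.

Definition fourier f : Rn -> C :=
  fun xi => cintegral (fun x => cexpi (- dot x xi) * f x).

Definition inv_fourier f : Rn -> C :=
  fun x => ((2 * pi) ^- n)%:C * cintegral (fun xi => cexpi (dot x xi) * f xi).

End complex_valued.

Section distributions.
Context {R : realType} {n : nat}.
Local Notation Rn := 'rV[R]_n.
Local Notation C := R[i].
Local Open Scope complex_scope.

(* Multi-indices are encoded as lists of coordinates, one per derivative. *)
Fixpoint rpartial (s : seq 'I_n) (f : Rn -> R) : Rn -> R :=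
  if s is i :: s' then
    (fun x => derive (rpartial s' f) x (delta_mx ord0 i))
  else f.

Definition rsmooth (f : Rn -> R) : Prop :=
  forall s : seq 'I_n, continuous (rpartial s f) /\
    forall x i, derivable (rpartial s f) x (delta_mx ord0 i).

Definition partial (s : seq 'I_n) (psi : Rn -> C) : Rn -> C := fun x =>
  rpartial s (fun y => complex.Re (psi y)) x +i*
  rpartial s (fun y => complex.Im (psi y)) x.

Definition schwartz (psi : Rn -> C) : Prop :=
  [/\ rsmooth (fun x => complex.Re (psi x)),
      rsmooth (fun x => complex.Im (psi x))
    & forall (k : nat) (s : seq 'I_n),
        exists M : R, forall x, enorm x ^+ k * cmod (partial s psi x) <= M].

(* Functionals are total functions; only their values at Schwartz functions
   are meaningful, whence deq below. *)
Definition functional := (Rn -> C) -> C.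

Definition deq (u v : functional) : Prop :=
  forall psi, schwartz psi -> u psi = v psi.

(* Continuity for the Schwartz topology: u is bounded by finitely many of the
   seminorms sup_x |x|^k |partial^s psi(x)|. *)
Definition tempered (u : functional) : Prop :=
  (forall (a : C) psi1 psi2, schwartz psi1 -> schwartz psi2 ->
     u (fun x => a * psi1 x + psi2 x) = a * u psi1 + u psi2) /\
  (exists (N : nat) (B : R), forall psi (M : R), schwartz psi ->
     (forall k s x, (k <= N)%N -> (size s <= N)%N ->
        enorm x ^+ k * cmod (partial s psi x) <= M) ->
     cmod (u psi) <= B * M).

Definition distr_of (f : Rn -> C) : functional :=
  fun psi => cintegral (fun x => f x * psi x).

Definition fourier_distr (u : functional) : functional :=
  fun psi => u (fourier psi).

Definition inv_fourier_distr (u : functional) : functional :=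
  fun psi => u (inv_fourier psi).

Definition sobolev_norm_hat (s : R) (g : Rn -> C) : \bar R :=
  ((\int[@lebesgue_rV R n]_xi
      ((1 + enorm xi ^+ 2) `^ s * cmod (g xi) ^+ 2)%:E) `^ 2^-1)%E.

Definition sobolev (s : R) (u : functional) : Prop :=
  tempered u /\
  exists g : Rn -> C, [/\ cmeasurable g,
    deq (fourier_distr u) (distr_of g) & (sobolev_norm_hat s g < +oo)%E].

(* h is a representative of the L^2 class of F^-1 (e^(i t phi) F f). Here g is
   F f and k is a Borel representative of e^(i t phi) g, which itself need not
   be Borel since phi is only Lebesgue measurable. As F f is unique almost
   everywhere, quantifying g and k existentially loses nothing. *)
Definition is_S (phi : Rn -> R) (f : Rn -> C) (t : R) (h : Rn -> C) : Prop :=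
  [/\ L2 f, L2 h & exists g k : Rn -> C,
    [/\ L2 g, deq (fourier_distr (distr_of f)) (distr_of g),
        L2 k, {ae @lebesgue_rV R n, forall xi, k xi = cexpi (t * phi xi) * g xi}
      & deq (distr_of h) (inv_fourier_distr (distr_of k))]].

End distributions.

Section radial.
Context {R : realType} {n : nat}.
Variable phi : 'rV[R]_n -> R.

Definition radial (w : 'rV[R]_n) : R -> R := fun r => phi (r *: w).

Definition rad1 (r : R) (w : 'rV[R]_n) : R := derive1 (radial w) r.

Definition rad2 (r : R) (w : 'rV[R]_n) : R := derive1 (derive1 (radial w)) r.

End radial.

(* Main.v *)
Require Import Defs.
From HB Require Import structures.
From mathcomp Require Import all_boot all_order all_algebra.
From mathcomp Require Import complex.
From mathcomp Require Import all_classical all_reals all_analysis.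
From mathcomp Require Import measurable_realfun.
From mathcomp Require Import ring lra.

Set Implicit Arguments.
Unset Strict Implicit.
Unset Printing Implicit Defensive.

Import Order.TTheory GRing.Theory Num.Theory.
Import numFieldNormedType.Exports.

Local Open Scope classical_set_scope.
Local Open Scope ring_scope.

(* On the annulus a <= |xi| <= a K the weight |xi|^-n has integral of order ln
   K; hence a wave packet with spectrum eps |xi|^-n there has squared
   H^(n/2) norm of order eps^2 ln K, but height of order eps ln K at the
   point (x_l, t_l) where it is focused. With eps = 64^-l and ln K = 256^l
   the packets sum in H^(n/2) and their heights 4^l blow up.

   Away from time t_l the packet is small if a is large: along each ray the
   phase has derivative t phi' + y.w, large because |phi'| tends to
   infinity, and the bound on phi'' allows one integration by parts. So a_l
   can be chosen to make the l-th packet at most 2^-l for t >= t_(l-1) and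
   |x| bounded by a radius growing with l. The sum then converges locally
   uniformly in t > 0, and is of size 4^j at (x_j, t_j).

   It remains to let (x_j, t_j) meet every region |y - x| < gamma(t)
   infinitely often: run through ever finer nets of growing balls, while t_j
   decreases to 0. *)

(** * Integrals of complex-valued functions *)

(** Enlarging [a] costs no energy, because |xi|^-n dxi is invariant under dilations: the mass of the
    annulus depends on K alone. Each [a l] is chosen from its own radius and time gap, so the annuli
    may overlap, and the packets are summed without orthogonality: energies of order 16^-l leave
    room for a weight 4^l that yields a pointwise majorant.

    Two obstacles shape the rest. First, [phi] is merely Lebesgue measurable. The packets carry a
    Borel version [phit], while the radial hypotheses concern [phi]; the two meet because a null set
    cuts almost every ray in a null set. Second, the sum must be identified as S^phi f in L^2. Only
    bounded integrable functions are transformed (single packets and Schwartz functions); the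
    Plancherel bound and the duality identities are proved for these by damping and pass to the sum
    term by term.

    Polar coordinates are used for nonnegative integrands only. Oscillation is recovered by
    integrating 1 + cos(theta + phase) and subtracting the known mass; the free angle theta then
    gives both signs, and both real and imaginary parts. *)

Section cmod_theory.
Context {R : realType}.
Implicit Types z w : R[i].
Local Open Scope complex_scope.

Lemma cmod_ge0 z : 0 <= cmod z.
Proof. by case: z => a b; exact: sqrtr_ge0. Qed.

Lemma cmodM z w : cmod (z * w) = cmod z * cmod w.
Proof. exact: Normc.normcM. Qed.

Lemma cmodD z w : cmod (z + w) <= cmod z + cmod w.
Proof. exact: le_normcD. Qed.

Lemma cmodN z : cmod (- z) = cmod z.
Proof. exact: normcN. Qed.

Lemma cmod0 : cmod (0 : R[i]) = 0.
Proof. exact: Normc.normc0. Qed.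

Lemma cmodC (x : R) : cmod x%:C = `|x|.
Proof. by rewrite /cmod /= expr0n addr0 sqrtr_sqr. Qed.

Lemma cmod_sqr z : cmod z ^+ 2 = complex.Re z ^+ 2 + complex.Im z ^+ 2.
Proof. by case: z => a b /=; rewrite sqr_sqrtr// addr_ge0// sqr_ge0. Qed.

Lemma cmod_conj z : cmod z^*%C = cmod z.
Proof. by case: z => a b; rewrite /cmod /= sqrrN. Qed.

Lemma normr_Re_le z : `|complex.Re z| <= cmod z.
Proof.
rewrite -(@ler_pXn2r _ 2) ?nnegrE ?cmod_ge0// cmod_sqr real_normK ?num_real//.
by rewrite lerDl sqr_ge0.
Qed.

Lemma normr_Im_le z : `|complex.Im z| <= cmod z.
Proof.
rewrite -(@ler_pXn2r _ 2) ?nnegrE ?cmod_ge0// cmod_sqr real_normK ?num_real//.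
by rewrite lerDr sqr_ge0.
Qed.

Lemma cmod_le z : cmod z <= `|complex.Re z| + `|complex.Im z|.
Proof.
rewrite -(@ler_pXn2r _ 2) ?nnegrE ?addr_ge0 ?cmod_ge0//.
rewrite cmod_sqr sqrrD !real_normK ?num_real// lerD2r lerDl.
by rewrite mulrn_wge0// mulr_ge0.
Qed.

Lemma cmod_eq0 z : cmod z = 0 -> z = 0.
Proof. by case: z => a b /Normc.eq0_normc. Qed.

Lemma mul_conj z : z^*%C * z = (cmod z ^+ 2)%:C.
Proof.
case: z => a b; rewrite cmod_sqr /=; apply/eqP; rewrite eq_complex /=.
by apply/andP; split; apply/eqP; ring.
Qed.

Lemma cmod_cexpi (a : R) : cmod (cexpi a) = 1.
Proof. by rewrite /cmod /= cos2Dsin2 sqrtr1. Qed.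

Lemma cexpiD (a b : R) : cexpi (a + b) = cexpi a * cexpi b.
Proof.
by rewrite /cexpi cosD sinD; apply/eqP; rewrite eq_complex /= eqxx /= addrC.
Qed.

Lemma cexpi0 : cexpi (0 : R) = 1.
Proof. by rewrite /cexpi cos0 sin0. Qed.

Lemma cexpiN (a : R) : cexpi (- a) = (cexpi a)^*%C.
Proof. by rewrite /cexpi cosN sinN. Qed.

Lemma cReD z w : complex.Re (z + w) = complex.Re z + complex.Re w.
Proof. by case: z; case: w. Qed.

Lemma cImD z w : complex.Im (z + w) = complex.Im z + complex.Im w.
Proof. by case: z; case: w. Qed.

Lemma cReM z w : complex.Re (z * w) =
  complex.Re z * complex.Re w - complex.Im z * complex.Im w.
Proof. by case: z; case: w. Qed.

Lemma cImM z w : complex.Im (z * w) =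
  complex.Re z * complex.Im w + complex.Im z * complex.Re w.
Proof. by case: z; case: w => a b c d /=. Qed.

Lemma Re_conj z : complex.Re z^*%C = complex.Re z.
Proof. by case: z. Qed.

Lemma Im_conj z : complex.Im z^*%C = - complex.Im z.
Proof. by case: z. Qed.

Lemma cRe_realM (x : R) z : complex.Re (x%:C * z) = x * complex.Re z.
Proof. by rewrite cReM /= mul0r subr0. Qed.

Lemma cIm_realM (x : R) z : complex.Im (x%:C * z) = x * complex.Im z.
Proof. by rewrite cImM /= mul0r addr0. Qed.

Lemma complex_ext z w :
  complex.Re z = complex.Re w -> complex.Im z = complex.Im w -> z = w.
Proof. by case: z; case: w => a b c d /= -> ->. Qed.

Lemma cmod_sum (I : Type) (r : seq I) (P : pred I) (F : I -> R[i]) :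
  cmod (\sum_(i <- r | P i) F i) <= \sum_(i <- r | P i) cmod (F i).
Proof.
elim/big_ind2: _ => [|a b c d ab cd|//]; first by rewrite cmod0.
exact: le_trans (cmodD _ _) (lerD ab cd).
Qed.

End cmod_theory.

Section complex_integral.
Context d (T : measurableType d) (R : realType).
Implicit Types (f g : T -> R[i]).
Local Open Scope complex_scope.

Definition cmeas f := measurable_fun setT (fun x => complex.Re (f x)) /\
  measurable_fun setT (fun x => complex.Im (f x)).

Lemma cmeasD f g : cmeas f -> cmeas g -> cmeas (fun x => f x + g x).
Proof.
move=> [rf jf] [rg jg]; split.
  by under eq_fun do rewrite cReD; exact: measurable_funD.
by under eq_fun do rewrite cImD; exact: measurable_funD.
Qed.

Lemma cmeasM f g : cmeas f -> cmeas g -> cmeas (fun x => f x * g x).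
Proof.
move=> [rf jf] [rg jg]; split.
  under eq_fun do rewrite cReM.
  by apply: measurable_funB; exact: measurable_funM.
under eq_fun do rewrite cImM.
by apply: measurable_funD; exact: measurable_funM.
Qed.

Lemma cmeas_cst z : cmeas (fun=> z).
Proof. by split; exact: measurable_cst. Qed.

Lemma cmeas_conj f : cmeas f -> cmeas (fun x => (f x)^*%C).
Proof.
move=> [rf jf]; split.
  by under eq_fun do rewrite Re_conj.
under eq_fun do rewrite Im_conj.
exact: measurableT_comp.
Qed.

Lemma cmeas_real (h : T -> R) : measurable_fun setT h -> cmeas (fun x => (h x)%:C).
Proof. by move=> mh; split => //=; exact: measurable_cst. Qed.

Lemma cmeas_cexpi (h : T -> R) :
  measurable_fun setT h -> cmeas (fun x => cexpi (h x)).
Proof.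
move=> mh; split => /=; apply: measurableT_comp => //.
  by apply: continuous_measurable_fun; exact: continuous_cos.
by apply: continuous_measurable_fun; exact: continuous_sin.
Qed.

Lemma cmeas_sum I (r : seq I) (F : I -> T -> R[i]) :
  (forall i, cmeas (F i)) -> cmeas (fun x => \sum_(i <- r) F i x).
Proof.
move=> mF; elim: r => [|i r IH].
  by under eq_fun do rewrite big_nil; exact: cmeas_cst.
by under eq_fun do rewrite big_cons; exact: cmeasD.
Qed.

Lemma measurable_cmod f : cmeas f -> measurable_fun setT (fun x => cmod (f x)).
Proof.
move=> [rf jf].
have -> : (fun x => cmod (f x)) =
    (fun x => Num.sqrt (complex.Re (f x) ^+ 2 + complex.Im (f x) ^+ 2)).
  by apply/funext => x; case: (f x).
apply: (@measurableT_comp _ _ _ _ _ _ (@Num.sqrt R)).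
  by apply: continuous_measurable_fun; exact: sqrt_continuous.
by apply: measurable_funD; exact: measurable_funX.
Qed.

Variable mu : {measure set T -> \bar R}.

Definition cintg f := cmeas f /\ (\int[mu]_x (cmod (f x))%:E < +oo)%E.

Definition cint f : R[i] :=
  (\int[mu]_x complex.Re (f x)) +i* (\int[mu]_x complex.Im (f x)).

Lemma cintg_cmod f : cintg f -> mu.-integrable setT (fun x => (cmod (f x))%:E).
Proof.
move=> [mf foo]; apply/integrableP; split.
  by apply/measurable_EFinP; exact: measurable_cmod.
under eq_integral => x _ do
  rewrite gee0_abs ?lee_fin ?cmod_ge0//.
exact: foo.
Qed.

Lemma le_cintg f (h : T -> R) : cmeas f -> (forall x, cmod (f x) <= h x) ->
  mu.-integrable setT (EFin \o h) -> cintg f.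
Proof.
move=> mf fh ih; split=> //.
have : mu.-integrable setT (fun x => (cmod (f x))%:E).
  apply: (le_integrable measurableT _ _ ih) => //.
    by apply/measurable_EFinP; exact: measurable_cmod.
  move=> x _ /=; rewrite lee_fin (ger0_norm (cmod_ge0 _)).
  exact: le_trans (fh x) (ler_norm _).
move=> /integrableP[_]; apply: le_lt_trans; apply: ge0_le_integral => //.
- by move=> x _; rewrite lee_fin cmod_ge0.
- by apply/measurable_EFinP; exact: measurable_cmod.
- by apply/measurable_EFinP; apply: measurableT_comp => //; exact: measurable_cmod.
- by move=> x _; rewrite lee_fin ler_norm.
Qed.

Lemma cintg_le f g : cmeas f -> (forall x, cmod (f x) <= cmod (g x)) ->
  cintg g -> cintg f.
Proof. by move=> mf fg /cintg_cmod ig; apply: (le_cintg mf fg). Qed.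

Lemma cintg_Re f : cintg f -> mu.-integrable setT (fun x => (complex.Re (f x))%:E).
Proof.
move=> cf; apply: (le_integrable measurableT _ _ (cintg_cmod cf)) => //.
  by apply/measurable_EFinP; case: cf => -[].
by move=> x _ /=; rewrite lee_fin (ger0_norm (cmod_ge0 _)) normr_Re_le.
Qed.

Lemma cintg_Im f : cintg f -> mu.-integrable setT (fun x => (complex.Im (f x))%:E).
Proof.
move=> cf; apply: (le_integrable measurableT _ _ (cintg_cmod cf)) => //.
  by apply/measurable_EFinP; case: cf => -[].
by move=> x _ /=; rewrite lee_fin (ger0_norm (cmod_ge0 _)) normr_Im_le.
Qed.

Lemma cintg_real (h : T -> R) : mu.-integrable setT (EFin \o h) ->
  cintg (fun x => (h x)%:C).
Proof.
move=> ih; apply: (@le_cintg _ (fun x => `|h x|)).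
- by apply: cmeas_real; apply/measurable_EFinP; exact: measurable_int ih.
- by move=> x; rewrite cmodC.
- exact: integrable_norm.
Qed.

Lemma cintgD f g : cintg f -> cintg g -> cintg (fun x => f x + g x).
Proof.
move=> cf cg; apply: (@le_cintg _ (fun x => cmod (f x) + cmod (g x))).
- by apply: cmeasD; [case: cf|case: cg].
- by move=> x; exact: cmodD.
- have := integrableD measurableT (cintg_cmod cf) (cintg_cmod cg).
  exact: eq_integrable.
Qed.

Lemma cintgZ (z : R[i]) f : cintg f -> cintg (fun x => z * f x).
Proof.
move=> cf; apply: (@le_cintg _ (fun x => cmod z * cmod (f x))).
- by apply: cmeasM; [exact: cmeas_cst|case: cf].
- by move=> x; rewrite cmodM.
- have := @integrableZl _ _ _ mu _ measurableT (cmod z) _ (cintg_cmod cf).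
  exact: eq_integrable.
Qed.

Lemma cintg_bounded (M : R) f g : cmeas f -> (forall x, cmod (f x) <= M) ->
  cintg g -> cintg (fun x => f x * g x).
Proof.
move=> mf fM cg; apply: (@le_cintg _ (fun x => M * cmod (g x))).
- by apply: cmeasM => //; case: cg.
- by move=> x; rewrite cmodM ler_wpM2r// cmod_ge0.
- have := @integrableZl _ _ _ mu _ measurableT M _ (cintg_cmod cg).
  exact: eq_integrable.
Qed.

Lemma cintg_cexpi (h : T -> R) g : measurable_fun setT h ->
  cintg g -> cintg (fun x => cexpi (h x) * g x).
Proof.
move=> mh; apply: (@cintg_bounded 1); first exact: cmeas_cexpi.
by move=> x; rewrite cmod_cexpi.
Qed.

Lemma cintD f g : cintg f -> cintg g ->
  cint (fun x => f x + g x) = cint f + cint g.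
Proof.
move=> cf cg; apply: complex_ext; rewrite ?cReD ?cImD /=.
- under eq_Rintegral do rewrite cReD.
  by rewrite RintegralD//; exact: cintg_Re.
- under eq_Rintegral do rewrite cImD.
  by rewrite RintegralD//; exact: cintg_Im.
Qed.

Lemma cintZ (z : R[i]) f : cintg f -> cint (fun x => z * f x) = z * cint f.
Proof.
move=> cf; have rf := cintg_Re cf; have jf := cintg_Im cf.
have Zi (a : R) (h : T -> R) : mu.-integrable setT (EFin \o h) ->
    mu.-integrable setT (fun x => (a * h x)%:E).
  move=> ih; have := @integrableZl _ _ _ mu _ measurableT a _ ih.
  exact: eq_integrable.
apply: complex_ext; rewrite ?cReM ?cImM /=.
- under eq_Rintegral do rewrite cReM.
  by rewrite RintegralB// ?RintegralZl//; exact: Zi.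
- under eq_Rintegral do rewrite cImM.
  by rewrite RintegralD// ?RintegralZl//; exact: Zi.
Qed.

Lemma cint0 : cint (fun=> 0) = 0.
Proof. by apply: complex_ext; rewrite /= /Rintegral integral0. Qed.

Lemma cintg0 : cintg (fun=> 0).
Proof.
split; first exact: cmeas_cst.
by under eq_integral do rewrite cmod0; rewrite integral0.
Qed.

Lemma cintg_sum I (r : seq I) (F : I -> T -> R[i]) : (forall i, cintg (F i)) ->
  cintg (fun x => \sum_(i <- r) F i x).
Proof.
move=> cF; elim: r => [|i r IH].
  by under eq_fun do rewrite big_nil; exact: cintg0.
by under eq_fun do rewrite big_cons; exact: cintgD.
Qed.

Lemma cint_sum I (r : seq I) (F : I -> T -> R[i]) : (forall i, cintg (F i)) ->
  cint (fun x => \sum_(i <- r) F i x) = \sum_(i <- r) cint (F i).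
Proof.
move=> cF; elim: r => [|i r IH].
  by under eq_fun do rewrite big_nil; rewrite big_nil cint0.
under eq_fun do rewrite big_cons.
by rewrite cintD ?IH ?big_cons//; exact: cintg_sum.
Qed.

Lemma cint_real (h : T -> R) : cint (fun x => (h x)%:C) = (\int[mu]_x h x)%:C.
Proof. by apply: complex_ext => //=; rewrite /Rintegral integral0. Qed.

Lemma cint_conj f : cintg f -> cint (fun x => (f x)^*%C) = (cint f)^*%C.
Proof.
move=> cf; apply: complex_ext => /=.
  by apply: eq_Rintegral => x _; rewrite Re_conj.
under eq_Rintegral do rewrite Im_conj -mulN1r.
by rewrite RintegralZl ?mulN1r//; exact: cintg_Im.
Qed.

Lemma cmod_cint_le f : cintg f -> cmod (cint f) <= \int[mu]_x cmod (f x).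
Proof.
move=> cf; have [/cmod_eq0->|z0] := eqVneq (cmod (cint f)) 0.
  by rewrite cmod0; apply: Rintegral_ge0 => x _; exact: cmod_ge0.
have zp : 0 < cmod (cint f) by rewrite lt_neqAle eq_sym z0 cmod_ge0.
rewrite -(ler_pM2l zp) -expr2.
(* Multiplication by the conjugate of the integral turns it into its squared modulus, a real number,
   so that only a real part remains to be estimated. *)
have -> : cmod (cint f) ^+ 2 = complex.Re (cint (fun x => (cint f)^*%C * f x)).
  by rewrite cintZ// mul_conj.
rewrite -RintegralZl//; last exact: cintg_cmod.
have cg : cintg (fun x => (cint f)^*%C * f x) by exact: cintgZ.
apply: le_Rintegral => //.
- exact: cintg_Re.
- have := @integrableZl _ _ _ mu _ measurableT (cmod (cint f)) _ (cintg_cmod cf).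
  exact: eq_integrable.
- move=> x _; apply: le_trans (ler_norm _) _.
  by rewrite (le_trans (normr_Re_le _))// cmodM cmod_conj.
Qed.

Lemma eq_cint f g : f =1 g -> cint f = cint g.
Proof. by move=> /funext ->. Qed.

Lemma ae_eq_cint f g : cmeas f -> cmeas g ->
  {ae mu, forall x, f x = g x} -> cint f = cint g.
Proof.
move=> [rf jf] [rg jg] fg; congr (_ +i* _); congr fine;
  apply: ae_eq_integral => //; try exact/measurable_EFinP;
  by apply: filterS fg => x -> _.
Qed.

Lemma cint_dominated (F : nat -> T -> R[i]) f (h : T -> R) :
  (forall n, cmeas (F n)) -> cmeas f ->
  {ae mu, forall x, (fun n => complex.Re (F n x)) @ \oo --> complex.Re (f x) /\
     (fun n => complex.Im (F n x)) @ \oo --> complex.Im (f x)} ->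
  mu.-integrable setT (EFin \o h) ->
  {ae mu, forall x n, cmod (F n x) <= h x} ->
  cintg f /\
  ((fun n => complex.Re (cint (F n))) @ \oo --> complex.Re (cint f) /\
   (fun n => complex.Im (cint (F n))) @ \oo --> complex.Im (cint f)).
Proof.
move=> mF mf Ff ih Fh.
have H (p : R[i] -> R) : (forall z, `|p z| <= cmod z) ->
    (forall n, measurable_fun setT (fun x => p (F n x))) ->
    measurable_fun setT (fun x => p (f x)) ->
    {ae mu, forall x, (fun n => p (F n x)) @ \oo --> p (f x)} ->
    mu.-integrable setT (fun x => (p (f x))%:E) /\
    (fun n => \int[mu]_x p (F n x)) @ \oo --> \int[mu]_x p (f x).
  move=> pc mpF mpf pF.
  have [] := @dominated_convergence _ _ _ mu setT measurableT
    (fun n x => (p (F n x))%:E) (fun x => (p (f x))%:E) (EFin \o h).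
  - by move=> n; exact/measurable_EFinP.
  - exact/measurable_EFinP.
  - by apply: filterS pF => x pFx _; apply: cvg_EFin => //; exact: nearW.
  - exact: ih.
  - apply: filterS Fh => x Fx n _ /=; rewrite lee_fin.
    exact: le_trans (pc _) (Fx n).
  move=> ipf _ pcv; split=> //; apply: fine_cvg; rewrite fineK//.
  exact: integrable_fin_num.
have [irf rcv] := H (@complex.Re R) normr_Re_le (fun n => (mF n).1) mf.1
  (filterS (fun x => @proj1 _ _) Ff).
have [ijf jcv] := H (@complex.Im R) normr_Im_le (fun n => (mF n).2) mf.2
  (filterS (fun x => @proj2 _ _) Ff).
split=> //.
apply: (@le_cintg _ (fun x => `|complex.Re (f x)| + `|complex.Im (f x)|)) => //.
  by move=> x; exact: cmod_le.
have := integrableD measurableT (integrable_norm irf) (integrable_norm ijf).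
exact: eq_integrable.
Qed.

End complex_integral.

(** * Fubini's theorem for complex integrands *)

Section complex_fubini.
Context d1 d2 (T1 : measurableType d1) (T2 : measurableType d2) (R : realType).
Variables (m1 : {sigma_finite_measure set T1 -> \bar R})
  (m2 : {sigma_finite_measure set T2 -> \bar R}).
Local Open Scope complex_scope.

Lemma cint_fubini (F : T1 * T2 -> R[i]) : cintg (m1 \x m2)%E F ->
  cint m1 (fun x => cint m2 (fun y => F (x, y))) =
  cint m2 (fun y => cint m1 (fun x => F (x, y))).
Proof.
move=> cF.
have H (p : R[i] -> R) :
    (m1 \x m2)%E.-integrable setT (fun x => (p (F x))%:E) ->
    \int[m1]_x \int[m2]_y p (F (x, y)) = \int[m2]_y \int[m1]_x p (F (x, y)).
  move=> ip; have := Fubini ip; rewrite /Rintegral.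
  have e1 := measurable_fubini_F ip; have e2 := measurable_fubini_G ip.
  move=> E; congr fine.
  (* On a null set of x the section need not be integrable, and [fine] then returns a default value;
     so real and extended iterated integrals are compared almost everywhere only. *)
  transitivity (\int[m1]_x \int[m2]_y (p (F (x, y)))%:E)%E.
    apply: ae_eq_integral => //; last first.
    - have := ae_integrable1 ip; apply: filterS => x ix _ /=.
      by rewrite fineK//; exact: integrable_fin_num.
    - by apply/measurable_EFinP; apply: measurableT_comp => //; exact: e1.
  rewrite E; apply: ae_eq_integral => //; last first.
  - have := ae_integrable2 ip; apply: filterS => x ix _ /=.
    by rewrite fineK//; exact: integrable_fin_num.
  - by apply/measurable_EFinP; apply: measurableT_comp => //; exact: e2.
by congr (_ +i* _); apply: H; [exact: cintg_Re|exact: cintg_Im].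
Qed.

Lemma cmeas_cint2 (F : T1 * T2 -> R[i]) : cintg (m1 \x m2)%E F ->
  cmeas (fun x => cint m2 (fun y => F (x, y))).
Proof.
move=> cF; split; apply: measurableT_comp => //.
  exact: measurable_int (integrable_fubini_F (cintg_Re cF)).
exact: measurable_int (integrable_fubini_F (cintg_Im cF)).
Qed.

End complex_fubini.

(** * Euclidean geometry of R^n and comparison with the sup norm *)

Section rV_geometry.
Context {R : realType} {n : nat}.
Implicit Types x y z : 'rV[R]_n.

Lemma dotC x y : dot x y = dot y x.
Proof. by apply: eq_bigr => i _; rewrite mulrC. Qed.

Lemma dotDl x y z : dot (x + y) z = dot x z + dot y z.
Proof. by rewrite -big_split; apply: eq_bigr => i _; rewrite mxE mulrDl. Qed.

Lemma dotDr x y z : dot x (y + z) = dot x y + dot x z.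
Proof. by rewrite dotC dotDl !(dotC x). Qed.

Lemma dotZl (c : R) x y : dot (c *: x) y = c * dot x y.
Proof. by rewrite /dot mulr_sumr; apply: eq_bigr => i _; rewrite mxE mulrA. Qed.

Lemma dotZr (c : R) x y : dot x (c *: y) = c * dot x y.
Proof. by rewrite dotC dotZl dotC. Qed.

Lemma dotNl x y : dot (- x) y = - dot x y.
Proof. by rewrite -scaleN1r dotZl mulN1r. Qed.

Lemma dotBl x y z : dot (x - y) z = dot x z - dot y z.
Proof. by rewrite dotDl dotNl. Qed.

Lemma dotBr x y z : dot x (y - z) = dot x y - dot x z.
Proof. by rewrite dotC dotBl !(dotC x). Qed.

Lemma dot_ge0 x : 0 <= dot x x.
Proof. by apply: sumr_ge0 => i _; rewrite -expr2 sqr_ge0. Qed.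

Lemma enorm_ge0 x : 0 <= enorm x.
Proof. exact: sqrtr_ge0. Qed.

Lemma enorm_sqr x : enorm x ^+ 2 = dot x x.
Proof. by rewrite sqr_sqrtr// dot_ge0. Qed.

Lemma enormZ (c : R) x : enorm (c *: x) = `|c| * enorm x.
Proof.
by rewrite /enorm dotZl dotZr mulrA -expr2 sqrtrM ?sqr_ge0// sqrtr_sqr.
Qed.

Lemma enormN x : enorm (- x) = enorm x.
Proof. by rewrite -scaleN1r enormZ normrN1 mul1r. Qed.

Lemma coord_le_enorm x i : `|x ord0 i| <= enorm x.
Proof.
rewrite -(@ler_pXn2r _ 2) ?nnegrE ?enorm_ge0// enorm_sqr real_normK ?num_real//.
rewrite /dot (bigD1 i)//= -expr2 lerDl; apply: sumr_ge0 => j _.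
by rewrite -expr2 sqr_ge0.
Qed.

Lemma enorm_eq0 x : enorm x = 0 -> x = 0.
Proof.
move=> x0; apply/rowP => i; rewrite mxE; apply/normr0_eq0/eqP.
by rewrite eq_le normr_ge0 andbT -x0 coord_le_enorm.
Qed.

(** Cauchy-Schwarz: expand the nonnegative square of |y| x - |x| y and cancel |x| |y|, the case of a
    vanishing norm being trivial. *)
Lemma dot_le x y : dot x y <= enorm x * enorm y.
Proof.
have [x0|x0] := eqVneq (enorm x) 0.
  rewrite x0 mul0r (enorm_eq0 x0) /dot big1// => i _.
  by rewrite mxE mul0r.
have [y0|y0] := eqVneq (enorm y) 0.
  rewrite y0 mulr0 (enorm_eq0 y0) /dot big1// => i _.
  by rewrite mxE mulr0.
have ab : 0 < enorm x * enorm y.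
  by rewrite mulr_gt0// lt_neqAle eq_sym ?x0 ?y0 enorm_ge0.
rewrite -(ler_pM2l ab).
have := dot_ge0 (enorm y *: x - enorm x *: y).
rewrite !(dotBl, dotBr, dotZl, dotZr) -!enorm_sqr (dotC y x).
set a := enorm x; set b := enorm y; set c := dot x y => H.
by rewrite -subr_ge0; nra.
Qed.

Lemma normr_dot_le x y : `|dot x y| <= enorm x * enorm y.
Proof.
by rewrite ler_norml dot_le andbT lerNl -dotNl -(enormN x) dot_le.
Qed.

Lemma enormD x y : enorm (x + y) <= enorm x + enorm y.
Proof.
rewrite -(@ler_pXn2r _ 2) ?nnegrE ?addr_ge0 ?enorm_ge0//.
rewrite enorm_sqr dotDl !dotDr -!enorm_sqr (dotC y x).
by have := dot_le x y; set c := dot x y => H; nra.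
Qed.

Lemma enormB x y : enorm (x - y) <= enorm x + enorm y.
Proof. by rewrite -(enormN y) enormD. Qed.

Lemma mx_norm_le_enorm x : `|x| <= enorm x.
Proof.
have [x0|x0] := eqVneq (mx_norm x) 0.
  by rewrite (x0 : `|x| = 0) enorm_ge0.
have [[i j] /= xij] := mx_norm_neq0 x0.
by rewrite (xij : `|x| = _) ord1 coord_le_enorm.
Qed.

Lemma coord_le_mx_norm x i : `|x ord0 i| <= `|x|.
Proof.
rewrite [leRHS]mx_normrE.
exact: (@le_bigmax _ _ _ 0 (fun ij : 'I_1 * 'I_n => `|x ij.1 ij.2|) (ord0, i)).
Qed.

Lemma enorm_le_mx_norm x : enorm x <= n%:R * `|x|.
Proof.
rewrite -(@ler_pXn2r _ 2) ?nnegrE ?mulr_ge0 ?enorm_ge0// enorm_sqr.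
apply: (@le_trans _ _ (\sum_(i < n) `|x| ^+ 2)).
  apply: ler_sum => i _; rewrite -expr2 -real_normK ?num_real//.
  by rewrite ler_pXn2r ?nnegrE// coord_le_mx_norm.
rewrite sumr_const card_ord exprMn -[leLHS]mulr_natl ler_wpM2r ?sqr_ge0//.
by rewrite -natrX ler_nat; case: (n) => // m; rewrite -{1}(expn1 m.+1) leq_pexp2l.
Qed.

Lemma measurable_dot y : measurable_fun setT (fun x => dot y x).
Proof.
apply: measurable_sum => i; apply: measurable_funM => //.
exact: measurable_coord.
Qed.

Lemma measurable_enorm : measurable_fun setT (@enorm R n).
Proof.
apply: (@measurableT_comp _ _ _ _ _ _ (@Num.sqrt R)).
  by apply: continuous_measurable_fun; exact: sqrt_continuous.
by apply: measurable_sum => i; apply: measurable_funM; exact: measurable_coord.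
Qed.

Section comp.
Context d (T : measurableType d).

Lemma measurable_rVD (f g : T -> 'rV[R]_n) : measurable_fun setT f ->
  measurable_fun setT g -> measurable_fun setT (fun t => f t + g t).
Proof.
move=> /measurable_fun_rVP mf /measurable_fun_rVP mg.
apply/measurable_fun_rVP => i; under eq_fun do rewrite mxE.
exact: measurable_funD.
Qed.

Lemma measurable_rVZ (c : T -> R) (f : T -> 'rV[R]_n) : measurable_fun setT c ->
  measurable_fun setT f -> measurable_fun setT (fun t => c t *: f t).
Proof.
move=> mc /measurable_fun_rVP mf.
apply/measurable_fun_rVP => i; under eq_fun do rewrite mxE.
exact: measurable_funM.
Qed.

Lemma measurable_dot2 (f g : T -> 'rV[R]_n) : measurable_fun setT f ->
  measurable_fun setT g -> measurable_fun setT (fun t => dot (f t) (g t)).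
Proof.
move=> /measurable_fun_rVP mf /measurable_fun_rVP mg.
by apply: measurable_sum => i; exact: measurable_funM.
Qed.

End comp.

End rV_geometry.

(** * Integration on R^n: recursion on n, products, affine substitutions *)

Section rV_integral.
Context {R : realType}.
Local Open Scope ereal_scope.
Local Notation mu := (@lebesgue_measure R).

Lemma ge0_integral_rVS n (f : 'rV[R]_n.+1 -> \bar R) :
  measurable_fun setT f -> (forall x, 0 <= f x) ->
  \int[lebesgue_rV n.+1]_x f x =
  \int[mu]_x \int[lebesgue_rV n]_v f (rV_cons (x, v)).
Proof.
move=> mf f0.
have mf' : measurable_fun setT (f \o @rV_cons R n).
  by apply: measurableT_comp => //; exact: measurable_rV_cons.
transitivity (\int[mu \x lebesgue_rV n]_z (f \o @rV_cons R n) z); last first.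
  by rewrite fubini_tonelli1//= => p; exact: f0.
have := @ge0_integral_pushforward _ _ (measurableTypeR R * 'rV[R]_n)%type _ R
  _ (@measurable_rV_cons R n) (mu \x lebesgue_rV n) setT f measurableT.
by rewrite preimage_setT => /(_ mf)<-.
Qed.

Lemma ge0_integral_prod n (f : 'I_n -> R -> R) :
  (forall i, measurable_fun setT (f i)) -> (forall i x, (0 <= f i x)%R) ->
  \int[lebesgue_rV n]_x (\prod_(i < n) f i (x ord0 i))%:E =
  \prod_(i < n) \int[mu]_x (f i x)%:E.
Proof.
elim: n f => [|n IH] f mf f0.
  rewrite big_ord0 integral_dirac//.
    by rewrite diracT mul1e big_ord0.
  apply/measurable_EFinP; under eq_fun do rewrite big_ord0.
  exact: measurable_cst.
have mp m (g : 'I_m -> R -> R) : (forall i, measurable_fun setT (g i)) ->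
    measurable_fun setT (fun x : 'rV[R]_m => (\prod_(i < m) g i (x ord0 i))%:E).
  move=> mg; apply/measurable_EFinP; apply: measurable_prod => i _.
  by apply: measurableT_comp => //; exact: measurable_coord.
rewrite ge0_integral_rVS//; last 2 first.
- exact: mp.
- by move=> x; rewrite lee_fin; apply: prodr_ge0 => i _; exact: f0.
rewrite big_ord_recl /= -IH//.
set K := \int[lebesgue_rV n]_x _.
transitivity (\int[mu]_x ((f ord0 x)%:E * K)).
  apply: eq_integral => x _.
  rewrite /K -ge0_integralZl//; last 3 first.
  - by apply: (mp n (fun i => f (lift ord0 i))).
  - by move=> y _; rewrite lee_fin; apply: prodr_ge0 => i _; exact: f0.
  - by rewrite lee_fin.
  apply: eq_integral => v _; rewrite -EFinM big_ord_recl rV_consE0; congr (_ * _)%:E.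
  by apply: eq_bigr => i _; rewrite rV_consES.
rewrite ge0_integralZr//.
- by apply/measurable_EFinP; exact: (mf ord0).
- by move=> x _; rewrite lee_fin.
apply: integral_ge0 => y _; rewrite lee_fin.
by apply: prodr_ge0 => i _; exact: f0.
Qed.

(** Both sides are measures of [A], and Lebesgue measure is determined by its values on the
    intervals ]u, v], where the identity is a computation of lengths. *)
Lemma lebesgue_measure_affine (a c : R) (A : set R) : (0 < c)%R -> measurable A ->
  c%:E * mu ((fun x : R => a + c * x)%R @^-1` A) = mu A.
Proof.
move=> c0 mA; pose T : measurableTypeR R -> measurableTypeR R := fun x : R => (a + c * x)%R.
have mT : measurable_fun setT T.
  by apply: measurable_funD => //; apply: measurable_funM.
pose nu := mscale (NngNum (ltW c0)) (pushforward mu T).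
change (nu mT A = mu A).
apply/esym/lebesgue_measure_unique => //= _ [[u v]] _ <-.
rewrite /nu /mscale /=.
rewrite (_ : pushforward _ _ _ = mu (T @^-1` `]u, v]%classic))//.
have -> : T @^-1` `]u, v]%classic = `]((u - a) / c)%R, ((v - a) / c)%R]%classic.
  apply/seteqP; split=> x /=; rewrite !in_itv /= ltr_pdivrMr// ler_pdivlMr//;
    rewrite /T (mulrC x) ltrBlDl lerBrDl//.
rewrite !lebesgue_measure_itv/= !lte_fin ltr_pM2r ?invr_gt0// ltrD2r.
case: ifP => _; last by rewrite mule0.
by rewrite -!EFinD -EFinM; congr EFin; field; rewrite gt_eqF.
Qed.

Lemma ge0_integral_affine1 (a c : R) (f : R -> \bar R) : (0 < c)%R ->
  measurable_fun setT f -> (forall x, 0 <= f x) ->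
  \int[mu]_x f x = c%:E * \int[mu]_x f (a + c * x)%R.
Proof.
move=> c0 mf f0; pose T : measurableTypeR R -> measurableTypeR R := fun x : R => (a + c * x)%R.
have mT : measurable_fun setT T.
  by apply: measurable_funD => //; apply: measurable_funM.
have := @ge0_integral_pushforward _ _ _ _ _ _ mT mu setT f measurableT mf.
rewrite preimage_setT => <-; last by move=> x _; exact: f0.
have <- := @ge0_integral_mscale _ _ _ (pushforward mu T) setT measurableT
  (NngNum (ltW c0)) f mf (fun x _ => f0 x).
apply: eq_measure_integral => A mA _.
exact: (esym (lebesgue_measure_affine a c0 mA)).
Qed.

(** Each coordinate contributes one factor c: the inner integral is rescaled by induction, the outer
    one by the one-dimensional case. *)
Lemma ge0_integral_affine n (a : 'rV[R]_n) (c : R) (f : 'rV[R]_n -> \bar R) :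
  (0 < c)%R -> measurable_fun setT f -> (forall x, 0 <= f x) ->
  \int[lebesgue_rV n]_x f x =
  (c ^+ n)%:E * \int[lebesgue_rV n]_x f (a + c *: x)%R.
Proof.
move=> c0; elim: n a f => [|n IH] a f mf f0.
  rewrite expr0 mul1e; apply: eq_integral => x _; congr f.
  by apply/rowP => -[].
have maff m (b : 'rV[R]_m) : measurable_fun setT (fun x : 'rV[R]_m => b + c *: x)%R.
  by apply: measurable_rVD => //; apply: measurable_rVZ.
rewrite ge0_integral_rVS// ge0_integral_rVS//; last first.
  exact: (measurableT_comp mf (maff _ a)).
pose a' : 'rV[R]_n := (rV_uncons a).2.
pose F x := \int[lebesgue_rV n]_v f (rV_cons (x, (a' + c *: v)%R)).
have mG : measurable_fun setT (fun p : R * 'rV[R]_n => f (rV_cons (p.1, (a' + c *: p.2)%R))).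
  apply: (measurableT_comp mf); apply: (measurableT_comp (@measurable_rV_cons R n)).
  apply/measurable_fun_pairP; split.
    exact: measurable_fst.
  by apply: (measurable_rVD (f := fun=> a')) => //; apply: measurable_rVZ.
have mF : measurable_fun setT F.
  have := @measurable_fun_fubini_tonelli_F _ _ (measurableTypeR R) _ _ (lebesgue_rV n) _ mG.
  by apply => p; exact: f0.
transitivity (\int[mu]_x ((c ^+ n)%:E * F x)).
  apply: eq_integral => x _; rewrite (IH a')//.
  apply: (measurableT_comp mf); apply: (measurableT_comp (@measurable_rV_cons R n)).
  apply/measurable_fun_pairP; split; first exact: measurable_cst.
  exact: measurable_id.
have F0 x : 0 <= F x by exact: integral_ge0.
rewrite ge0_integralZl//; last by rewrite lee_fin exprn_ge0// ltW.
rewrite (ge0_integral_affine1 (a ord0 ord0) c0 mF F0).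
rewrite muleA -EFinM -exprSr.
congr (_ * _); apply: eq_integral => x _; apply: eq_integral => v _; congr f.
apply/rowP => i; have [j ->|->] := unliftP ord0 i.
  by rewrite rV_consES mxE [RHS]mxE mxE [in RHS]mxE rV_consES mxE.
by rewrite rV_consE0 mxE [in RHS]mxE rV_consE0.
Qed.

Lemma integrable_affine n (a : 'rV[R]_n) (c : R) (f : 'rV[R]_n -> \bar R) :
  (0 < c)%R -> (lebesgue_rV n).-integrable setT f ->
  (lebesgue_rV n).-integrable setT (fun x => f (a + c *: x)%R) /\
  \int[lebesgue_rV n]_x f x =
  (c ^+ n)%:E * \int[lebesgue_rV n]_x f (a + c *: x)%R.
Proof.
move=> c0 fi.
have maff : measurable_fun setT (fun x : 'rV[R]_n => a + c *: x)%R.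
  by apply: measurable_rVD => //; apply: measurable_rVZ.
have mf : measurable_fun setT f by exact: measurable_int fi.
have cn : (0 < c ^+ n)%R by rewrite exprn_gt0.
have fi' : (lebesgue_rV n).-integrable setT (fun x => f (a + c *: x)%R).
  apply/integrableP; split; first exact: (measurableT_comp mf maff).
  move: fi => /integrableP[_]; rewrite (ge0_integral_affine a c0)//=; last first.
    exact: measurableT_comp.
  set I := \int[_]_x _; have : 0 <= I by exact: integral_ge0.
  case: I => [r _ _|_|//]; first exact: ltry.
  by rewrite gt0_muley// lte_fin.
split=> //.
rewrite [LHS]integralE.
rewrite (ge0_integral_affine a c0 (measurable_funepos mf) (funepos_ge0 f)).
rewrite (ge0_integral_affine a c0 (measurable_funeneg mf) (funeneg_ge0 f)).
have D := integrable_add_def measurableT fi'.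
rewrite [X in _ = _ * X](integralE _ _ (fun x : 'rV[R]_n => f (a + c *: x)%R)) (muleBr _ D)//.
by congr (_ * _ - _ * _); apply: eq_integral => x _; rewrite ?funeposE ?funenegE.
Qed.

End rV_integral.

Section rV_complex_integral.
Context {R : realType}.
Local Open Scope complex_scope.
Local Notation mu := (@lebesgue_measure R).

Lemma cintP_EFin d (T : measurableType d) (m : {measure set T -> \bar R})
    (f : T -> R[i]) : cintg m f ->
  ((cmod (cint m f))%:E <= \int[m]_x (cmod (f x))%:E)%E.
Proof.
move=> cf; have := cmod_cint_le cf; rewrite -lee_fin /Rintegral fineK//.
exact: (integrable_fin_num measurableT (cintg_cmod cf)).
Qed.

Lemma cint_prod_meas d1 d2 (T1 : measurableType d1) (T2 : measurableType d2)
    (m1 : {sigma_finite_measure set T1 -> \bar R})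
    (m2 : {sigma_finite_measure set T2 -> \bar R}) (F : T1 * T2 -> R[i]) :
  cintg (m1 \x m2)%E F ->
  cint (m1 \x m2)%E F = cint m1 (fun x => cint m2 (fun y => F (x, y))).
Proof.
move=> cF.
have H (p : R[i] -> R) :
    (m1 \x m2)%E.-integrable setT (fun x => (p (F x))%:E) ->
    \int[(m1 \x m2)%E]_x p (F x) = \int[m1]_x \int[m2]_y p (F (x, y)).
  move=> ip; rewrite /Rintegral -(integral12_prod_meas1 ip); congr fine.
  have e1 := measurable_fubini_F ip.
  apply: ae_eq_integral => //.
  - by apply/measurable_EFinP; apply: measurableT_comp => //; exact: e1.
  - have := ae_integrable1 ip; apply: filterS => x ix _ /=.
    by rewrite fineK//; exact: integrable_fin_num.
by congr (_ +i* _); apply: H; [exact: cintg_Re|exact: cintg_Im].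
Qed.

Lemma cintg_rVS n (f : 'rV[R]_n.+1 -> R[i]) : cintg (lebesgue_rV n.+1) f ->
  cintg (mu \x lebesgue_rV n)%E (f \o @rV_cons R n).
Proof.
move=> [mf foo]; split.
  have [rf jf] := mf; split.
    exact: (measurableT_comp rf (@measurable_rV_cons R n)).
  exact: (measurableT_comp jf (@measurable_rV_cons R n)).
move: foo; rewrite ge0_integral_rVS//; last 2 first.
- by apply/measurable_EFinP; exact: measurable_cmod.
- by move=> x; rewrite lee_fin cmod_ge0.
rewrite fubini_tonelli1//; last by move=> x; rewrite lee_fin cmod_ge0.
apply/measurable_EFinP.
exact: (measurableT_comp (measurable_cmod mf) (@measurable_rV_cons R n)).
Qed.

Lemma cint_rVS n (f : 'rV[R]_n.+1 -> R[i]) : cintg (lebesgue_rV n.+1) f ->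
  cint (lebesgue_rV n.+1) f =
  cint mu (fun x => cint (lebesgue_rV n) (fun v => f (rV_cons (x, v)))).
Proof.
move=> cf; have cg := cintg_rVS cf; rewrite -(cint_prod_meas cg).
have H (p : R[i] -> R) : measurable_fun setT (fun x => (p (f x))%:E) ->
    (mu \x lebesgue_rV n)%E.-integrable setT (fun x => (p (f (rV_cons x)))%:E) ->
    \int[lebesgue_rV n.+1]_x p (f x) =
    \int[(mu \x lebesgue_rV n)%E]_x p (f (rV_cons x)).
  move=> mp ip; congr fine.
  have := @integral_pushforward _ _ (measurableTypeR R * 'rV[R]_n)%type _ R
    _ (@measurable_rV_cons R n) (mu \x lebesgue_rV n)%E setT _ mp.
  by rewrite preimage_setT => /(_ ip measurableT)<-.
by congr (_ +i* _); apply: H; [exact: measurable_int (cintg_Re cf)|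
  exact: (cintg_Re cg)|exact: measurable_int (cintg_Im cf)|exact: (cintg_Im cg)].
Qed.

Lemma cmeas_prod d (T : measurableType d) I (r : seq I) (F : I -> T -> R[i]) :
  (forall i, cmeas (F i)) -> cmeas (fun x => \prod_(i <- r) F i x).
Proof.
move=> mF; elim: r => [|i r IH].
  by under eq_fun do rewrite big_nil; exact: cmeas_cst.
by under eq_fun do rewrite big_cons; exact: cmeasM.
Qed.

Lemma cmod_prod I (r : seq I) (F : I -> R[i]) :
  cmod (\prod_(i <- r) F i) = \prod_(i <- r) cmod (F i).
Proof.
elim/big_ind2: _ => [|a b c d <- <-|//]; last by rewrite cmodM.
exact: Normc.normc1.
Qed.

Lemma cmeas_coord n (i : 'I_n) (f : R -> R[i]) :
  cmeas f -> cmeas (fun x : 'rV[R]_n => f (x ord0 i)).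
Proof.
by move=> [rf jf]; split;
  [exact: (measurableT_comp rf (measurable_coord i))|
   exact: (measurableT_comp jf (measurable_coord i))].
Qed.

Lemma cintg_prod n (f : 'I_n -> R -> R[i]) : (forall i, cintg mu (f i)) ->
  cintg (lebesgue_rV n) (fun x => \prod_(i < n) f i (x ord0 i)).
Proof.
move=> cf; split.
  by apply: cmeas_prod => i; apply: cmeas_coord; exact: (cf i).1.
under eq_integral do rewrite cmod_prod.
rewrite (@ge0_integral_prod _ _ (fun i x => cmod (f i x)))//; last 2 first.
- by move=> i; exact: (measurable_cmod (cf i).1).
- by move=> i x; exact: cmod_ge0.
suff: (0 <= \prod_(i < n) \int[mu]_x (cmod (f i x))%:E < +oo)%E.
  by case/andP.
elim/big_ind: _ => [|a b /andP[a0 ay] /andP[b0 bz]|i _].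
- by rewrite lee_fin ler01 ltry.
- by rewrite mule_ge0// lte_mul_pinfty// ge0_fin_numE.
- rewrite (cf i).2 andbT; apply: integral_ge0 => x _.
  by rewrite lee_fin cmod_ge0.
Qed.

Lemma cint_prod n (f : 'I_n -> R -> R[i]) : (forall i, cintg mu (f i)) ->
  cint (lebesgue_rV n) (fun x => \prod_(i < n) f i (x ord0 i)) =
  \prod_(i < n) cint mu (f i).
Proof.
elim: n f => [|n IH] f cf.
  rewrite big_ord0; under eq_fun do rewrite big_ord0.
  rewrite /cint /Rintegral !integral_dirac//; try exact: measurable_cst.
  by rewrite diracT !mul1e.
rewrite cint_rVS; last exact: cintg_prod.
rewrite big_ord_recl -IH//.
rewrite mulrC -cintZ//; congr cint; apply/funext => x.
rewrite mulrC -cintZ; last exact: (cintg_prod (fun i => cf (lift ord0 i))).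
congr cint; apply/funext => v.
rewrite big_ord_recl rV_consE0; congr (_ * _).
by apply: eq_bigr => i _; rewrite rV_consES.
Qed.

End rV_complex_integral.

(** * The transform of the two-sided exponential *)

Section exponential_kernel.
Context {R : realType}.
Local Open Scope complex_scope.
Local Notation mu := (@lebesgue_measure R).

Lemma ge0_integral_fold (h : R -> R) : measurable_fun setT h ->
  (forall x, 0 <= h x) ->
  (\int[mu]_x (h x)%:E = \int[mu]_(x in `[0%R, +oo[) (h x + h (- x)%R)%:E)%E.
Proof.
move=> mh h0.
have mhE : measurable_fun setT (fun x => (h x)%:E) by exact/measurable_EFinP.
have mhN : measurable_fun setT (fun x : R => (h (- x))%:E).
  apply/measurable_EFinP; apply: (measurableT_comp mh).
  exact: oppr_measurable.
under [RHS]eq_integral do rewrite EFinD.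
rewrite ge0_integralD//; last 4 first.
- by move=> x _; rewrite lee_fin.
- exact: measurable_funS mhE.
- by move=> x _; rewrite lee_fin.
- exact: measurable_funS mhN.
rewrite (ge0_integration_by_substitution0 mhN); last by move=> r; rewrite lee_fin.
under [X in (_ + X)%E]eq_integral do rewrite opprK.
rewrite -(@integral_itv_obnd_cbnd _ 0 +oo%O)//; last exact: measurable_funS mhE.
rewrite addeC -ge0_integral_setU//=; last 2 first.
- by move=> x _; rewrite lee_fin.
- rewrite disj_set2E; apply/eqP; rewrite -subset0 => x []/= /[!in_itv]/=.
  by rewrite andbT leNgt => /negP.
- by rewrite -setCitvl setUv.
- exact: measurable_funS mhE.
Qed.

(** The summand 1 keeps the integrand nonnegative, as the fundamental theorem on a half-line
    requires. [F] is an explicit primitive, and its exponential factor makes it vanish at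
    infinity. *)
Lemma integral_expR_cos (e z : R) : 0 < e ->
  (\int[mu]_(x in `[0%R, +oo[) ((1 + cos (z * x)) * expR (- e * x))%:E =
  (e^-1 + e / (e ^+ 2 + z ^+ 2))%:E)%E.
Proof.
move=> e0.
have D0 : e ^+ 2 + z ^+ 2 != 0 by rewrite gt_eqF// ltr_wpDr ?sqr_ge0// exprn_gt0.
pose c := (e ^+ 2 + z ^+ 2)^-1.
pose E : R -> R := expR \o (- e \*: (@id R)).
pose F : R -> R := E * (z * c \*: (sin \o (z \*: (@id R))) - e * c \*: (cos \o (z \*: (@id R))) - cst e^-1).
pose f : R -> R := fun x => (1 + cos (z * x)) * expR (- e * x).
have dF (x : R) : is_derive x 1 F (f x).
  apply: is_derive_eq.
  rewrite /f /F /E /c !fctE /= /GRing.scale /=.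
  set S := sin _; set C := cos _; set X := expR _.
  by field; rewrite D0 gt_eqF.
have cf : continuous f.
  move=> x; apply: (@continuousM _ _ (fun x => 1 + cos (z * x)) (fun x => expR (- e * x))).
    apply: cvgD; first exact: cvg_cst.
    apply: (@continuous_comp _ _ _ ( *%R z) cos); last exact: continuous_cos.
    exact: mulrl_continuous.
  apply: (@continuous_comp _ _ _ ( *%R (- e)) expR); last exact: continuous_expR.
  exact: mulrl_continuous.
have F0 : F 0 = - e^-1 - e * c.
  rewrite /F /E /= !fctE /= /GRing.scale /= !mulr0 expR0 sin0 cos0.
  by rewrite !mul1r mulr0 mulr1 sub0r addrC.
have Fy : F x @[x --> +oo] --> (0 : R).
  pose M := `|z * c| + `|e * c| + `|e^-1|.
  have B x : `|F x| <= M * E x.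
    rewrite /F fctE normrM (ger0_norm (expR_ge0 _)) mulrC.
    apply: ler_wpM2r; first exact: expR_ge0.
    rewrite !fctE /= /GRing.scale /=.
    apply: (le_trans (ler_normB _ _)); apply: lerD => //.
    apply: (le_trans (ler_normB _ _)); rewrite !normrM.
    by apply: lerD; rewrite -[leRHS]mulr1 ler_wpM2l ?mulr_ge0// ler_norml
      ?sin_le1 ?cos_le1 ?sin_geN1 ?cos_geN1.
  have Ey : M * E x @[x --> +oo] --> (0 : R).
    rewrite -[X in _ --> X](mulr0 M); apply: cvgM; first exact: cvg_cst.
    have -> : E = (fun x => expR (- x)) \o (fun x => e * x).
      by apply/funext => x; rewrite /E /= /GRing.scale /= mulNr.
    apply: (cvg_comp _ _ _ (@cvgr_expR R)).
    exact: gt0_cvgMry.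
  apply/cvgr0Pnorm_le => /= d d0.
  move/cvgr0Pnorm_le : Ey => /(_ d d0); apply: filterS => x.
  apply: le_trans; apply: (le_trans (B x)); exact: ler_norm.
have := @ge0_continuous_FTC2y _ f F 0 0 _ _ Fy.
rewrite F0 -EFinB => ->.
- by congr EFin; rewrite /c; ring.
- move=> x _; rewrite mulr_ge0 ?expR_ge0// -lerBlDl sub0r; exact: cos_geN1.
- exact: continuous_subspaceT.
- by move=> x _; exact: ex_derive.
- apply: cvg_at_right_filter; rewrite -F0.
  exact/differentiable_continuous/derivable1_diffP/ex_derive.
- by move=> x _; rewrite derive1E; exact: derive_val.
Qed.

Lemma integral_expR_abs (e : R) : 0 < e ->
  (\int[mu]_x (expR (- e * `|x|))%:E = (2 / e)%:E)%E.
Proof.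
move=> e0; rewrite ge0_integral_fold; last 2 first.
- by apply: measurableT_comp => //; apply: measurable_funM.
- by move=> x; exact: expR_ge0.
have := integral_expR_cos 0 e0.
have -> : e^-1 + e / (e ^+ 2 + 0 ^+ 2) = 2 / e by field; rewrite gt_eqF.
move=> <-; apply: eq_integral => x; rewrite inE /= in_itv /= andbT => x0.
by rewrite normrN ger0_norm// mul0r cos0 mulrDl mul1r.
Qed.

Lemma integrable_expR_abs (e : R) : 0 < e ->
  mu.-integrable setT (fun x : R => (expR (- e * `|x|))%:E).
Proof.
move=> e0; apply/integrableP; split.
  by apply/measurable_EFinP; apply: measurableT_comp => //; apply: measurable_funM.
under eq_integral do rewrite gee0_abs ?lee_fin ?expR_ge0//.
by rewrite integral_expR_abs// ltry.
Qed.

Lemma cint_cexpi_expR_abs (e z : R) : 0 < e ->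
  cintg mu (fun x => cexpi (z * x) * (expR (- e * `|x|))%:C) /\
  cint mu (fun x => cexpi (z * x) * (expR (- e * `|x|))%:C) =
  (2 * e / (e ^+ 2 + z ^+ 2))%:C.
Proof.
move=> e0; pose E (x : R) := expR (- e * `|x|).
have iE : mu.-integrable setT (EFin \o E) := integrable_expR_abs e0.
have mE : measurable_fun setT E.
  by apply/measurable_EFinP; exact: measurable_int iE.
have cE : cintg mu (fun x => (E x)%:C) by exact: cintg_real.
have mz : measurable_fun setT (fun x : R => z * x) by exact: measurable_funM.
split; first exact: cintg_cexpi.
(* Adding 1 to [g] makes the integrand nonnegative, so that it can be folded onto the half-line; the
   mass 2 / e of the added term is then removed. For the sine the folded odd parts cancel, for the
   cosine they double. *)
have H (g : R -> R) (v : R) : measurable_fun setT g -> (forall x, `|g x| <= 1) ->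
    (\int[mu]_(x in `[0%R, +oo[) ((2 + g x + g (- x)) * expR (- e * x))%:E = v%:E)%E ->
    \int[mu]_x (g x * E x) = v - 2 / e.
  move=> mg g1 gv.
  have ig1 : mu.-integrable setT (fun x => ((1 + g x) * E x)%:E).
    have iE2 : mu.-integrable setT (fun x => (2 * E x)%:E).
      have := @integrableZl _ _ _ mu _ measurableT 2 _ iE.
      exact: eq_integrable.
    apply: (le_integrable measurableT _ _ iE2).
    - by apply/measurable_EFinP; apply: measurable_funM => //; apply: measurable_funD.
    - move=> x _; rewrite /= lee_fin !normrM ler_wpM2r// (le_trans (ler_normD _ _))//.
      by rewrite normr1 (ger0_norm (ler0n R 2)); have := g1 x; lra.
  have -> : \int[mu]_x (g x * E x) = \int[mu]_x ((1 + g x) * E x - E x).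
    by apply: eq_Rintegral => x _; ring.
  rewrite RintegralB//; congr (_ - _).
    rewrite /Rintegral ge0_integral_fold; last 2 first.
    - by apply: measurable_funM => //; apply: measurable_funD.
    - move=> x; rewrite mulr_ge0 ?expR_ge0//.
      by have := g1 x; rewrite ler_norml => /andP[]; lra.
    rewrite (_ : (\int[_]_(_ in _) _ = v%:E)%E)//.
    rewrite -gv; apply: eq_integral => x; rewrite inE /= in_itv /= andbT => x0.
    by rewrite /E normrN ger0_norm//; congr EFin; ring.
  by rewrite /Rintegral integral_expR_abs.
have D0 : e ^+ 2 + z ^+ 2 != 0 by rewrite gt_eqF// ltr_wpDr ?sqr_ge0// exprn_gt0.
apply: complex_ext.
- rewrite [LHS](_ : _ = \int[mu]_x (cos (z * x) * E x)); last first.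
    by apply: eq_Rintegral => x _; rewrite cReM /= mulr0 subr0.
  rewrite (H _ (2 * (e^-1 + e / (e ^+ 2 + z ^+ 2)))) /=.
  + by field; rewrite D0 gt_eqF.
  + apply: measurableT_comp => //.
    by apply: continuous_measurable_fun; exact: continuous_cos.
  + by move=> x; rewrite ler_norml cos_le1 cos_geN1.
  + rewrite EFinM -(integral_expR_cos z e0) -ge0_integralZl//.
    * apply: eq_integral => x _; rewrite -EFinM mulrN cosN; congr EFin; ring.
    * apply/measurable_EFinP; apply: measurable_funM.
        apply: measurable_funD => //; apply: measurable_funTS; apply: measurableT_comp => //.
        by apply: continuous_measurable_fun; exact: continuous_cos.
      apply: measurable_funTS; apply: measurableT_comp => //; exact: measurable_funM.
- rewrite [LHS](_ : _ = \int[mu]_x (sin (z * x) * E x)); last first.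
    by apply: eq_Rintegral => x _; rewrite cImM /= mulr0 add0r.
  rewrite (H _ (2 / e)) /= ?subrr//.
  + apply: measurableT_comp => //.
    by apply: continuous_measurable_fun; exact: continuous_sin.
  + by move=> x; rewrite ler_norml sin_le1 sin_geN1.
  + have := integral_expR_cos 0 e0.
    have -> : e^-1 + e / (e ^+ 2 + 0 ^+ 2) = 2 / e by field; rewrite gt_eqF.
    move=> <-; apply: eq_integral => x _.
    by rewrite mulrN sinN mul0r cos0; congr EFin; ring.
Qed.

(** The source of the factor 2 pi per coordinate in the Plancherel bound and in Parseval's
    formula. *)
Lemma integral_cauchy_kernel :
  (\int[mu]_x (2 / (1 + x ^+ 2))%:E = (2 * pi)%:E)%E.
Proof.
have m0 : measurable_fun setT (fun x : R => (1 + x ^+ 2)^-1).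
  by apply: continuous_measurable_fun; exact: continuous_oneDsqrV.
have p0 (x : R) : 0 <= (1 + x ^+ 2)^-1 by rewrite invr_ge0 addr_ge0// sqr_ge0.
rewrite (@ge0_integral_fold (fun x => 2 / (1 + x ^+ 2))); last 2 first.
- exact: measurable_funM.
- by move=> x; rewrite mulr_ge0.
rewrite (_ : (2 * pi)%:E = 4%:E * (pi / 2)%:E)%E; last first.
  by rewrite -EFinM; congr EFin; field.
rewrite -integral0y_oneDsqr -ge0_integralZl//.
- by apply: eq_integral => x _; rewrite -EFinM sqrrN; congr EFin; rewrite -mulrDl -natrD.
- by apply/measurable_EFinP; apply: measurable_funTS.
Qed.

End exponential_kernel.

(** * The Fourier transform on bounded integrable functions *)

Section fourier_transform.
Context {R : realType} {n : nat}.
Local Open Scope complex_scope.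
Local Notation mu := (@lebesgue_rV R n).
Local Notation Rn := 'rV[R]_n.
Implicit Types a b f : Rn -> R[i].

(** The sign [s] treats the transform (s = -1) and the unnormalized inverse transform (s = 1) at
    once. *)
Definition FT (s : R) f : Rn -> R[i] :=
  fun xi => cint mu (fun x => cexpi (s * dot x xi) * f x).

Lemma fourierE f : fourier f = FT (-1) f.
Proof.
apply/funext => xi; rewrite /FT; apply: eq_cint => x.
by rewrite mulN1r.
Qed.

Lemma inv_fourierE f : inv_fourier f = fun x => ((2 * pi) ^- n)%:C * FT 1 f x.
Proof.
apply/funext => x; congr (_ * _); apply: eq_cint => xi.
by rewrite mul1r dotC.
Qed.

Lemma cintg_tensor a b (K : Rn * Rn -> R[i]) (M : R) : cintg mu a -> cintg mu b ->
  cmeas K -> (forall p, cmod (K p) <= M) ->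
  cintg (mu \x mu)%E (fun p => a p.1 * b p.2 * K p).
Proof.
move=> ca cb mK KM.
have mca : cmeas (fun p : Rn * Rn => a p.1).
  by case: ca => -[ra ja] _; split;
    [exact: (measurableT_comp ra measurable_fst)|
     exact: (measurableT_comp ja measurable_fst)].
have mcb : cmeas (fun p : Rn * Rn => b p.2).
  by case: cb => -[rb jb] _; split;
    [exact: (measurableT_comp rb measurable_snd)|
     exact: (measurableT_comp jb measurable_snd)].
have cab : cintg (mu \x mu)%E (fun p => a p.1 * b p.2).
  split; first exact: cmeasM.
  rewrite fubini_tonelli1//; last 2 first.
  - by apply/measurable_EFinP; apply: measurable_cmod; exact: cmeasM.
  - by move=> p; rewrite lee_fin cmod_ge0.
  have -> : fubini_F mu (fun p : Rn * Rn => (cmod (a p.1 * b p.2))%:E) =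
      fun x => ((cmod (a x))%:E * \int[mu]_y (cmod (b y))%:E)%E.
    apply/funext => x; rewrite /fubini_F /= -ge0_integralZl//.
    - by apply: eq_integral => y _; rewrite cmodM EFinM.
    - by apply/measurable_EFinP; exact: (measurable_cmod cb.1).
    - by move=> y _; rewrite lee_fin cmod_ge0.
    - by rewrite lee_fin cmod_ge0.
  rewrite ge0_integralZr//; last 3 first.
  - by apply/measurable_EFinP; exact: (measurable_cmod ca.1).
  - by move=> y _; rewrite lee_fin cmod_ge0.
  - by apply: integral_ge0 => y _; rewrite lee_fin cmod_ge0.
  rewrite lte_mul_pinfty//; last exact: cb.2.
    by apply: integral_ge0 => y _; rewrite lee_fin cmod_ge0.
  apply/fin_numPlt; rewrite ca.2 andbT.
  apply: (@lt_le_trans _ _ 0%E) => //.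
  by apply: integral_ge0 => y _; rewrite lee_fin cmod_ge0.
have := cintg_bounded mK KM cab.
by congr cintg; apply/funext => p; rewrite mulrC.
Qed.

Lemma cmeas_phase (s : R) : cmeas (fun p : Rn * Rn => cexpi (s * dot p.1 p.2)).
Proof.
by apply: cmeas_cexpi; apply: measurable_funM => //; apply: measurable_dot2.
Qed.

(** The multiplication formula: Fubini for a(x) b(y) against a bounded kernel that is symmetric in x
    and y. *)
Lemma FT_multiplication (s : R) a b : cintg mu a -> cintg mu b ->
  cint mu (fun x => FT s a x * b x) = cint mu (fun x => a x * FT s b x).
Proof.
move=> ca cb.
have cF : cintg (mu \x mu)%E (fun p => a p.1 * b p.2 * cexpi (s * dot p.1 p.2)).
  apply: (@cintg_tensor _ _ _ 1) => //; first exact: cmeas_phase.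
  by move=> p; rewrite cmod_cexpi.
have cph (f : Rn -> R[i]) z : cintg mu f ->
    cintg mu (fun x => cexpi (s * dot x z) * f x).
  move=> cf; apply: cintg_cexpi => //; apply: measurable_funM => //.
  by apply: measurable_dot2.
transitivity (cint mu (fun y => cint mu (fun x => a x * b y * cexpi (s * dot x y)))).
  apply: eq_cint => y; rewrite /FT mulrC -cintZ; last exact: cph.
  by apply: eq_cint => x; ring.
rewrite -(cint_fubini cF); apply: eq_cint => x /=.
rewrite /FT -cintZ; last exact: cph.
by apply: eq_cint => y; rewrite (dotC y x); ring.
Qed.

Lemma cmod_FT_le (s : R) a xi : cintg mu a ->
  cmod (FT s a xi) <= \int[mu]_x cmod (a x).
Proof.
move=> ca; apply: (le_trans (cmod_cint_le _)).
  apply: cintg_cexpi => //; apply: measurable_funM => //.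
  by apply: measurable_dot2.
by under eq_Rintegral do rewrite cmodM cmod_cexpi mul1r.
Qed.

Lemma FT_conj (s : R) a xi : cintg mu a ->
  FT (- s) (fun x => (a x)^*%C) xi = (FT s a xi)^*%C.
Proof.
move=> ca; rewrite /FT -cint_conj.
  by apply: eq_cint => x; rewrite mulNr cexpiN rmorphM.
apply: cintg_cexpi => //; apply: measurable_funM => //.
by apply: measurable_dot2.
Qed.

(** A damping factor that splits over the coordinates and has an explicit transform; it takes the
    place of the usual Gaussian. Its transform for e = 1 is [poisson], a product of Cauchy
    kernels. *)
Definition decay (e : R) (x : Rn) : R := \prod_(i < n) expR (- e * `|x ord0 i|).

Definition poisson (x : Rn) : R := \prod_(i < n) (2 / (1 + x ord0 i ^+ 2)).

Lemma decay_ge0 e x : 0 <= decay e x.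
Proof. by apply: prodr_ge0 => i _; exact: expR_ge0. Qed.

Lemma decay_le1 (e : R) x : 0 <= e -> decay e x <= 1.
Proof.
move=> e0; apply: prodr_ile1 => i _; rewrite expR_ge0 /= -expR0 ler_expR.
by rewrite mulNr oppr_le0 mulr_ge0.
Qed.

Lemma poisson_ge0 x : 0 <= poisson x.
Proof.
by apply: prodr_ge0 => i _; rewrite divr_ge0// addr_ge0// sqr_ge0.
Qed.

Lemma cintg_decay e : 0 < e -> cintg mu (fun x => (decay e x)%:C).
Proof.
move=> e0; under eq_fun do rewrite /decay rmorph_prod.
apply: (@cintg_prod _ _ (fun _ x => (expR (- e * `|x|))%:C)) => i.
by apply: cintg_real; exact: integrable_expR_abs.
Qed.

(* [e^n K_e (e w) = K_1 w], where [K_e] is the transform of [decay e]. *)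
Lemma FT_decay (s e : R) w : 0 < e -> `|s| = 1 ->
  FT s (fun x => (decay e x)%:C) (e *: w) = ((e ^- n) * poisson w)%:C.
Proof.
move=> e0 s1.
have s2 : s ^+ 2 = 1 by rewrite -real_normK ?num_real// s1 expr1n.
have H i := @cint_cexpi_expR_abs R e (s * (e * w ord0 i)) e0.
rewrite [LHS](_ : _ = cint mu (fun x : Rn => \prod_(i < n)
   (cexpi (s * (e * w ord0 i) * x ord0 i) * (expR (- e * `|x ord0 i|))%:C))).
  rewrite (@cint_prod _ _ (fun i x =>
    (cexpi (s * (e * w ord0 i) * x) * (expR (- e * `|x|))%:C))); last first.
    by move=> i; case: (H i).
  rewrite (eq_bigr (fun i => (2 * e / (e ^+ 2 + (s * (e * w ord0 i)) ^+ 2))%:C)).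
    rewrite -rmorph_prod /poisson; congr (_%:C).
    have -> : e ^- n = \prod_(i < n) e^-1 by rewrite prodr_const card_ord exprVn.
    rewrite -big_split /=; apply: eq_bigr => i _.
    rewrite !exprMn s2 mul1r.
    have : 1 + w ord0 i ^+ 2 != 0 by rewrite gt_eqF// ltr_wpDr ?sqr_ge0.
    have := gt_eqF e0 => /negbT e1 w1.
    field; rewrite e1 w1 /=.
    by rewrite (_ : _ + _ = e ^+ 2 * (1 + w ord0 i ^+ 2)) ?mulf_neq0 ?expf_neq0//; ring.
  by move=> i _; case: (H i).
apply: eq_cint => x; rewrite big_split /= /decay rmorph_prod; congr (_ * _).
transitivity (cexpi (\sum_(i < n) s * (e * w ord0 i) * x ord0 i)).
  rewrite /dot mulr_sumr; congr cexpi; apply: eq_bigr => i _.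
  by rewrite mxE; ring.
elim/big_ind2: _ => [|a b c d <- <-|//]; first exact: cexpi0.
exact: cexpiD.
Qed.

Lemma measurable_poisson : measurable_fun setT poisson.
Proof.
apply: measurable_prod => i _.
apply: (measurableT_comp _ (measurable_coord i) (f := fun y : R => 2 / (1 + y ^+ 2))).
apply: measurable_funM => //.
by apply: continuous_measurable_fun; exact: continuous_oneDsqrV.
Qed.

Lemma integral_poisson : (\int[mu]_x (poisson x)%:E = ((2 * pi) ^+ n)%:E)%E.
Proof.
rewrite /poisson (@ge0_integral_prod _ _ (fun _ x => 2 / (1 + x ^+ 2))).
- under eq_bigr do rewrite integral_cauchy_kernel.
  by rewrite prodEFin prodr_const card_ord.
- move=> i; apply: measurable_funM => //.
  by apply: continuous_measurable_fun; exact: continuous_oneDsqrV.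
- by move=> i x; rewrite divr_ge0// addr_ge0// sqr_ge0.
Qed.

Lemma cintg_poisson : cintg mu (fun x => (poisson x)%:C).
Proof.
apply: cintg_real; apply/integrableP; split.
  by apply/measurable_EFinP; exact: measurable_poisson.
under eq_integral => x _ do rewrite /= ger0_norm ?poisson_ge0//.
by rewrite integral_poisson ltry.
Qed.

End fourier_transform.

Lemma cintg_parts d (T : measurableType d) (R : realType)
    (mu : {measure set T -> \bar R}) (f : T -> R[i]) :
  mu.-integrable setT (fun x => (complex.Re (f x))%:E) ->
  mu.-integrable setT (fun x => (complex.Im (f x))%:E) -> cintg mu f.
Proof.
move=> irf ijf.
apply: (@le_cintg _ _ _ _ _ (fun x => `|complex.Re (f x)| + `|complex.Im (f x)|)).
- by split; apply/measurable_EFinP; [exact: measurable_int irf|exact: measurable_int ijf].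
- by move=> x; exact: cmod_le.
- have := integrableD measurableT (integrable_norm irf) (integrable_norm ijf).
  exact: eq_integrable.
Qed.

Section plancherel.
Context {R : realType} {n : nat}.
Local Open Scope complex_scope.
Local Notation mu := (@lebesgue_rV R n).
Local Notation Rn := 'rV[R]_n.
Implicit Types a b f g : Rn -> R[i].

(** L^1 together with boundedness: the class contains packets and Schwartz functions, lies in L^2,
    and its transforms are honest integrals. *)
Definition bounded_cintg f := cintg mu f /\ exists M : R, forall x, cmod (f x) <= M.

Lemma L2_cintgM f g : L2 f -> L2 g -> cintg mu (fun x => f x * g x).
Proof.
move=> [mf foo] [mg goo]; split; first exact: cmeasM.
have mf2 : measurable_fun setT (fun x => (cmod (f x) ^+ 2)%:E).
  by apply/measurable_EFinP; apply: measurable_funX; exact: measurable_cmod.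
have mg2 : measurable_fun setT (fun x => (cmod (g x) ^+ 2)%:E).
  by apply/measurable_EFinP; apply: measurable_funX; exact: measurable_cmod.
apply: (@le_lt_trans _ _ (\int[mu]_x ((cmod (f x) ^+ 2)%:E + (cmod (g x) ^+ 2)%:E))%E).
  apply: ge0_le_integral => //.
  - by move=> x _; rewrite lee_fin cmod_ge0.
  - by apply/measurable_EFinP; apply: measurable_cmod; exact: cmeasM.
  - exact: emeasurable_funD.
  - move=> x _; rewrite -EFinD lee_fin cmodM.
    have := cmod_ge0 (f x); have := cmod_ge0 (g x).
    by set u := cmod _; set v := cmod _ => u0 v0; nra.
rewrite ge0_integralD//.
- exact: lte_add_pinfty.
- by move=> x _; rewrite lee_fin sqr_ge0.
- by move=> x _; rewrite lee_fin sqr_ge0.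
Qed.

Lemma bounded_cintg_L2 f : bounded_cintg f -> L2 f.
Proof.
move=> [[mf foo] [M fM]]; split=> //.
have M0 : 0 <= M by apply: le_trans (fM 0); exact: cmod_ge0.
have mfc : measurable_fun setT (fun x => (cmod (f x))%:E).
  by apply/measurable_EFinP; exact: measurable_cmod.
apply: (@le_lt_trans _ _ (\int[mu]_x (M%:E * (cmod (f x))%:E))%E).
  apply: ge0_le_integral => //.
  - by move=> x _; rewrite lee_fin sqr_ge0.
  - by apply/measurable_EFinP; apply: measurable_funX; exact: measurable_cmod.
  - exact: measurable_funeM.
  - by move=> x _; rewrite -EFinM lee_fin expr2 ler_wpM2r ?cmod_ge0.
rewrite ge0_integralZl//; last by move=> x _; rewrite lee_fin cmod_ge0.
rewrite lte_mul_pinfty// ge0_fin_numE//.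
Qed.

Lemma cmeas_comp_rV (h : Rn -> Rn) f : measurable_fun setT h -> cmeas f ->
  cmeas (fun x => f (h x)).
Proof.
by move=> mh [rf jf]; split; [exact: (measurableT_comp rf mh)|
  exact: (measurableT_comp jf mh)].
Qed.

Lemma measurable_affine (v : Rn) (e : R) :
  measurable_fun setT (fun x : Rn => v + e *: x).
Proof. by apply: measurable_rVD => //; apply: measurable_rVZ. Qed.

Lemma cint_affine (v : Rn) (e : R) f : 0 < e -> cintg mu f ->
  cintg mu (fun x => f (v + e *: x)) /\
  cint mu f = (e ^+ n)%:C * cint mu (fun x => f (v + e *: x)).
Proof.
move=> e0 cf.
have [rf rE] := integrable_affine v e0 (cintg_Re cf).
have [jf jE] := integrable_affine v e0 (cintg_Im cf).
split.
  exact: (@cintg_parts _ _ _ mu (fun x : Rn => f (v + e *: x))).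
by apply: complex_ext; rewrite ?cReM ?cImM /= mul0r ?subr0 ?addr0 /Rintegral
  ?rE ?jE fineM//; exact: (integrable_fin_num measurableT).
Qed.

(** Measurability of a parameter integral comes from Fubini, which needs integrability in both
    variables. So the frequency is damped by [decay 1], and the damping is undone by the factor
    [decay (-1)]. *)
Lemma cmeas_FT (s : R) f : cintg mu f -> cmeas (FT s f).
Proof.
move=> cf.
have d1 (x : Rn) : decay (-1) x * decay 1 x = 1 :> R.
  rewrite /decay -big_split big1//= => i _.
  by rewrite -expRD -mulrDl addrC subrr mul0r expR0.
have md : measurable_fun setT (@decay R n (-1)).
  apply: measurable_prod => i _.
  apply: (measurableT_comp _ (measurable_coord i) (f := fun y : R => expR (- -1 * `|y|))).
  by apply: measurableT_comp => //; apply: measurable_funM.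
have c1 (p : Rn * Rn) : cmod (cexpi (s * dot p.1 p.2)) <= 1.
  by rewrite cmod_cexpi.
have cF := @cintg_tensor R n (fun x => (decay 1 x)%:C) f _ 1 (cintg_decay ltr01) cf
  (cmeas_phase s) c1.
have := cmeasM (cmeas_real md) (cmeas_cint2 cF).
congr cmeas; apply/funext => x /=.
transitivity ((decay (-1) x)%:C * ((decay 1 x)%:C * FT s f x)).
  congr (_ * _); rewrite -cintZ.
    by apply: eq_cint => y; rewrite (dotC x y); ring.
  by apply: cintg_cexpi => //; apply: measurable_funM => //; apply: measurable_dot2.
by rewrite mulrA -rmorphM /= d1 mul1r.
Qed.

(** Parseval with damping. The multiplication formula, used twice, moves both transforms onto the
    damping factor, whose transform at y - x is an approximate identity of width e; the substitution
    y = x + e w turns it into the fixed kernel [poisson]. *)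
Lemma FT_pairing (s e : R) a b (M : R) : `|s| = 1 -> 0 < e ->
  cintg mu a -> cintg mu b -> (forall x, cmod (b x) <= M) ->
  cint mu (fun xi => (decay e xi)%:C * (FT s a xi * FT (- s) b xi)) =
  cint mu (fun x => cint mu (fun w => a x * (poisson w)%:C * b (x + e *: w))).
Proof.
move=> s1 e0 ca cb bM.
have cd := @cintg_decay R n e e0.
pose B := \int[mu]_x cmod (b x).
have cc : cintg mu (fun xi => (decay e xi)%:C * FT (- s) b xi).
  rewrite (_ : (fun _ => _) = fun xi => FT (- s) b xi * (decay e xi)%:C).
    apply: (@cintg_bounded _ _ _ _ B) => //; first exact: cmeas_FT.
    by move=> x; exact: cmod_FT_le.
  by apply/funext => x; rewrite mulrC.
rewrite [LHS](_ : _ = cint mu (fun x => FT s a x * ((decay e x)%:C * FT (- s) b x))).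
  rewrite (@FT_multiplication R n s a _ ca cc); apply: eq_cint => x.
  pose q xi := cexpi (s * dot xi x) * (decay e xi)%:C.
  have cq : cintg mu q.
    apply: cintg_cexpi => //; apply: measurable_funM => //.
    by apply: measurable_dot2.
  have -> : FT s (fun xi => (decay e xi)%:C * FT (- s) b xi) x =
      cint mu (fun y => b y * FT (- s) (fun xi => (decay e xi)%:C) (y - x)).
    transitivity (cint mu (fun xi => FT (- s) b xi * q xi)).
      by apply: eq_cint => xi; rewrite /q; ring.
    rewrite (@FT_multiplication R n (- s) b q cb cq); apply: eq_cint => y.
    congr (_ * _).
    apply: eq_cint => xi; rewrite /q mulrA -cexpiD; congr (cexpi _ * _).
    by rewrite dotBr; ring.
  have cbF : cintg mu (fun y => b y * FT (- s) (fun xi => (decay e xi)%:C) (y - x)).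
    rewrite (_ : (fun _ => _) = fun y =>
        FT (- s) (fun xi => (decay e xi)%:C) (y - x) * b y).
      apply: (@cintg_bounded _ _ _ _ (\int[mu]_x cmod (decay e x)%:C)) => //.
        apply: (cmeas_comp_rV (h := fun y => y - x)); last exact: cmeas_FT.
        by apply: measurable_rVD.
      by move=> y; exact: cmod_FT_le.
    by apply/funext => y; rewrite mulrC.
  have [caf ->] := cint_affine x e0 cbF.
  rewrite -cintZ// -cintZ; last exact: cintgZ.
  apply: eq_cint => w; rewrite addrAC subrr add0r FT_decay ?normrN//.
  rewrite rmorphM /=.
  have : (e ^+ n)%:C * (e ^- n)%:C = 1 :> R[i].
    by rewrite -rmorphM /= divff// expf_neq0// gt_eqF.
  set u := (e ^+ n)%:C; set v := (e ^- n)%:C => uv.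
  set p := (poisson w)%:C; set bb := b _.
  by transitivity (u * v * (a x * p * bb)); [ring|rewrite uv mul1r].
by apply: eq_cint => x; ring.
Qed.

End plancherel.

(** * Removing the damping: the Plancherel bound and Parseval's formula *)

Section fourier_L2.
Context {R : realType} {n : nat}.
Local Open Scope complex_scope.
Local Notation mu := (@lebesgue_rV R n).
Local Notation Rn := 'rV[R]_n.
Implicit Types a b f g : Rn -> R[i].

Lemma bounded_cintg_conj f : bounded_cintg f -> bounded_cintg (fun x => (f x)^*%C).
Proof.
move=> [cf [M fM]]; split; last by exists M => x; rewrite cmod_conj.
apply: (@cintg_le _ _ _ _ _ f) => //; first by apply: cmeas_conj; case: cf.
by move=> x; rewrite cmod_conj.
Qed.

Lemma cintg_poisson_tensor a b (e M : R) : cintg mu a -> cmeas b ->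
  (forall x, cmod (b x) <= M) ->
  cintg (mu \x mu)%E (fun p => a p.1 * (poisson p.2)%:C * b (p.1 + e *: p.2)).
Proof.
move=> ca mb bM.
apply: (@cintg_tensor R n a (fun w => (poisson w)%:C) _ M) => //.
  exact: cintg_poisson.
have mh : measurable_fun setT (fun p : Rn * Rn => p.1 + e *: p.2).
  by apply: measurable_rVD => //; apply: measurable_rVZ.
by case: mb => rb jb; split; [exact: (measurableT_comp rb mh)|
  exact: (measurableT_comp jb mh)].
Qed.

Lemma measurable_sqr_cmod f : cmeas f ->
  measurable_fun setT (fun x => (cmod (f x) ^+ 2)%:E).
Proof.
by move=> mf; apply/measurable_EFinP; apply: measurable_funX; exact: measurable_cmod.
Qed.

(* AM-GM on [a x * b (x + e w)], then translation invariance: this is Schur's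
   test for the kernel [poisson]. *)
Lemma poisson_form_le a b (e M : R) : 0 < e -> cintg mu a -> cmeas b ->
  (forall x, cmod (b x) <= M) -> (forall x, cmod (b x) = cmod (a x)) ->
  ((cmod (cint mu (fun x => cint mu (fun w => a x * (poisson w)%:C * b (x + e *: w)))))%:E
   <= ((2 * pi) ^+ n)%:E * \int[mu]_x (cmod (a x) ^+ 2)%:E)%E.
Proof.
move=> e0 ca mb bM ba.
have cF := cintg_poisson_tensor e ca mb bM.
rewrite -(cint_prod_meas cF); apply: (le_trans (cintP_EFin cF)).
pose A x := (cmod (a x) ^+ 2)%:E.
have mA : measurable_fun setT A by apply: measurable_sqr_cmod; case: ca.
have A0 x : (0 <= A x)%E by rewrite lee_fin sqr_ge0.
pose G (p : Rn * Rn) := ((2^-1 * poisson p.2)%:E * A p.1)%E.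
pose H (p : Rn * Rn) := ((2^-1 * poisson p.2)%:E * A (p.1 + e *: p.2)%R)%E.
have mP : measurable_fun setT (fun p : Rn * Rn => (2^-1 * poisson p.2)%:E).
  apply/measurable_EFinP; apply: measurable_funM => //.
  exact: (measurableT_comp (@measurable_poisson R n) measurable_snd).
have hp w : 0 <= 2^-1 * poisson w :> R by rewrite mulr_ge0// poisson_ge0.
have mG : measurable_fun setT G.
  by apply: emeasurable_funM => //; exact: (measurableT_comp mA measurable_fst).
have mH : measurable_fun setT H.
  apply: emeasurable_funM => //.
  apply: (measurableT_comp mA); apply: measurable_rVD => //.
  by apply: measurable_rVZ.
have G0 p : (0 <= G p)%E by rewrite mule_ge0// lee_fin.
have H0 p : (0 <= H p)%E by rewrite mule_ge0// lee_fin.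
apply: (@le_trans _ _ (\int[(mu \x mu)%E]_p (G p + H p))%E).
  apply: ge0_le_integral => //.
  - by move=> x _; rewrite lee_fin cmod_ge0.
  - by apply/measurable_EFinP; apply: measurable_cmod; case: cF.
  - exact: emeasurable_funD.
  - move=> [x w] _; rewrite /G /H /A /= -!EFinM -EFinD lee_fin.
    rewrite !cmodM cmodC (ger0_norm (poisson_ge0 _)) ba.
    set u := cmod (a x); set v := cmod _.
    have /(ler_wpM2l (poisson_ge0 w)) : u * v <= 2^-1 * u ^+ 2 + 2^-1 * v ^+ 2.
      by have := sqr_ge0 (u - v); nra.
    by set p := poisson w => h; nra.
rewrite ge0_integralD//.
have S : (\int[mu]_w (2^-1 * poisson w)%:E = (2^-1 * (2 * pi) ^+ n)%:E)%E.
  under eq_integral do rewrite EFinM.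
  rewrite ge0_integralZl//; last 2 first.
  - by apply/measurable_EFinP; exact: measurable_poisson.
  - by move=> w _; rewrite lee_fin poisson_ge0.
  by rewrite integral_poisson -EFinM.
have mP1 : measurable_fun setT (fun w : Rn => (2^-1 * poisson w)%:E).
  by apply/measurable_EFinP; apply: measurable_funM => //; exact: measurable_poisson.
set I := (\int[mu]_x A x)%E; have I0 : (0 <= I)%E by exact: integral_ge0.
have GE : (\int[(mu \x mu)%E]_p G p = (2^-1 * (2 * pi) ^+ n)%:E * I)%E.
  rewrite fubini_tonelli2//.
  transitivity (\int[mu]_w ((2^-1 * poisson w)%:E * I))%E.
    by apply: eq_integral => w _; rewrite /fubini_G /G /= ge0_integralZl// lee_fin.
  by rewrite ge0_integralZr// ?S// => w _; rewrite lee_fin.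
have HE : (\int[(mu \x mu)%E]_p H p = (2^-1 * (2 * pi) ^+ n)%:E * I)%E.
  rewrite fubini_tonelli2//.
  transitivity (\int[mu]_w ((2^-1 * poisson w)%:E * I))%E.
    apply: eq_integral => w _; rewrite /fubini_G /H /= ge0_integralZl// ?lee_fin//.
      congr (_ * _)%E; rewrite /I (@ge0_integral_affine _ _ (e *: w) 1 A ltr01 mA A0).
      rewrite expr1n mul1e; apply: eq_integral => x _.
      by rewrite scale1r addrC.
    apply: (measurableT_comp mA); apply: measurable_rVD => //.
  by rewrite ge0_integralZr// ?S// => w _; rewrite lee_fin.
rewrite GE HE -ge0_muleDl ?lee_fin ?mulr_ge0 ?exprn_ge0 ?mulr_ge0 ?pi_ge0//.
rewrite -EFinD (_ : _ + _ = (2 * pi) ^+ n)//; field.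
by [].
Qed.

Lemma cint_dominated_everywhere (F : nat -> Rn -> R[i]) f (h : Rn -> R) :
  (forall m, cmeas (F m)) -> cmeas f ->
  (forall x, (fun m => complex.Re (F m x)) @ \oo --> complex.Re (f x) /\
     (fun m => complex.Im (F m x)) @ \oo --> complex.Im (f x)) ->
  mu.-integrable setT (EFin \o h) -> (forall m x, cmod (F m x) <= h x) ->
  (fun m => complex.Re (cint mu (F m))) @ \oo --> complex.Re (cint mu f) /\
  (fun m => complex.Im (cint mu (F m))) @ \oo --> complex.Im (cint mu f).
Proof.
move=> mF mf Ff ih Fh.
by apply: (@cint_dominated _ _ _ mu F f h mF mf _ ih _).2; exact: aeW.
Qed.

Let em (m : nat) : R := m.+1%:R^-1.

Let em_gt0 m : 0 < em m.
Proof. by rewrite invr_gt0. Qed.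

Let em_cvg : em @ \oo --> (0 : R).
Proof. exact: cvg_harmonic. Qed.

Lemma decay_cvg1 (x : Rn) : decay (em m) x @[m --> \oo] --> (1 : R).
Proof.
have -> : 1 = decay 0 x.
  by rewrite /decay big1// => i _; rewrite oppr0 mul0r expR0.
have -> : (fun m => decay (em m) x) = (fun e : R => decay e x) \o em by [].
apply: (cvg_comp _ _ em_cvg).
have : continuous (fun e : R => decay e x).
  rewrite /decay; elim: (index_enum _) => [|i r IH] e.
    by under eq_fun do rewrite big_nil; exact: cst_continuous.
  under eq_fun do rewrite big_cons.
  apply: (@continuousM _ _ (fun e : R => expR (- e * `|x ord0 i|))); last exact: IH.
  apply: (@continuous_comp _ _ _ (fun e : R => - e * `|x ord0 i|) expR).
    by apply: cvgM; [apply: cvgN; exact: cvg_id|exact: cvg_cst].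
  exact: continuous_expR.
by move/(_ 0).
Qed.

(** For b the conjugate of f, the damped pairing is the integral of [decay] times |FT f|^2, and
    [poisson_form_le] bounds it uniformly in e. Fatou's lemma removes the damping. *)
Lemma plancherel_le (s : R) f : `|s| = 1 -> bounded_cintg f ->
  (\int[mu]_xi (cmod (FT s f xi) ^+ 2)%:E <=
   ((2 * pi) ^+ n)%:E * \int[mu]_x (cmod (f x) ^+ 2)%:E)%E.
Proof.
move=> s1 [cf [M fM]].
have [cfc _] := bounded_cintg_conj (conj cf (ex_intro _ M fM)).
have fcM x : cmod (f x)^*%C <= M by rewrite cmod_conj.
have mF := cmeas_FT s cf.
pose h m xi := (decay (em m) xi * cmod (FT s f xi) ^+ 2)%:E.
have mh m : measurable_fun setT (h m).
  apply/measurable_EFinP; apply: measurable_funM.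
    by have [[]] := @cintg_decay R n (em m) (em_gt0 m).
  by apply: measurable_funX; exact: measurable_cmod.
have h0 m xi : (0 <= h m xi)%E by rewrite lee_fin mulr_ge0 ?decay_ge0// sqr_ge0.
have hle m : (\int[mu]_xi h m xi <=
    ((2 * pi) ^+ n)%:E * \int[mu]_x (cmod (f x) ^+ 2)%:E)%E.
  have := @poisson_form_le f (fun x => (f x)^*%C) (em m) M (em_gt0 m) cf
    (cmeas_conj cf.1) fcM (fun x => cmod_conj _).
  apply: le_trans.
  rewrite -(@FT_pairing R n s (em m) f _ M s1 (em_gt0 m) cf cfc fcM).
  rewrite (_ : cint _ _ = cint mu (fun xi =>
      (decay (em m) xi * cmod (FT s f xi) ^+ 2)%:C)); last first.
    apply: eq_cint => xi; rewrite FT_conj//.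
    rewrite (_ : FT s f xi * _ = (cmod (FT s f xi) ^+ 2)%:C) -?rmorphM//.
    by rewrite mulrC mul_conj.
  rewrite cint_real cmodC ger0_norm; last first.
    by apply: Rintegral_ge0 => xi _; rewrite mulr_ge0 ?decay_ge0// sqr_ge0.
  rewrite /Rintegral fineK ?lexx//.
  rewrite ge0_fin_numE; last by apply: integral_ge0 => xi _; exact: h0.
  pose B := \int[mu]_x cmod (f x).
  apply: (@le_lt_trans _ _ (\int[mu]_xi ((B ^+ 2)%:E * (cmod (decay (em m) xi)%:C)%:E))%E).
    apply: ge0_le_integral => //.
    - by move=> xi _; exact: h0.
    - exact: mh.
    - apply: measurable_funeM; apply/measurable_EFinP; apply: measurable_cmod.
      by case: (@cintg_decay R n (em m) (em_gt0 m)).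
    - move=> xi _; rewrite /h -EFinM lee_fin cmodC (ger0_norm (decay_ge0 _ _)).
      rewrite mulrC ler_wpM2r ?decay_ge0// ler_pXn2r ?nnegrE ?cmod_ge0//.
        exact: cmod_FT_le.
      by apply: Rintegral_ge0 => x _; exact: cmod_ge0.
  have cd := cintg_cmod (@cintg_decay R n (em m) (em_gt0 m)).
  rewrite integralZl// lte_mul_pinfty// ?lee_fin ?sqr_ge0//.
  by have [_] := @cintg_decay R n (em m) (em_gt0 m).
have cvh xi : h m xi @[m --> \oo] --> (cmod (FT s f xi) ^+ 2)%:E.
  apply: cvg_EFin; first exact: nearW.
  rewrite -[X in _ --> X]mul1r; apply: cvgM; last exact: cvg_cst.
  exact: decay_cvg1.
have := fatou mu measurableT mh (fun m xi _ => h0 m xi).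
rewrite (eq_integral (fun xi => (cmod (FT s f xi) ^+ 2)%:E)); last first.
  move=> xi _; rewrite is_cvg_limn_einfE.
    by apply/cvg_lim => //; exact: cvh.
  by apply/cvg_ex; eexists; exact: cvh.
move=> /le_trans; apply.
rewrite limn_einf_lim; apply: lime_le; first exact: is_cvg_einfs.
apply: nearW => m; apply: le_trans (hle m).
by apply: ereal_inf_lbound; exists m => /=.
Qed.

Lemma FT_L2 (s : R) f : `|s| = 1 -> bounded_cintg f -> L2 (FT s f).
Proof.
move=> s1 bf; split; first by apply: cmeas_FT; case: bf.
apply: (le_lt_trans (plancherel_le s1 bf)).
have [_ foo] := bounded_cintg_L2 bf.
rewrite lte_mul_pinfty// ?lee_fin ?exprn_ge0 ?mulr_ge0 ?pi_ge0//.
Qed.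

(** Both sides of [FT_pairing] converge by dominated convergence as e tends to 0. On the left the
    majorant is |FT a FT b|, integrable since both transforms are in L^2. On the right continuity of
    b along lines gives the pointwise limit, and the majorants are M [poisson] inside and a multiple
    of |a| outside. *)
Lemma FT_inversion (s : R) a b : `|s| = 1 -> bounded_cintg a -> bounded_cintg b ->
  (forall x v, (fun m => complex.Re (b (x + em m *: v))) @ \oo --> complex.Re (b x) /\
    (fun m => complex.Im (b (x + em m *: v))) @ \oo --> complex.Im (b x)) ->
  cint mu (fun xi => FT s a xi * FT (- s) b xi) =
  ((2 * pi) ^+ n)%:C * cint mu (fun x => a x * b x).
Proof.
move=> s1 ba bb bcont; have [ca [Ma aMa]] := ba; have [cb [M bM]] := bb.
have M0 : 0 <= M by apply: le_trans (bM 0); exact: cmod_ge0.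
have Fa := FT_L2 s1 ba.
have Fb : L2 (FT (- s) b) by apply: FT_L2 => //; rewrite normrN.
have cFF := L2_cintgM Fa Fb.
have dc (r : R) (xi : Rn) : decay (em m) xi * r @[m --> \oo] --> r.
  rewrite -[X in _ --> X]mul1r.
  by apply: cvgM; [exact: decay_cvg1|exact: cvg_cst].
have L := @cint_dominated_everywhere
  (fun m xi => (decay (em m) xi)%:C * (FT s a xi * FT (- s) b xi))
  (fun xi => FT s a xi * FT (- s) b xi)
  (fun xi => cmod (FT s a xi * FT (- s) b xi))
  (fun m => cmeasM (@cintg_decay R n (em m) (em_gt0 m)).1 cFF.1) cFF.1.
have {}L : (fun m => complex.Re (cint mu (fun xi =>
        (decay (em m) xi)%:C * (FT s a xi * FT (- s) b xi)))) @ \oo -->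
      complex.Re (cint mu (fun xi => FT s a xi * FT (- s) b xi)) /\
    (fun m => complex.Im (cint mu (fun xi =>
        (decay (em m) xi)%:C * (FT s a xi * FT (- s) b xi)))) @ \oo -->
      complex.Im (cint mu (fun xi => FT s a xi * FT (- s) b xi)).
  apply: L (cintg_cmod cFF) _ => [xi|m xi].
    split.
      under eq_fun do rewrite cRe_realM.
      exact: dc.
    under eq_fun do rewrite cIm_realM.
    exact: dc.
  rewrite cmodM cmodC (ger0_norm (decay_ge0 _ _)) -[leRHS]mul1r ler_wpM2r ?cmod_ge0//.
  by rewrite decay_le1// ltW.
have inner x := @cint_dominated_everywhere
  (fun m w => (poisson w)%:C * b (x + em m *: w))
  (fun w => (poisson w)%:C * b x) (fun w => M * cmod (poisson w)%:C).
have mbx (x : Rn) m : cmeas (fun w : Rn => b (x + em m *: w)).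
  by apply: cmeas_comp_rV; [exact: measurable_affine|case: cb].
have ip : mu.-integrable setT (EFin \o (fun w => M * cmod (poisson w : R)%:C)).
  have := @integrableZl _ _ _ mu _ measurableT M _ (cintg_cmod (@cintg_poisson R n)).
  exact: eq_integrable.
have {}inner (x : Rn) : (fun m => complex.Re (cint mu (fun w => (poisson w)%:C * b (x + em m *: w))))
      @ \oo --> complex.Re (((2 * pi) ^+ n)%:C * b x) /\
    (fun m => complex.Im (cint mu (fun w => (poisson w)%:C * b (x + em m *: w))))
      @ \oo --> complex.Im (((2 * pi) ^+ n)%:C * b x).
  have -> : ((2 * pi) ^+ n)%:C * b x = cint mu (fun w => (poisson w)%:C * b x).
    under eq_cint do rewrite mulrC.
    rewrite cintZ; last exact: cintg_poisson.
    by rewrite cint_real /Rintegral integral_poisson mulrC.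
  apply: (inner x _ _ _ ip _).
  - by move=> m; apply: cmeasM => //; case: (@cintg_poisson R n).
  - by apply: cmeasM; [case: (@cintg_poisson R n)|exact: cmeas_cst].
  - move=> w; have [rc jc] := bcont x w; split.
      under eq_fun do rewrite cRe_realM.
      by rewrite cRe_realM; apply: cvgM => //; exact: cvg_cst.
    under eq_fun do rewrite cIm_realM.
    by rewrite cIm_realM; apply: cvgM => //; exact: cvg_cst.
  - by move=> m w; rewrite cmodM mulrC ler_wpM2r ?cmod_ge0.
have cin (x : Rn) m : cintg mu (fun w => (poisson w)%:C * b (x + em m *: w)).
  apply: (@le_cintg _ _ _ _ _ (fun w => M * cmod (poisson w : R)%:C)) => //.
    by apply: cmeasM => //; case: (@cintg_poisson R n).
  by move=> w; rewrite cmodM mulrC ler_wpM2r ?cmod_ge0.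
have RE m : cint mu (fun xi => (decay (em m) xi)%:C * (FT s a xi * FT (- s) b xi)) =
    cint mu (fun x => a x * cint mu (fun w => (poisson w)%:C * b (x + em m *: w))).
  rewrite (@FT_pairing R n s (em m) a b M s1 (em_gt0 m) ca cb bM).
  apply: eq_cint => x; rewrite -cintZ//; apply: eq_cint => w; by rewrite mulrA.
pose B := \int[mu]_x cmod (poisson x : R)%:C.
have L' := @cint_dominated_everywhere
  (fun m x => a x * cint mu (fun w => (poisson w)%:C * b (x + em m *: w)))
  (fun x => a x * (((2 * pi) ^+ n)%:C * b x)) (fun x => (M * B) * cmod (a x)).
have {}L' : (fun m => complex.Re (cint mu (fun x =>
        a x * cint mu (fun w => (poisson w)%:C * b (x + em m *: w))))) @ \oo -->
      complex.Re (cint mu (fun x => a x * (((2 * pi) ^+ n)%:C * b x))) /\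
    (fun m => complex.Im (cint mu (fun x =>
        a x * cint mu (fun w => (poisson w)%:C * b (x + em m *: w))))) @ \oo -->
      complex.Im (cint mu (fun x => a x * (((2 * pi) ^+ n)%:C * b x))).
  apply: L' => [m||x||m x].
  - have := cmeas_cint2 (cintg_poisson_tensor (em m) ca cb.1 bM).
    congr cmeas; apply/funext => x /=; rewrite -cintZ//.
    by apply: eq_cint => w; rewrite mulrA.
  - apply: cmeasM; first by case: ca.
    by apply: cmeasM; [exact: cmeas_cst|case: cb].
  - have [rc jc] := inner x; split.
      under eq_fun do rewrite cReM; rewrite cReM.
      by apply: cvgB; apply: cvgM => //; exact: cvg_cst.
    under eq_fun do rewrite cImM; rewrite cImM.
    by apply: cvgD; apply: cvgM => //; exact: cvg_cst.
  - have := @integrableZl _ _ _ mu _ measurableT (M * B) _ (cintg_cmod ca).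
    exact: eq_integrable.
  - rewrite cmodM mulrC ler_wpM2r ?cmod_ge0//.
    apply: (le_trans (cmod_cint_le (cin x m))).
    rewrite /B -RintegralZl//; last exact: (cintg_cmod (@cintg_poisson R n)).
    apply: le_Rintegral => //.
    + exact: (cintg_cmod (cin x m)).
    + by move=> w _; rewrite cmodM mulrC ler_wpM2r ?cmod_ge0.
have <- : cint mu (fun x => a x * (((2 * pi) ^+ n)%:C * b x)) =
    ((2 * pi) ^+ n)%:C * cint mu (fun x => a x * b x).
  rewrite -cintZ; last exact: (L2_cintgM (bounded_cintg_L2 ba) (bounded_cintg_L2 bb)).
  by apply: eq_cint => x; rewrite mulrCA.
move: L L' => [rL jL] [rL' jL'].
have U (u v : nat -> R) (l l' : R) : u =1 v -> u @ \oo --> l ->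
    v @ \oo --> l' -> l = l'.
  by move=> /funext ->; exact: cvg_unique.
by apply: complex_ext; [apply: U _ rL rL'|apply: U _ jL jL'] => m; rewrite RE.
Qed.

End fourier_L2.

(** * Schwartz functions *)

Section continuous_rV.
Context {R : realType} {n : nat}.
Local Notation Rn := 'rV[R]_n.

Lemma mx_norm_le_coord (x : Rn) (c : R) : 0 <= c ->
  (forall i, `|x ord0 i| <= c) -> `|x| <= c.
Proof.
move=> c0 xc; have [x0|x0] := eqVneq (mx_norm x) 0.
  by rewrite (x0 : `|x| = 0).
have [[i j] /= xij] := mx_norm_neq0 x0.
by rewrite (xij : `|x| = _) ord1.
Qed.

Let grid (m : nat) (z : 'rV[int]_n) : Rn := \row_i ((z ord0 i)%:~R / m.+1%:R).

Let cell (m : nat) (x : Rn) : 'rV[int]_n :=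
  \row_i Num.floor (x ord0 i * m.+1%:R).

Let grid_cvg (x : Rn) : grid m (cell m x) @[m --> \oo] --> x.
Proof.
apply/cvgrPdist_le => /= e e0.
have := @cvg_harmonic R => /cvgr0Pnorm_le /(_ e e0); apply: filterS => m /= me.
apply: le_trans me; rewrite ger0_norm//.
apply: mx_norm_le_coord => // i; rewrite !mxE.
have := floor_itv (x ord0 i * m.+1%:R).
set z : R := (Num.floor _)%:~R => /andP[zl zr].
have m0 : 0 < m.+1%:R :> R by [].
have -> : x ord0 i - z / m.+1%:R = (x ord0 i * m.+1%:R - z) * m.+1%:R^-1.
  by field.
rewrite normrM (ger0_norm (_ : 0 <= m.+1%:R^-1))// -[leRHS]mul1r ler_wpM2r//.
rewrite ger0_norm ?subr_ge0//.
by move: zr; rewrite intrD /= -/z => /ltW; rewrite -lerBlDl.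
Qed.

Let measurable_cell m (z : 'rV[int]_n) : measurable [set x | cell m x = z].
Proof.
rewrite (_ : [set _ | _] = \bigcap_(i in [set: 'I_n])
    ((fun x : Rn => x ord0 i * m.+1%:R) @^-1`
       `[(z ord0 i)%:~R, (z ord0 i + 1)%:~R[%classic)).
  apply: fin_bigcap_measurable => // i _; rewrite -[X in measurable X]setTI.
  apply: (measurable_funM (measurable_coord i) (measurable_cst _)) => //.
apply/seteqP; split=> x /=.
  by move=> <- i _ /=; rewrite in_itv /= !mxE floor_itv.
move=> H; apply/rowP => i; rewrite !mxE; apply/eqP.
by rewrite floor_eq; have := H i I; rewrite /= in_itv.
Qed.

(** The sigma-algebra is generated by the coordinates, so continuity must be linked to it by hand: f
    is the pointwise limit of its values at points rounded down to the grid of mesh 1/(m+1), and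
    such a rounded function takes countably many values, each on a union of measurable cells. *)
Lemma continuous_measurable_rV (f : Rn -> R) :
  continuous f -> measurable_fun setT f.
Proof.
move=> cf; apply: (@measurable_fun_cvg _ _ _ setT (fun m x => f (grid m (cell m x)))).
  move=> m _ Y mY; rewrite setTI.
  rewrite (_ : _ @^-1` Y = \bigcup_k (if unpickle k is Some z then
      if f (grid m z) \in Y then [set x | cell m x = z] else set0 else set0)).
    apply: bigcupT_measurable => k; case: unpickle => [z|//].
    by case: ifP => // _; exact: measurable_cell.
  apply/seteqP; split=> [x /= Yx|x /= [k _]].
    by exists (pickle (cell m x)) => //; rewrite pickleK mem_set.
  case: unpickle => [z|//]; case: ifPn => [|//].
  by rewrite inE => Yz /= ->.
move=> x _; apply: (cvg_comp _ _ (@grid_cvg x)).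
exact: cf.
Qed.

End continuous_rV.

Section schwartz.
Context {R : realType} {n : nat}.
Local Open Scope complex_scope.
Local Notation mu := (@lebesgue_rV R n).
Local Notation Rn := 'rV[R]_n.
Implicit Types (f : Rn -> R[i]) (psi : Rn -> R[i]).

Lemma partial_nil psi : partial [::] psi = psi.
Proof. by apply/funext => x; rewrite /partial /=; case: (psi x). Qed.

Lemma schwartz_continuous psi : schwartz psi ->
  continuous (fun x => complex.Re (psi x)) /\ continuous (fun x => complex.Im (psi x)).
Proof. by move=> [sr si _]; split; [exact: (sr [::]).1|exact: (si [::]).1]. Qed.

Lemma prod_oneDsqr_le (x : Rn) :
  \prod_(i < n) (1 + x ord0 i ^+ 2) <= 2 ^+ n * (1 + enorm x ^+ (n.*2)).
Proof.
apply: (@le_trans _ _ ((1 + enorm x ^+ 2) ^+ n)).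
  have -> : (1 + enorm x ^+ 2) ^+ n = \prod_(i < n) (1 + enorm x ^+ 2).
    by rewrite prodr_const card_ord.
  apply: ler_prod => i _; rewrite addr_ge0 ?sqr_ge0//= lerD2l -[leLHS]real_normK ?num_real//.
  by rewrite ler_pXn2r ?nnegrE ?enorm_ge0// coord_le_enorm.
rewrite -mul2n exprM; set t := enorm x ^+ 2.
have t0 : 0 <= t by rewrite sqr_ge0.
have [t1|t1] := leP t 1.
  apply: (@le_trans _ _ (2 ^+ n)).
    by apply: lerXn2r; rewrite ?nnegrE ?addr_ge0//; lra.
  by rewrite -[leLHS]mulr1 ler_wpM2l ?exprn_ge0// lerDl exprn_ge0.
apply: (@le_trans _ _ (2 ^+ n * t ^+ n)).
  have t2 : 1 + t <= 2 * t by lra.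
  by rewrite -exprMn; apply: lerXn2r => //; rewrite nnegrE; lra.
by rewrite ler_wpM2l ?exprn_ge0// lerDr.
Qed.

(** The product of the 1 + x_i^2 is at most 2^n (1 + |x|^(2n)), so the bounds for k = 0 and k = 2n
    control it against [psi], with the constant 2^n * 2. The same product times [poisson] equals
    2^n, hence is at least 1. *)
Lemma le_poisson (psi : Rn -> R[i]) (M : R) :
  (forall k x, (k <= n.*2)%N -> enorm x ^+ k * cmod (psi x) <= M) ->
  forall x, cmod (psi x) <= 2 ^+ n.+1 * M * poisson x.
Proof.
move=> H x; pose D := \prod_(i < n) (1 + x ord0 i ^+ 2).
have D1 : 0 < D by apply: prodr_gt0 => i _; rewrite ltr_pwDl// sqr_ge0.
have Dp : 1 <= D * poisson x.
  rewrite /D /poisson -big_split /= (eq_bigr (fun=> 2)).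
    by rewrite prodr_const card_ord exprn_ege1// ler1n.
  by move=> i _; rewrite mulrCA divff ?mulr1// gt_eqF// ltr_pwDl// sqr_ge0.
have h0 := H 0 x (leq0n _); rewrite expr0 mul1r in h0.
have h1 := H n.*2 x (leqnn _).
have M0 : 0 <= M by apply: le_trans h0; exact: cmod_ge0.
have HD : D * cmod (psi x) <= 2 ^+ n.+1 * M.
  apply: (le_trans (ler_wpM2r (cmod_ge0 _) (prod_oneDsqr_le x))).
  rewrite -mulrA exprSr -mulrA ler_wpM2l ?exprn_ge0// mulrDl mul1r.
  by rewrite (natrD _ 1 1) mulrDl mul1r lerD.
apply: (@le_trans _ _ (D * poisson x * cmod (psi x))).
  by rewrite -[leLHS]mul1r ler_wpM2r// cmod_ge0.
by rewrite mulrAC ler_wpM2r// poisson_ge0.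
Qed.

Lemma schwartz_le_poisson psi : schwartz psi ->
  exists M, forall x, cmod (psi x) <= M * poisson x.
Proof.
move=> [_ _ H].
have /choice[M HM] (k : nat) : exists M : R, forall x, enorm x ^+ k * cmod (psi x) <= M.
  by have [M HM] := H k [::]; exists M; move: HM; rewrite partial_nil.
have M0 k : 0 <= M k.
  by apply: le_trans (HM k 0); rewrite mulr_ge0 ?exprn_ge0 ?enorm_ge0 ?cmod_ge0.
exists (2 ^+ n.+1 * \sum_(k < n.*2.+1) M k); apply: le_poisson => k x kn.
apply: (le_trans (HM k x)).
have kn' : (k < n.*2.+1)%N by rewrite ltnS.
rewrite (bigD1 (Ordinal kn'))//= lerDl; exact: sumr_ge0.
Qed.

Lemma poisson_le (x : Rn) : poisson x <= 2 ^+ n.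
Proof.
rewrite -[in leRHS](card_ord n) -prodr_const; apply: ler_prod => i _.
rewrite divr_ge0 ?addr_ge0 ?sqr_ge0//= ler_pdivrMr ?ltr_pwDl ?sqr_ge0//.
by rewrite ler_peMr// lerDl sqr_ge0.
Qed.

Lemma schwartz_bounded_cintg psi : schwartz psi -> bounded_cintg psi.
Proof.
move=> sp; have [M HM] := schwartz_le_poisson sp.
have [cr ci] := schwartz_continuous sp.
split; last first.
  have [_ _ /(_ 0 [::])[B HB]] := sp; exists B => x.
  by have := HB x; rewrite partial_nil expr0 mul1r.
apply: (@le_cintg _ _ _ _ _ (fun x => M * poisson x)) => //.
  by split; exact: continuous_measurable_rV.
have := @integrableZl _ _ _ mu _ measurableT M _ (cintg_Re (@cintg_poisson R n)).
exact: eq_integrable.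
Qed.

Lemma schwartz_cvg_line psi : schwartz psi -> forall x v : Rn,
  (fun m : nat => complex.Re (psi (x + m.+1%:R^-1 *: v))) @ \oo --> complex.Re (psi x) /\
  (fun m : nat => complex.Im (psi (x + m.+1%:R^-1 *: v))) @ \oo --> complex.Im (psi x).
Proof.
move=> /schwartz_continuous[cr ci] x v.
have L : (fun m : nat => x + m.+1%:R^-1 *: v) @ \oo --> x.
  rewrite -[X in _ --> X]addr0; apply: cvgD; first exact: cvg_cst.
  rewrite -[X in _ --> X](scale0r v); apply: cvgZr_tmp.
  exact: cvg_harmonic.
by split; [exact: (cvg_comp _ _ L (cr x))|exact: (cvg_comp _ _ L (ci x))].
Qed.

Lemma L2_poisson : @L2 R n (fun x => (poisson x)%:C).
Proof.
apply: bounded_cintg_L2; split; first exact: cintg_poisson.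
exists (2 ^+ n) => x; rewrite cmodC ger0_norm ?poisson_ge0//.
exact: poisson_le.
Qed.

(** Seminorms of order at most 2n dominate a Schwartz function by [poisson], which is in L^2; the
    continuity constant is thus a multiple of the integral of |f| [poisson]. *)
Lemma tempered_L2 f : L2 f -> tempered (distr_of f).
Proof.
move=> Lf; have Ls psi : schwartz psi -> cintg mu (fun x => f x * psi x).
  by move=> sp; apply: L2_cintgM => //; exact/bounded_cintg_L2/schwartz_bounded_cintg.
split.
  move=> a p1 p2 s1 s2; rewrite /distr_of.
  rewrite [LHS](_ : _ = cint mu (fun x => a * (f x * p1 x) + f x * p2 x)).
    by rewrite cintD ?cintZ//; [exact: Ls|exact: cintgZ (Ls _ s1)|exact: Ls].
  by apply: eq_cint => x; ring.
have cfp := L2_cintgM Lf L2_poisson.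
pose I := \int[mu]_x cmod (f x * (poisson x)%:C).
exists n.*2, (2 ^+ n.+1 * I) => psi M sp H.
have HP := @le_poisson psi M _.
have {}HP : forall x, cmod (psi x) <= 2 ^+ n.+1 * M * poisson x.
  by apply: HP => k x kn; have := H k [::] x kn (leq0n _); rewrite partial_nil.
apply: (le_trans (cmod_cint_le (Ls _ sp))).
rewrite mulrAC /I -RintegralZl//; last exact: (cintg_cmod cfp).
apply: le_Rintegral => //.
- exact: (cintg_cmod (Ls _ sp)).
- have := @integrableZl _ _ _ mu _ measurableT (2 ^+ n.+1 * M) _ (cintg_cmod cfp).
  exact: eq_integrable.
- move=> x _; rewrite !cmodM cmodC (ger0_norm (poisson_ge0 _)) mulrCA.
  by rewrite ler_wpM2l ?cmod_ge0.
Qed.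

End schwartz.

(** * Series of functions with geometrically decaying L^2 norms *)

Section L2_series.
Context {R : realType} {n : nat}.
Local Open Scope complex_scope.
Local Notation mu := (@lebesgue_rV R n).
Local Notation Rn := 'rV[R]_n.

Definition cpsum (z : nat -> R[i]) (N : nat) : R[i] := \sum_(l < N) z l.

Definition ccvg (z : nat -> R[i]) (w : R[i]) : Prop :=
  (fun N => complex.Re (z N)) @ \oo --> complex.Re w /\
  (fun N => complex.Im (z N)) @ \oo --> complex.Im w.

Lemma ccvg_unique z w w' : ccvg z w -> ccvg z w' -> w = w'.
Proof.
by move=> [rw jw] [rw' jw']; apply: complex_ext;
  [exact: cvg_unique rw rw'|exact: cvg_unique jw jw'].
Qed.

Lemma eq_ccvg z z' w : z =1 z' -> ccvg z w -> ccvg z' w.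
Proof. by move=> /funext ->. Qed.

Lemma ccvgZ z w (c : R[i]) : ccvg z w -> ccvg (fun N => c * z N) (c * w).
Proof.
move=> [rw jw]; split.
  under eq_fun do rewrite cReM; rewrite cReM.
  by apply: cvgB; apply: cvgM => //; exact: cvg_cst.
under eq_fun do rewrite cImM; rewrite cImM.
by apply: cvgD; apply: cvgM => //; exact: cvg_cst.
Qed.

Lemma ccvg_cmod z w : ccvg z w -> (fun N => cmod (z N)) @ \oo --> cmod w.
Proof.
have E u : cmod u = Num.sqrt (complex.Re u ^+ 2 + complex.Im u ^+ 2) :> R.
  by case: u.
move=> [rw jw]; under eq_fun do rewrite E; rewrite E.
have H : (fun N => complex.Re (z N) ^+ 2 + complex.Im (z N) ^+ 2) @ \oo -->
    complex.Re w ^+ 2 + complex.Im w ^+ 2.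
  by apply: cvgD; rewrite expr2; under eq_fun do rewrite expr2; exact: cvgM.
exact: (cvg_comp _ _ H (@sqrt_continuous R _)).
Qed.

Lemma cRe_sum I (r : seq I) (F : I -> R[i]) :
  complex.Re (\sum_(i <- r) F i) = \sum_(i <- r) complex.Re (F i).
Proof. by elim/big_ind2: _ => [//|a b c d <- <-|//]; rewrite cReD. Qed.

Lemma cIm_sum I (r : seq I) (F : I -> R[i]) :
  complex.Im (\sum_(i <- r) F i) = \sum_(i <- r) complex.Im (F i).
Proof. by elim/big_ind2: _ => [//|a b c d <- <-|//]; rewrite cImD. Qed.

Definition csum (z : nat -> R[i]) : R[i] :=
  limn (fun N => complex.Re (cpsum z N)) +i* limn (fun N => complex.Im (cpsum z N)).

Lemma geometric_half_cvg (B : R) :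
  cvgn (series (fun l => B * 2^-1 ^+ l)).
Proof.
apply: is_cvg_geometric_series.
by rewrite ger0_norm ?invr_ge0// invf_lt1 ?ltr1n.
Qed.

Lemma csum_cvg (z : nat -> R[i]) (B : R) : (forall l, cmod (z l) <= B * 2^-1 ^+ l) ->
  ccvg (cpsum z) (csum z).
Proof.
move=> zB.
have H (p : R[i] -> R) : (forall u, `|p u| <= cmod u) ->
    (forall N, p (cpsum z N) = \sum_(l < N) p (z l)) ->
    (fun N => p (cpsum z N)) @ \oo --> limn (fun N => p (cpsum z N)).
  move=> pc pS; have -> : (fun N => p (cpsum z N)) = series (fun l => p (z l)).
    by apply/funext => N; rewrite pS seriesEord.
  apply: normed_cvg.
  apply: (@series_le_cvg _ (fun l => `|p (z l)|) (fun l => B * 2^-1 ^+ l)) => //.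
  - by move=> l; apply: le_trans (zB l); exact: cmod_ge0.
  - by move=> l /=; apply: le_trans (zB l); exact: pc.
  - exact: geometric_half_cvg.
by split; apply: H; [exact: normr_Re_le|move=> N; rewrite cRe_sum|
  exact: normr_Im_le|move=> N; rewrite cIm_sum].
Qed.

Lemma cpsum_le (z : nat -> R[i]) (B : R) N : (forall l, cmod (z l) <= B * 2^-1 ^+ l) ->
  cmod (cpsum z N) <= 2 * B.
Proof.
move=> zB; have B0 : 0 <= B.
  by have := zB 0%N; rewrite expr0 mulr1; apply: le_trans; exact: cmod_ge0.
apply: (le_trans (cmod_sum _ _ _)).
apply: (@le_trans _ _ (\sum_(l < N) B * 2^-1 ^+ l)); first exact: ler_sum.
rewrite -mulr_sumr mulrC ler_wpM2r//.
suff -> : \sum_(l < N) 2^-1 ^+ l = 2 - 2 * 2^-1 ^+ N :> R.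
  by rewrite gerDl oppr_le0 mulr_ge0// exprn_ge0// invr_ge0.
elim: N => [|N IH]; first by rewrite big_ord0 expr0 mulr1 subrr.
by rewrite big_ord_recr /= IH exprS; field.
Qed.

Lemma csum_le (z : nat -> R[i]) (B : R) : (forall l, cmod (z l) <= B * 2^-1 ^+ l) ->
  cmod (csum z) <= 2 * B.
Proof.
move=> zB; have := ccvg_cmod (csum_cvg zB) => H.
rewrite -(cvg_lim _ H)//; apply: limr_le; first by apply/cvg_ex; eexists; exact: H.
by apply: nearW => N; exact: cpsum_le.
Qed.

Lemma cmeas_ccvg (F : nat -> Rn -> R[i]) (f : Rn -> R[i]) :
  (forall N, cmeas (F N)) -> (forall x, ccvg (F ^~ x) (f x)) -> cmeas f.
Proof.
move=> mF Ff; split.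
  apply: (@measurable_fun_cvg _ _ _ setT (fun N x => complex.Re (F N x))).
    by move=> N; case: (mF N).
  by move=> x _; case: (Ff x).
apply: (@measurable_fun_cvg _ _ _ setT (fun N x => complex.Im (F N x))).
  by move=> N; case: (mF N).
by move=> x _; case: (Ff x).
Qed.

(* Weighting the terms by [4^l] makes the single majorant
   [sqrt (sum_l 4^l |z_l|^2)] dominate every tail geometrically. *)
Lemma L2_series (z : nat -> Rn -> R[i]) (C : R) : (forall l, cmeas (z l)) ->
  (forall l, (\int[mu]_x (cmod (z l x) ^+ 2)%:E <= (C * 16 ^- l)%:E)%E) ->
  exists S : Rn -> R[i], [/\ L2 S,
    {ae mu, forall x, ccvg (fun N => cpsum (z ^~ x) N) (S x)} &
    forall g : Rn -> R[i], L2 g ->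
      ccvg (fun N => \sum_(l < N) cint mu (fun x => z l x * g x))
        (cint mu (fun x => S x * g x))].
Proof.
move=> mz zC.
pose w l x := ((4 ^+ l * cmod (z l x) ^+ 2)%:E).
pose W x := (\sum_(l <oo) w l x)%E.
have mw l : measurable_fun setT (w l).
  apply/measurable_EFinP; apply: measurable_funM => //.
  by apply: measurable_funX; exact: measurable_cmod.
have w0 l x : (0 <= w l x)%E.
  by rewrite /w lee_fin mulr_ge0// exprn_ge0// cmod_ge0.
have mW : measurable_fun setT W.
  by apply: ge0_emeasurable_sum => // l x _ _; exact: w0.
have W0 x : (0 <= W x)%E by apply: nneseries_ge0 => l _ _; exact: w0.
have C0 : 0 <= C.
  have := zC 0%N; rewrite expr0 invr1 mulr1 -lee_fin; apply: le_trans.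
  by apply: integral_ge0 => x _; rewrite lee_fin sqr_ge0.
have IW : (\int[mu]_x W x < +oo)%E.
  rewrite integral_nneseries//.
  apply: (@le_lt_trans _ _ (\sum_(l <oo) (C * 4^-1 ^+ l)%:E)%E).
    apply: lee_nneseries => [l _ _|l _].
      by apply: integral_ge0 => x _; exact: w0.
    rewrite /w; under eq_integral do rewrite EFinM.
    rewrite ge0_integralZl//; last 2 first.
    - exact: (measurable_sqr_cmod (mz l)).
    - by move=> x _; rewrite lee_fin sqr_ge0.
    apply: (le_trans (lee_wpmul2l _ (zC l))); first by rewrite lee_fin exprn_ge0.
    rewrite -EFinM lee_fin mulrCA ler_wpM2l//.
    rewrite (_ : 16 = 4 * 4 :> R); last by rewrite -natrM.
    rewrite exprMn invfM mulrA divff ?expf_neq0// mul1r exprVn//.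
  rewrite (_ : (fun N => _) = EFin \o series (fun l => C * 4^-1 ^+ l)); last first.
    by apply/funext => N; rewrite /= /series /= sumEFin.
  have cv : cvgn (series (fun l => C * 4^-1 ^+ l)).
    apply: is_cvg_geometric_series.
    by rewrite ger0_norm ?invr_ge0// invf_lt1 ?ltr1n.
  by rewrite EFin_lim// ltry.
(* Cutting the terms off to 0 on the null set where the majorant is infinite makes the geometric
   bound, and hence convergence, hold at every point; measurability of the sum and dominated
   convergence then need no exceptional set. *)
pose E := [set x | (W x < +oo)%E].
have mE : measurable E.
  by rewrite /E -(setTI [set x | _]); exact: emeasurable_fun_infty_o.
pose y l x : R[i] := (\1_E x)%:C * z l x.
have my l : cmeas (y l).
  by apply: cmeasM => //; apply: cmeas_real; exact: measurable_indic.
pose q x := Num.sqrt (fine (W x)).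
have q0 x : 0 <= q x by exact: sqrtr_ge0.
have cq x : cmod (q x)%:C = q x by rewrite cmodC ger0_norm.
have yq l x : cmod (y l x) <= q x * 2^-1 ^+ l.
  rewrite cmodM cmodC indicE; have [|] := boolP (x \in E); last first.
    by rewrite normr0 mul0r mulr_ge0 ?sqrtr_ge0// exprn_ge0// invr_ge0.
  rewrite inE /E /= => Wx; rewrite normr1 mul1r.
  have Wf : W x \is a fin_num by rewrite ge0_fin_numE.
  rewrite -(@ler_pXn2r _ 2) ?nnegrE ?cmod_ge0 ?mulr_ge0 ?sqrtr_ge0 ?exprn_ge0 ?invr_ge0//.
  rewrite exprMn /q sqr_sqrtr ?fine_ge0// -exprM mulnC exprM.
  rewrite exprVn -natrX exprVn ler_pdivlMr ?exprn_gt0// mulrC.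
  rewrite -lee_fin fineK//.
  rewrite /W (@nneseriesD1 _ _ l xpredT)//.
  rewrite -[leLHS]adde0; apply: leeD => //.
  by apply: nneseries_ge0 => k _ _; exact: w0.
exists (fun x => csum (y ^~ x)).
have cv x : ccvg (cpsum (y ^~ x)) (csum (y ^~ x)) by apply: csum_cvg (yq ^~ x).
have aeE : {ae mu, forall x, E x}.
  have : mu.-integrable setT W.
    apply/integrableP; split=> //.
    by under eq_integral do rewrite gee0_abs//.
  move=> /(integrable_ae measurableT); apply: filterS => x /(_ I).
  by rewrite ge0_fin_numE.
have mS : cmeas (fun x => csum (y ^~ x)).
  apply: (@cmeas_ccvg (fun N x => cpsum (y ^~ x) N)) => //.
  by move=> N; apply: cmeas_sum => i; exact: my.
have mq : measurable_fun setT q.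
  apply: (@measurableT_comp _ _ _ _ _ _ (@Num.sqrt R)).
    by apply: continuous_measurable_fun; exact: sqrt_continuous.
  exact: measurableT_comp.
have L2q : @L2 R n (fun x => (q x)%:C).
  split; first exact: cmeas_real.
  apply: le_lt_trans IW; apply: ge0_le_integral => //.
  - by move=> x _; rewrite lee_fin sqr_ge0.
  - by apply: measurable_sqr_cmod; exact: cmeas_real.
  - move=> x _; rewrite cmodC ger0_norm ?sqrtr_ge0// sqr_sqrtr ?fine_ge0//.
    have := W0 x; case: (W x) => [r| |] //=.
split.
- split=> //.
  (* The 4 is the square of the factor 2 in [csum_le]. *)
  apply: (@le_lt_trans _ _ (\int[mu]_x (4%:E * (cmod (q x)%:C ^+ 2)%:E))%E).
    apply: ge0_le_integral => //.
    + by move=> x _; rewrite lee_fin sqr_ge0.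
    + exact: measurable_sqr_cmod.
    + by apply: measurable_funeM; apply: measurable_sqr_cmod; exact: cmeas_real.
    + move=> x _; rewrite -EFinM lee_fin (_ : 4 = 2 ^+ 2); last by rewrite -natrX.
      rewrite -exprMn ler_pXn2r ?nnegrE ?mulr_ge0 ?cmod_ge0//.
      rewrite cq.
      exact: (csum_le (yq ^~ x)).
  rewrite ge0_integralZl//; last 2 first.
  + by apply: measurable_sqr_cmod; exact: cmeas_real.
  + by move=> x _; rewrite lee_fin sqr_ge0.
  by rewrite lte_mul_pinfty// L2q.2.
- apply: filterS aeE => x Ex; have := cv x.
  by rewrite /y indicE mem_set//; under eq_fun do rewrite mul1r.
- move=> g Lg.
  have cqg := L2_cintgM L2q Lg.
  have Lz l : L2 (z l).
    by split; [exact: mz|apply: (le_lt_trans (zC l)); exact: ltry].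
  have zy l : cint mu (fun x => z l x * g x) = cint mu (fun x => y l x * g x).
    apply: ae_eq_cint; [apply: cmeasM => //; exact: Lg.1|apply: cmeasM => //; exact: Lg.1|].
    by apply: filterS aeE => x Ex; rewrite /y indicE mem_set// mul1r.
  have cyg l : cintg mu (fun x => y l x * g x).
    apply: (@cintg_le _ _ _ _ _ (fun x => (q x)%:C * g x)) => //.
      by apply: cmeasM => //; exact: Lg.1.
    move=> x; rewrite [leLHS]cmodM [leRHS]cmodM cq ler_wpM2r ?cmod_ge0//.
    apply: (le_trans (yq l x)); rewrite -[leRHS]mulr1 ler_wpM2l//.
    by rewrite exprn_ile1// ?invr_ge0// invf_le1// ler1n.
  have := @cint_dominated_everywhere R n (fun N x => cpsum (y ^~ x) N * g x)
    (fun x => csum (y ^~ x) * g x) (fun x => 2 * cmod ((q x)%:C * g x)).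
  move=> D.
  have E2 N : \sum_(l < N) cint mu (fun x => z l x * g x) =
      cint mu (fun x => cpsum (y ^~ x) N * g x).
    under eq_bigr do rewrite zy.
    rewrite -cint_sum//; apply: eq_cint => x.
    by rewrite /cpsum mulr_suml.
  apply: (eq_ccvg (fun N => esym (E2 N))); apply: D.
  + by move=> N; apply: cmeasM; [apply: cmeas_sum => i; exact: my|exact: Lg.1].
  + by apply: cmeasM => //; exact: Lg.1.
  + move=> x; have := ccvgZ (g x) (cv x); rewrite (mulrC (g x)).
    by apply: eq_ccvg => N; rewrite mulrC.
  + have := @integrableZl _ _ _ mu _ measurableT 2 _ (cintg_cmod cqg).
    exact: eq_integrable.
  + move=> N x; rewrite [leLHS]cmodM cmodM cq mulrA ler_wpM2r ?cmod_ge0//.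
    exact: (cpsum_le N (yq ^~ x)).
Qed.

End L2_series.

(** * Polar coordinates *)

Section polar.
Context {R : realType}.
Local Notation mu := (@lebesgue_measure R).

Lemma integral_inv (a b : R) : 0 < a -> a < b ->
  (\int[mu]_(x in `[a, b]) (x^-1)%:E = (ln b - ln a)%:E)%E.
Proof.
move=> a0 ab.
have pos x : x \in `[a, b] -> 0 < x.
  by rewrite in_itv /= => /andP[ax _]; exact: lt_le_trans ax.
have cln x : x \in `[a, b] -> {for x, continuous (@ln R)}.
  by move=> /pos x0; exact: continuous_ln.
rewrite (@continuous_FTC2 _ _ (@ln R)) ?EFinB//.
- apply: continuous_in_subspaceT => x; rewrite inE /= => /pos x0.
  by apply: cvgV; [rewrite gt_eqF|exact: cvg_id].
- split.
  + move=> x; rewrite in_itv /= => /andP[ax _].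
    by apply: ex_derive; apply: is_derive1_ln; exact: lt_trans ax.
  + by apply: cvg_at_right_filter; apply: cln; rewrite in_itv /= lexx ltW.
  + by apply: cvg_at_left_filter; apply: cln; rewrite in_itv /= lexx ltW.
- move=> x; rewrite in_itv /= => /andP[ax _].
  by rewrite derive1E; apply: derive_val; apply: is_derive1_ln; exact: lt_trans ax.
Qed.

Lemma measurable_invr : measurable_fun setT (fun x : R => x^-1).
Proof.
have -> : (fun x : R => x^-1) = (fun x => if 0 < x then expR (- ln x) else
    if x < 0 then - expR (- ln (- x)) else 0).
  apply/funext => x; have [x0|x0|<-] := ltgtP 0 x.
  - by rewrite expRN lnK.
  - by rewrite expRN lnK ?posrE ?oppr_gt0// invrN opprK.
  - by rewrite invr0.
have mln : measurable_fun setT (@ln R) by exact: measurable_ln.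
apply: measurable_fun_ifT; first exact: measurable_fun_ltr.
  by apply: measurableT_comp => //; exact: measurableT_comp.
apply: measurable_fun_ifT => //; first exact: measurable_fun_ltr.
apply: measurableT_comp => //; apply: measurableT_comp => //.
apply: measurableT_comp => //; apply: (measurableT_comp mln).
exact: oppr_measurable.
Qed.

(** The density of the dilation-invariant measure dr/r on the half-line; [rhoM] is this
    invariance. *)
Definition rho (r : R) : R := if 0 < r then r^-1 else 0.

Lemma rho_ge0 r : 0 <= rho r.
Proof. by rewrite /rho; case: ifPn => // r0; rewrite invr_ge0 ltW. Qed.

Lemma measurable_rho : measurable_fun setT rho.
Proof.
apply: measurable_fun_ifT => //; first exact: measurable_fun_ltr.
exact: measurable_invr.
Qed.

Lemma rhoM (c r : R) : 0 < c -> c * rho (c * r) = rho r.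
Proof.
move=> c0; rewrite /rho pmulr_rgt0//; case: ifPn => r0; last by rewrite mulr0.
by rewrite invfM mulrA divff ?mul1r// gt_eqF.
Qed.

Variable n : nat.
Hypothesis n0 : (0 < n)%N.
Local Notation Rn := 'rV[R]_n.
Local Notation lam := (@lebesgue_rV R n).

Definition shell (e : Rn) : R := if 1 < enorm e <= 2 then enorm e ^- n else 0.

Lemma shell_ge0 e : 0 <= shell e.
Proof. by rewrite /shell; case: ifPn => // _; rewrite invr_ge0 exprn_ge0// enorm_ge0. Qed.

Lemma measurable_enormVn : measurable_fun setT (fun e : Rn => enorm e ^- n).
Proof.
apply: (measurableT_comp measurable_invr); apply: measurable_funX.
exact: measurable_enorm.
Qed.

Lemma measurable_shell : measurable_fun setT shell.
Proof.
apply: measurable_fun_ifT => //; last exact: measurable_enormVn.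
by apply: measurable_and; [apply: measurable_fun_ltr|apply: measurable_fun_ler] => //;
  exact: measurable_enorm.
Qed.

(** The scales s that bring a point of norm u into the shell fill an interval of ratio 2, whose
    dr/r-measure does not depend on u. *)
Lemma integral_rho_shell (u : R) : 0 < u ->
  (\int[mu]_s (rho s * (if s < u <= 2 * s then 1 else 0))%:E = (ln 2)%:E)%E.
Proof.
move=> u0.
transitivity (\int[mu]_(s in `[(u / 2)%R, u[) (s^-1)%:E)%E.
  rewrite [RHS]integral_mkcond; apply: eq_integral => s _.
  rewrite patchE mem_setE in_itv /=.
  have -> : (u / 2 <= s < u) = (s < u <= 2 * s).
    by rewrite andbC ler_pdivrMr// mulrC.
  case: ifPn => [/andP[su us]|_]; last by rewrite mulr0.
  by rewrite mulr1 /rho ifT//; lra.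
have u2 : u / 2 < u by lra.
rewrite integral_itv_bndo_bndc; last first.
  by apply/measurable_EFinP; apply: measurable_funTS; exact: measurable_invr.
rewrite integral_inv//; last by lra.
rewrite -ln_div ?posrE//; last by lra.
by congr ((ln _)%:E); field; rewrite gt_eqF.
Qed.

Local Open Scope ereal_scope.

(* Polar coordinates without a surface measure: the sphere is replaced by the
   shell [1 < |e| <= 2] with density [|e|^-n], whence the factor [ln 2]. *)
Lemma polar (H : Rn -> \bar R) : measurable_fun setT H -> (forall x, 0 <= H x) ->
  (ln 2)%:E * \int[lam]_x ((enorm x ^- n)%:E * H x) =
  \int[lam]_e ((shell e)%:E *
     \int[mu]_r ((rho r)%:E * H (r *: ((enorm e)^-1 *: e))%R)).
Proof.
move=> mH H0.
have mrho : measurable_fun setT (fun r : R => (rho r)%:E).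
  by apply/measurable_EFinP; exact: measurable_rho.
have mshell : measurable_fun setT (fun e => (shell e)%:E).
  by apply/measurable_EFinP; exact: measurable_shell.
have rho0 r : 0 <= (rho r)%:E by rewrite lee_fin rho_ge0.
have sh0 e : 0 <= (shell e)%:E by rewrite lee_fin shell_ge0.
have mline (e : Rn) : measurable_fun setT (fun r : R => H (r *: e)%R).
  apply: (measurableT_comp mH); apply/measurable_fun_rVP => i.
  by under eq_fun do rewrite mxE; apply: measurable_funM.
symmetry.
transitivity (\int[lam]_e \int[mu]_s ((shell e)%:E * ((rho s)%:E * H (s *: e)%R))).
  apply: eq_integral => e _.
  have [se|se] := eqVneq (shell e) 0%R.
    by rewrite se mul0e; apply/esym; apply: integral0_eq => s _; rewrite mul0e.
  have e0 : (0 < enorm e)%R.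
    by move: se; rewrite /shell; case: ifPn => [/andP[/(lt_trans ltr01)]|_ /eqP].
  rewrite ge0_integralZl//; last 2 first.
  - by apply: emeasurable_funM => //; exact: mline.
  - by move=> s _; exact: mule_ge0.
  congr (_ * _).
  (* The substitution r = |e| s leaves dr/r invariant and replaces the unit direction by [e]
     itself. *)
  rewrite (@ge0_integral_affine1 _ 0%R (enorm e)
    (fun r => (rho r)%:E * H (r *: ((enorm e)^-1 *: e))%R))//; last 2 first.
  - by apply: emeasurable_funM => //; exact: mline.
  - by move=> s; exact: mule_ge0.
  rewrite -ge0_integralZl//; last 3 first.
  - apply: emeasurable_funM.
      apply/measurable_EFinP; apply: (measurableT_comp measurable_rho).
      by apply: measurable_funD => //; apply: measurable_funM.
    apply: (measurableT_comp mH); apply/measurable_fun_rVP => i.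
    under eq_fun do rewrite mxE; apply: measurable_funM => //.
    by apply: measurable_funD => //; apply: measurable_funM.
  - by move=> s _; exact: mule_ge0.
  - by rewrite lee_fin ltW.
  apply: eq_integral => s _; rewrite add0r muleA -EFinM rhoM//.
  by rewrite scalerA mulrAC divff ?mul1r// gt_eqF.
have mF : measurable_fun setT (fun p : Rn * R =>
    (shell p.1)%:E * ((rho p.2)%:E * H (p.2 *: p.1)%R)).
  apply: emeasurable_funM; first exact: (measurableT_comp mshell measurable_fst).
  apply: emeasurable_funM; first exact: (measurableT_comp mrho measurable_snd).
  by apply: (measurableT_comp mH); apply: measurable_rVZ.
have := @fubini_tonelli _ _ Rn (measurableTypeR R) R lam mu _ mF.
move=> -> /=; last by move=> p; rewrite !mule_ge0.
(* The integrand after the substitution x = s e at fixed s: membership of e in the shell reads s <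
   |x| <= 2 s. Once the integrals are exchanged, the s-integral is ln 2 for every nonzero x. *)
pose K s x := (rho s * (if (s < enorm x <= 2 * s)%R then 1 else 0))%:E *
  ((enorm x ^- n)%:E * H x).
have mwH : measurable_fun setT (fun x => (enorm x ^- n)%:E * H x).
  by apply: emeasurable_funM => //; apply/measurable_EFinP; exact: measurable_enormVn.
have mK s : measurable_fun setT (K s).
  apply: emeasurable_funM => //; apply/measurable_EFinP; apply: measurable_funM => //.
  apply: measurable_fun_ifT => //.
  by apply: measurable_and; [apply: measurable_fun_ltr|apply: measurable_fun_ler] => //;
    exact: measurable_enorm.
have K0 s x : 0 <= K s x.
  rewrite !mule_ge0//; rewrite lee_fin ?invr_ge0 ?exprn_ge0 ?enorm_ge0//.
  by rewrite mulr_ge0 ?rho_ge0//; case: ifP.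
transitivity (\int[mu]_s \int[lam]_x K s x).
  apply: eq_integral => s _; rewrite /K /rho; case: ifPn => [s0|_]; last first.
    rewrite integral0_eq ?[RHS]integral0_eq// => x _; rewrite ?mul0r ?mul0e ?mule0//.
  rewrite (@ge0_integral_affine _ _ 0%R s _ s0)//; last 2 first.
  - by have := mK s; rewrite /K /rho s0.
  - by move=> x; have := K0 s x; rewrite /K /rho s0.
  rewrite -ge0_integralZl//; last 3 first.
  - have := measurableT_comp (mK s) (@measurable_affine R n 0%R s).
    by rewrite /K /rho s0.
  - by move=> x _; have := K0 s (0 + s *: x)%R; rewrite /K /rho s0.
  - by rewrite lee_fin exprn_ge0// ltW.
  apply: eq_integral => e _; rewrite add0r enormZ (ger0_norm (ltW s0)) !muleA.
  congr (_ * _); rewrite -!EFinM; congr EFin.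
  rewrite /shell (mulrC 2%R) ltr_pMr// ler_pM2l//.
  case: ifPn => [/andP[e1 _]|_]; last by rewrite mulr0 mulr0 !mul0r.
  have e0 := lt_trans ltr01 e1.
  rewrite mulr1 exprMn; field.
  by rewrite !expf_neq0 ?gt_eqF.
have mK2 : measurable_fun setT (fun p : R * Rn => K p.1 p.2).
  apply: emeasurable_funM.
    apply/measurable_EFinP; apply: measurable_funM.
      exact: (measurableT_comp measurable_rho measurable_fst).
    have me : measurable_fun setT (fun p : R * Rn => enorm p.2).
      exact: (measurableT_comp (@measurable_enorm R n) measurable_snd).
    apply: measurable_fun_ifT => //; apply: measurable_and.
      by apply: measurable_fun_ltr.
    by apply: measurable_fun_ler => //; apply: measurable_funM.
  exact: (measurableT_comp mwH measurable_snd).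
have := @fubini_tonelli _ _ (measurableTypeR R) Rn R mu lam _ mK2.
move=> -> /=; last by move=> p; exact: K0.
rewrite -ge0_integralZl//; last 2 first.
- by move=> x _; rewrite mule_ge0// lee_fin invr_ge0 exprn_ge0// enorm_ge0.
- by rewrite lee_fin ln_ge0// ler1n.
apply: eq_integral => x _; rewrite /K.
have [x0|x0] := eqVneq (enorm x) 0%R.
  rewrite x0 expr0n gtn_eqF// invr0 mul0e mule0.
  by apply: integral0_eq => s _; rewrite mule0.
rewrite ge0_integralZr//; last 3 first.
- apply/measurable_EFinP; apply: measurable_funM; first exact: measurable_rho.
  apply: measurable_fun_ifT => //; apply: measurable_and.
    exact: measurable_fun_ltr.
  by apply: measurable_fun_ler => //; apply: measurable_funM.
- by move=> s _; rewrite lee_fin mulr_ge0 ?rho_ge0//; case: ifP.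
- by rewrite mule_ge0// lee_fin invr_ge0 exprn_ge0// enorm_ge0.
by rewrite integral_rho_shell// lt_neqAle eq_sym x0 enorm_ge0.
Qed.

End polar.

(** * Oscillatory integrals along a ray *)

Section oscillatory_1d.
Context {R : realType}.
Local Notation mu := (@lebesgue_measure R).

(* Integration by parts: [sin Phi / (r p)] is a primitive of [cos Phi / r] up
   to an error bounded pointwise by [1/(a^2 P) + del/a]. *)
Lemma oscillatory_integral_le (Phi p q : R -> R) (a b P del : R) : 0 < a -> a < b -> 0 < P ->
  (forall r : R, a <= r <= b -> is_derive r 1 Phi (p r)) ->
  (forall r : R, a <= r <= b -> is_derive r 1 p (q r)) ->
  (forall r : R, a <= r <= b -> {for r, continuous q}) ->
  (forall r : R, a <= r <= b -> P <= `|p r|) ->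
  (forall r : R, a <= r <= b -> `|q r| <= del * p r ^+ 2) ->
  `|\int[mu]_(r in `[a, b]) (r^-1 * cos (Phi r))| <=
    2 / (a * P) + (b - a) * (1 / (a ^+ 2 * P) + del / a).
Proof.
move=> a0 ab P0 dPhi dp cq pP qdel.
pose F := (sin \o Phi) * (fun r => (r * p r)^-1).
pose err r := sin (Phi r) * (1 / (r ^+ 2 * p r) + q r / (r * p r ^+ 2)).
pose f r := r^-1 * cos (Phi r).
pose f1 r := f r - err r.
have r0 r : a <= r <= b -> 0 < r by move=> /andP[ar _]; exact: lt_le_trans ar.
have p0 r : a <= r <= b -> p r != 0.
  by move=> rab; rewrite -normr_gt0; apply: lt_le_trans (pP r rab).
have dF (r : R) : a <= r <= b -> is_derive r 1 F (f1 r).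
  move=> rab; have d1 := dPhi r rab; have d2 := dp r rab.
  have d3 : is_derive r 1 ((fun r => r * p r) : R -> R) (p r + r * q r).
    apply: (@is_derive_eq _ _ _ ((@id R) * p)); rewrite /GRing.scale /= mulr1.
    by rewrite addrC.
  have rp0 : r * p r != 0 by rewrite mulf_neq0 ?p0// gt_eqF// r0.
  have d4 : is_derive r 1 (fun r => (r * p r)^-1) (- (r * p r) ^- 2 * (p r + r * q r)).
    exact: (is_deriveV (f := fun r => r * p r) rp0 d3).
  have d5 : is_derive r 1 (sin \o Phi) (cos (Phi r) * p r) by exact: is_derive1_comp.
  apply: is_derive_eq; rewrite /GRing.scale /= /f1 /f /err.
  by field; rewrite p0// gt_eqF// r0.
have cPhi r : a <= r <= b -> {for r, continuous Phi}.
  move=> rab; have d := dPhi r rab.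
  exact/differentiable_continuous/derivable1_diffP/ex_derive.
have cp r : a <= r <= b -> {for r, continuous p}.
  move=> rab; have d := dp r rab.
  exact/differentiable_continuous/derivable1_diffP/ex_derive.
have cid (r : R) : {for r, continuous (@id R)} by exact: cvg_id.
have csin r : a <= r <= b -> {for r, continuous (sin \o Phi)}.
  by move=> rab; apply: continuous_comp; [exact: cPhi|exact: continuous_sin].
have ccos r : a <= r <= b -> {for r, continuous (cos \o Phi)}.
  by move=> rab; apply: continuous_comp; [exact: cPhi|exact: continuous_cos].
have cf r : a <= r <= b -> {for r, continuous f}.
  move=> rab; apply: cvgM; last exact: ccos.
  by apply: cvgV; [rewrite gt_eqF// r0|exact: cid].
have cerr r : a <= r <= b -> {for r, continuous err}.
  move=> rab; have rr := r0 r rab; have pp := p0 r rab.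
  apply: cvgM; first exact: csin.
  apply: cvgD; apply: cvgM; [exact: cvg_cst| |exact: cq|].
    apply: cvgV; first by rewrite mulf_neq0 ?expf_neq0// gt_eqF.
    apply: cvgM; last exact: cp.
    by rewrite expr2; under eq_fun do rewrite expr2; apply: cvgM; exact: cid.
  apply: cvgV; first by rewrite mulf_neq0 ?expf_neq0// gt_eqF.
  apply: cvgM; first exact: cid.
  by rewrite expr2; under eq_fun do rewrite expr2; apply: cvgM; exact: cp.
have inab r : (r \in `[a, b]) = (a <= r <= b) by rewrite in_itv.
have W (g : R -> R) : (forall r, a <= r <= b -> {for r, continuous g}) ->
    {within `[a, b], continuous g}.
  by move=> cg; apply: continuous_in_subspaceT => r; rewrite inE /= inab => /cg.
have I (g : R -> R) : (forall r, a <= r <= b -> {for r, continuous g}) ->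
    mu.-integrable `[a, b] (EFin \o g).
  move=> cg; apply: continuous_compact_integrable; first exact: segment_compact.
  exact: W.
have cf1 r : a <= r <= b -> {for r, continuous f1}.
  by move=> rab; apply: cvgB; [exact: cf|exact: cerr].
have cF r : a <= r <= b -> {for r, continuous F}.
  move=> rab; have d := dF r rab.
  exact/differentiable_continuous/derivable1_diffP/ex_derive.
have aab : a <= a <= b by rewrite lexx ltW.
have bab : a <= b <= b by rewrite lexx ltW.
have FTC : \int[mu]_(r in `[a, b]) f1 r = F b - F a.
  rewrite /Rintegral (@continuous_FTC2 _ _ F)//; first exact: W.
  - split; first by move=> x /subset_itv_oo_cc; rewrite inab => /dF d; exact: ex_derive.
      by apply: cvg_at_right_filter; exact: cF.
    by apply: cvg_at_left_filter; exact: cF.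
  - move=> x /subset_itv_oo_cc; rewrite inab => /dF d.
    by rewrite derive1E; exact: derive_val.
have -> : \int[mu]_(r in `[a, b]) (r^-1 * cos (Phi r)) =
    \int[mu]_(r in `[a, b]) f1 r + \int[mu]_(r in `[a, b]) err r.
  rewrite -RintegralD//; [|exact: I|exact: I].
  by apply: eq_Rintegral => r _; rewrite /f1 subrK.
rewrite FTC; apply: (le_trans (ler_normD _ _)); apply: lerD.
  have FB r : a <= r <= b -> `|F r| <= 1 / (a * P).
    move=> rab; rewrite /F fctE /= normrM -[leRHS]mul1r.
    rewrite div1r ler_pM//; first by rewrite ler_norml sin_le1 sin_geN1.
    rewrite normfV normrM lef_pV2 ?posrE ?mulr_gt0 ?normr_gt0 ?p0//; last first.
      by rewrite gt_eqF// r0.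
    rewrite (ger0_norm (ltW (r0 r rab))).
    by apply: ler_pM; [exact: ltW|exact: ltW|case/andP: rab|exact: pP].
  apply: (le_trans (ler_normB _ _)).
  by have := lerD (FB b bab) (FB a aab); rewrite -mulrDl.
set K := 1 / (a ^+ 2 * P) + del / a.
have errK r : a <= r <= b -> `|err r| <= K.
  move=> rab; rewrite /err normrM -[leRHS]mul1r; apply: ler_pM => //.
    by rewrite ler_norml sin_le1 sin_geN1.
  have rr := r0 r rab; have pp := p0 r rab; have [ar _] := andP rab.
  apply: (le_trans (ler_normD _ _)); apply: lerD.
    rewrite normrM normr1 normfV normrM (ger0_norm (sqr_ge0 r)) ler_wpM2l//.
    rewrite lef_pV2 ?posrE; [|by rewrite mulr_gt0 ?exprn_gt0 ?normr_gt0..].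
    apply: ler_pM; [exact: sqr_ge0|exact: ltW| |exact: pP].
    by apply: lerXn2r => //; rewrite nnegrE; exact: ltW.
  have p2 : 0 < p r ^+ 2 by rewrite exprn_even_gt0.
  have del0 : 0 <= del.
    rewrite -(pmulr_lge0 _ p2); apply: le_trans (qdel r rab); exact: normr_ge0.
  rewrite normrM normfV normrM (gtr0_norm rr) (gtr0_norm p2).
  rewrite (ler_pdivrMr _ _ (mulr_gt0 rr p2)).
  apply: (le_trans (qdel r rab)).
  rewrite (mulrA (del / a) r); apply: ler_wpM2r; first exact: ltW.
  by rewrite -mulrA ler_peMr// mulrC ler_pdivlMr// mul1r.
apply: (@le_trans _ _ (\int[mu]_(r in `[a, b]) K)).
  apply: (le_trans (le_normr_Rintegral _ (I _ cerr))) => //.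
  apply: le_Rintegral => //.
  - exact: (integrable_norm (I _ cerr)).
  - by apply: I => r _; exact: cvg_cst.
rewrite Rintegral_cst//= lebesgue_measure_itv /= lte_fin ab.
by rewrite mulrC.
Qed.

End oscillatory_1d.

(** Each sublevel set of phi at a rational q is Borel up to a subset of a Borel null set. The union
    [B] of these countably many null sets is null, and phi becomes Borel once it is set to 0 on
    [B]. *)
Lemma lebesgue_measurable_borel (R : realType) (n : nat) (phi : 'rV[R]_n -> R) :
  lebesgue_measurable phi ->
  exists (phit : 'rV[R]_n -> R) (B : set 'rV[R]_n),
    [/\ measurable_fun setT phit, measurable B, lebesgue_rV n B = 0%E &
      forall x, ~ B x -> phit x = phi x].
Proof.
move=> mphi.
have H (q : rat) : exists AB : set 'rV[R]_n * set 'rV[R]_n,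
    [/\ measurable AB.1, measurable AB.2, lebesgue_rV n AB.2 = 0%E &
      forall x, ~ AB.2 x -> (AB.1 x <-> phi x < ratr q)].
  have [A mA [N [B [mB B0 NB]] AN]] := mphi `]-oo, ratr q[%classic (measurable_itv _).
  exists (A, B); split=> // x Bx.
  have -> : (phi x < ratr q) = ((A `|` N) x) :> Prop.
    by rewrite AN /= in_itv.
  by split=> [|[//|/NB]]; first by left.
have {H}[AB HAB] := choice H.
have [e He] : exists e : nat -> option rat, forall q, exists k, e k = Some q.
  by exists unpickle => q; exists (pickle q); exact: pickleK.
pose B := \bigcup_k (if e k is Some q then (AB q).2 else set0).
have mB : measurable B.
  apply: bigcupT_measurable => k; case: (e k) => [q|//].
  by case: (HAB q).
have BN (q : rat) : (AB q).2 `<=` B.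
  by move=> x ABx; have [k ek] := He q; exists k => //; rewrite ek.
have B0 : lebesgue_rV n B = 0%E.
  apply/eqP; rewrite eq_le measure_ge0 andbT.
  apply: (@le_trans _ _ (\sum_(k <oo) lebesgue_rV n
      (if e k is Some q then (AB q).2 else set0))%E).
    apply: measure_sigma_subadditive => //.
    by move=> k; case: (e k) => [q|//]; case: (HAB q).
  rewrite eseries0// => k _ _; case: (e k) => [q|]; last exact: measure0.
  by case: (HAB q).
exists (fun x => if x \in B then 0 else phi x), B; split=> //; last first.
  by move=> x Bx; rewrite memNset.
apply: (measurability _ (RGenInftyO.measurableE R)) => //.
move=> _ [_ [r ->] <-]; rewrite setTI.
(* Off [B], phi(x) < r means phi(x) < q < r for some rational q; on [B] the value is 0, so all of
   [B] is counted exactly when 0 < r. *)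
have -> : (fun x => if x \in B then 0 else phi x) @^-1` `]-oo, r[%classic =
   ((\bigcup_k (if e k is Some q then
       if (ratr q : R) < r then (AB q).1 else set0 else set0)) `\` B) `|`
   (if 0 < r then B else set0).
  apply/seteqP; split=> x /=; rewrite in_itv /=.
    case: ifPn => [|]; first by rewrite inE => Bx r0; right; rewrite r0.
    rewrite notin_setE => Bx /rat_in_itvoo[q]; rewrite in_itv /= => /andP[pq qr].
    left; split=> //; have [k ek] := He q; exists k => //; rewrite ek qr.
    case: (HAB q) => _ _ _ /(_ x) HH; apply/HH => // ABx.
    by apply: Bx; exact: (BN q).
  move=> [[[k _]]|].
    case: (e k) => [q|//]; case: ifPn => // qr ABx Bx.
    rewrite memNset//; apply: lt_trans qr.
    case: (HAB q) => _ _ _ /(_ x) HH; apply/HH => // ABx'.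
    by apply: Bx; exact: (BN q).
  by case: ifPn => // r0 Bx; rewrite mem_set.
apply: measurableU; last by case: ifPn.
apply: measurableD => //; apply: bigcupT_measurable => k.
case: (e k) => [q|//]; case: ifPn => // _.
by case: (HAB q).
Qed.

(** * Pointwise form of the hypotheses on the radial derivatives *)

Section radial_hypotheses.
Context {R : realType} {n : nat} (phi : 'rV[R]_n -> R).

Lemma rad1_growth :
  limf_einf (fun r : R => ereal_inf [set `|rad1 phi r w|%:E | w in unit_sphere])
    (pinfty_nbhs R) = +oo%E ->
  forall M : R, exists r0, forall r w, r0 < r -> unit_sphere w -> M <= `|rad1 phi r w|.
Proof.
move=> H M; move: H; rewrite limf_einfE => H.
have : (M%:E < ereal_sup [set ereal_inf ((fun r : R =>
    ereal_inf [set `|rad1 phi r w|%:E | w in unit_sphere]) @` V) | V in pinfty_nbhs R])%E.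
  by rewrite H ltry.
move=> /ereal_sup_gt[_ [V [r0 [_ Vr0]] <-]] MV.
exists r0 => r w r0r sw; rewrite -lee_fin; apply: (le_trans (ltW MV)).
apply: (@le_trans _ _ (ereal_inf [set `|rad1 phi r w|%:E | w in unit_sphere])).
  by apply: ereal_inf_lbound; exists r => //; exact: Vr0.
by apply: ereal_inf_lbound; exists w.
Qed.

Lemma rad2_le (R0 C : R) : 1 <= R0 ->
  (forall r w, R0 < r -> unit_sphere w -> rad1 phi r w != 0) ->
  (ereal_sup [set ereal_sup
     [set ((r * `|rad2 phi r w|) /
           (`|rad1 phi r w| ^+ 2 * ln r `^ (3 / 4)))%:E
     | w in unit_sphere] | r in `]R0, +oo[] < C%:E)%E ->
  forall r w, R0 < r -> unit_sphere w ->
    r * `|rad2 phi r w| <= C * (rad1 phi r w ^+ 2 * ln r `^ (3 / 4)).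
Proof.
move=> R1 p0 H r w rr sw.
have D0 : 0 < `|rad1 phi r w| ^+ 2 * ln r `^ (3 / 4).
  rewrite mulr_gt0 ?exprn_gt0 ?normr_gt0 ?p0// powR_gt0// ln_gt0//.
  exact: le_lt_trans rr.
rewrite -[X in X * ln r `^ _]real_normK ?num_real// -ler_pdivrMr// -lee_fin.
apply: le_trans (ltW H).
apply: (@le_trans _ _ (ereal_sup [set ((r * `|rad2 phi r w|) /
           (`|rad1 phi r w| ^+ 2 * ln r `^ (3 / 4)))%:E
     | w in unit_sphere])).
  by apply: ereal_sup_ubound; exists w.
by apply: ereal_sup_ubound; exists r => //=; rewrite in_itv /= rr.
Qed.

Lemma rad2_continuous (R0 : R) :
  {within [set p : R * 'rV[R]_n | R0 < p.1 /\ unit_sphere p.2],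
       continuous (fun p => rad2 phi p.1 p.2)} ->
  forall r w, R0 < r -> unit_sphere w -> {for r, continuous (fun t => rad2 phi t w)}.
Proof.
move=> c r w rr sw; pose A := [set p : R * 'rV[R]_n | R0 < p.1 /\ unit_sphere p.2].
have H := (subspace_continuousP A _).1 c (r, w) (conj rr sw).
 apply: (cvg_comp (fun t : R => (t, w)) _ _ H).
move=> U [[V W] /= [nV nW] VW].
have nR : \forall t \near r, R0 < t by exact: lt_nbhsr.
apply: filterS2 nV nR => t Vt Rt; apply: (VW (t, w)) => //.
by split => //=; exact: nbhs_singleton.
Qed.

Lemma derivable1_is_derive (g : R -> R) (r : R) :
  derivable g r 1 -> is_derive r 1 g (derive1 g r).
Proof. by move=> d; apply: DeriveDef => //; rewrite derive1E. Qed.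

End radial_hypotheses.

Section radial_oscillation.
Context {R : realType} {n : nat} (phi : 'rV[R]_n -> R) (R0 C : R).
Hypothesis R1 : 1 <= R0.
Hypothesis phi_rad : forall r w, R0 < r -> unit_sphere w ->
  derivable (radial phi w) r 1 /\ derivable (derive1 (radial phi w)) r 1.
Hypothesis growth : forall M : R, exists r0, forall r w,
  r0 < r -> unit_sphere w -> M <= `|rad1 phi r w|.
Hypothesis curv : forall r w, R0 < r -> unit_sphere w ->
  r * `|rad2 phi r w| <= C * (rad1 phi r w ^+ 2 * ln r `^ (3 / 4)).
Hypothesis cont2 : forall r w, R0 < r -> unit_sphere w ->
  {for r, continuous (fun t => rad2 phi t w)}.
Local Notation mu := (@lebesgue_measure R).

(** Trades the logarithm for a power: the curvature bound becomes |phi''| <= 3 |C| phi'^2 / sqrt r,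
    a gain of sqrt a on the annulus. The proof writes ln r = 2 ln (sqrt r) and uses that ln grows
    sublinearly. *)
Lemma ln_powR_le (r : R) : 1 <= r -> ln r `^ (3 / 4) <= 3 * Num.sqrt r.
Proof.
move=> r1; have r0 : 0 < r by exact: lt_le_trans r1.
have s1 : 1 <= Num.sqrt r by rewrite -sqrtr1 ler_wsqrtr.
have s0 : 0 < Num.sqrt r by exact: lt_le_trans s1.
have ls : ln r <= 2 * Num.sqrt r.
  have -> : ln r = 2 * ln (Num.sqrt r).
    by rewrite -{1}(sqr_sqrtr (ltW r0)) lnXn// mulr_natl.
  rewrite ler_wpM2l//.
  by apply: ltW; exact: ln_sublinear.
have l0 : 0 <= ln r by exact: ln_ge0.
have [l1|l1] := leP (ln r) 1.
  apply: (@le_trans _ _ 1); last by lra.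
  have := @ge0_ler_powR R (3 / 4) ltac:(lra) (ln r) 1.
  by rewrite powR1 !nnegrE; apply.
apply: (@le_trans _ _ (ln r)); last by lra.
by rewrite -[leRHS]powRr1// ler_powR ?ltW//; lra.
Qed.

(** The phase has derivative p = y.w + s phi', in which the second term dominates for large r, and
    the curvature bound for phi becomes one for p. The threshold is uniform in y, w, s and theta, as
    integration over directions will require. *)
Lemma radial_oscillation (B tau K del : R) : 0 <= B -> 0 < tau -> 1 < K -> 0 < del ->
  exists a0 : R, forall a : R, a0 <= a -> [/\ 1 <= a, R0 < a &
   forall (y w : 'rV[R]_n) (s theta : R), enorm y <= B -> unit_sphere w -> tau <= `|s| ->
     (forall r : R, a <= r <= a * K -> {for r, continuous
       (fun r : R => theta + dot y (r *: w) + s * phi (r *: w))}) /\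
     `|\int[mu]_(r in `[a, a * K])
        (r^-1 * cos (theta + dot y (r *: w) + s * phi (r *: w)))| <= del].
Proof.
move=> B0 tau0 K1 del0.
(* With |s| >= tau this gives |s phi'| >= 2 (B + 1); since |y.w| <= B, it follows that |p| >= |s
   phi'| / 2 >= 1, so the lower bound P is taken to be 1. *)
have [r0 Hr0] := growth (2 * (B + 1) / tau).
(* 12 = 3 * 4: the 3 is that of [ln_powR_le], the 4 comes from s^2 phi'^2 <= 4 p^2, and 1 / tau from
   |s| <= s^2 / tau. Together |q| <= (Q / sqrt a) p^2. *)
pose Q := 12 * `|C| / tau.
have Q0 : 0 <= Q by rewrite divr_ge0 ?mulr_ge0// ltW.
(* With v = 1 / sqrt a the integration by parts leaves 2 v^2 + (K - 1) (v^2 + Q v), which is at most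
   (2 + K + K Q) v, hence at most del once sqrt a >= T. *)
pose T := (2 + K + K * Q) / del.
exists (1 + `|r0| + `|R0| + T ^+ 2) => a Ha.
have T2 : 0 <= T ^+ 2 by rewrite sqr_ge0.
have ar0 : r0 < a by have := ler_norm r0; have := normr_ge0 R0; lra.
have aR0 : R0 < a by have := ler_norm R0; have := normr_ge0 r0; lra.
have a1 : 1 <= a by have := normr_ge0 R0; have := normr_ge0 r0; lra.
have aT : T ^+ 2 <= a by have := normr_ge0 R0; have := normr_ge0 r0; lra.
have a0 : 0 < a by exact: lt_le_trans a1.
split=> // y w s theta yB sw ts.
have s0 : 0 < `|s| by exact: lt_le_trans ts.
have aK : a < a * K by rewrite ltr_pMr.
pose Phi (r : R) := theta + dot y (r *: w) + s * phi (r *: w).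
pose p (r : R) := dot y w + s * rad1 phi r w.
pose q (r : R) := s * rad2 phi r w.
have PhiE : Phi = cst theta + (dot y w \*: (@id R)) + (s \*: radial phi w).
  by apply/funext => r; rewrite /Phi dotZr !fctE /= /GRing.scale /= (mulrC r).
have dPhi (r : R) : a <= r <= a * K -> is_derive r 1 Phi (p r).
  move=> /andP[ar _]; have [d1 _] := phi_rad (lt_le_trans aR0 ar) sw.
  have d := derivable1_is_derive d1.
  rewrite PhiE; apply: is_derive_eq.
  by rewrite /p /GRing.scale /= add0r mulr1.
have dp (r : R) : a <= r <= a * K -> is_derive r 1 p (q r).
  move=> /andP[ar _]; have [_ d2] := phi_rad (lt_le_trans aR0 ar) sw.
  have d := derivable1_is_derive d2.
  have -> : p = cst (dot y w) + (s \*: derive1 (radial phi w)) by [].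
  by apply: is_derive_eq; rewrite add0r.
have dyw : `|dot y w| <= B.
  by apply: (le_trans (normr_dot_le y w)); rewrite (sw : enorm w = 1) mulr1.
have grow (r : R) : a <= r <= a * K -> 2 * (B + 1) <= `|s * rad1 phi r w|.
  move=> /andP[ar _]; have := Hr0 r w (lt_le_trans ar0 ar) sw.
  rewrite ler_pdivrMr// normrM => H; apply: (le_trans H).
  by rewrite mulrC ler_wpM2r.
have plow (r : R) : a <= r <= a * K -> `|s * rad1 phi r w| / 2 <= `|p r|.
  move=> /grow g; have := ler_normB (p r) (dot y w).
  by rewrite (_ : p r - dot y w = s * rad1 phi r w); [lra|rewrite /p; ring].
split.
  move=> r /dPhi d.
  exact/differentiable_continuous/derivable1_diffP/ex_derive.
apply: (@le_trans _ _ (2 / (a * 1) + (a * K - a) * (1 / (a ^+ 2 * 1) + (Q / Num.sqrt a) / a))).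
  apply: (@oscillatory_integral_le _ Phi p q) => //.
  - move=> r /andP[ar _]; apply: cvgM; first exact: cvg_cst.
    exact: (cont2 (lt_le_trans aR0 ar) sw).
  - by move=> r rab; have := grow r rab; have := plow r rab; lra.
  - move=> r rab; have [ar _] := andP rab.
    have rr : 0 < r by exact: lt_le_trans ar.
    have r1 : 1 <= r by exact: le_trans ar.
    have pl := plow r rab.
    have cu := curv (lt_le_trans aR0 ar) sw.
    have sr : 0 < Num.sqrt r by rewrite sqrtr_gt0.
    have sa : 0 < Num.sqrt a by rewrite sqrtr_gt0.
    have srr : Num.sqrt a <= Num.sqrt r by rewrite ler_wsqrtr.
    have c1 : Num.sqrt r * `|rad2 phi r w| <= 3 * `|C| * rad1 phi r w ^+ 2.
      rewrite -(ler_pM2l sr) mulrA -expr2 sqr_sqrtr ?(ltW rr)//.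
      apply: (le_trans cu).
      apply: (@le_trans _ _ (`|C| * (rad1 phi r w ^+ 2 * (3 * Num.sqrt r)))).
        apply: (le_trans (ler_wpM2r _ (ler_norm C))).
          by rewrite mulr_ge0 ?sqr_ge0 ?powR_ge0.
        by rewrite ler_wpM2l// ler_wpM2l ?sqr_ge0// ln_powR_le.
      by rewrite le_eqVlt; apply/orP; left; apply/eqP; ring.
    have h1 : Num.sqrt a * `|rad2 phi r w| <= 3 * `|C| * rad1 phi r w ^+ 2.
      by apply: le_trans c1; rewrite ler_wpM2r.
    have h2 : `|s| ^+ 2 * rad1 phi r w ^+ 2 <= 4 * p r ^+ 2.
      have : (`|s * rad1 phi r w| / 2) ^+ 2 <= `|p r| ^+ 2.
        by apply: lerXn2r => //; rewrite nnegrE// divr_ge0.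
      rewrite !real_normK ?num_real// exprMn real_normK ?num_real// exprMn exprVn.
      by rewrite ler_pdivrMr ?exprn_gt0// => H; apply: (le_trans H); lra.
    have h3 : tau * `|s| <= `|s| ^+ 2 by rewrite expr2 ler_wpM2r.
    rewrite normrM (_ : Q / Num.sqrt a * p r ^+ 2 =
      (12 * `|C| * p r ^+ 2) / (tau * Num.sqrt a)); last first.
      by rewrite /Q; field; rewrite !gt_eqF.
    rewrite ler_pdivlMr ?mulr_gt0//.
    apply: (@le_trans _ _ (`|s| ^+ 2 * (3 * `|C| * rad1 phi r w ^+ 2))).
      rewrite mulrACA (mulrC `|s|) (mulrC `|rad2 phi r w|).
      by apply: ler_pM => //; rewrite mulr_ge0// ltW.
    have := ler_wpM2l (_ : 0 <= 3 * `|C|) h2.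
    rewrite (_ : 3 * `|C| * (4 * _) = 12 * `|C| * p r ^+ 2); last by ring.
    by rewrite mulrCA; apply; rewrite mulr_ge0.
have sa1 : 1 <= Num.sqrt a by rewrite -sqrtr1 ler_wsqrtr.
have saT : T <= Num.sqrt a.
  have KQ : 0 <= K * Q by apply: mulr_ge0 => //; lra.
  have T0 : 0 <= T by apply: divr_ge0; lra.
  by rewrite -(ger0_norm T0) -sqrtr_sqr ler_wsqrtr.
have sa0 : 0 < Num.sqrt a by exact: lt_le_trans sa1.
pose v := (Num.sqrt a)^-1.
have v0 : 0 < v by rewrite invr_gt0.
have v1 : v <= 1 by rewrite invf_le1.
have aE : a = (Num.sqrt a) ^+ 2 by rewrite sqr_sqrtr// ltW.
have -> : 2 / (a * 1) + (a * K - a) * (1 / (a ^+ 2 * 1) + Q / Num.sqrt a / a) =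
    2 * v ^+ 2 + (K - 1) * (v ^+ 2 + Q * v).
  rewrite {1 2 3 4 6}aE /v; field.
  by rewrite gt_eqF.
have vT : (2 + K + K * Q) * v <= del.
  move: saT; rewrite /T ler_pdivrMr// => H.
  by rewrite /v ler_pdivrMr// (mulrC del).
apply: le_trans vT.
have v2 : v ^+ 2 <= v by rewrite expr2 ler_piMl// ltW.
have Qv : 0 <= Q * v by rewrite mulr_ge0// ltW.
have K0 : 0 <= K - 1 by lra.
have e1 := ler_wpM2l K0 (lerD v2 (lexx (Q * v))).
by lra.
Qed.

End radial_oscillation.

(** * Integrals over annuli *)

Section annulus.
Context {R : realType} {n : nat}.
Local Notation mu := (@lebesgue_measure R).
Local Notation Rn := 'rV[R]_n.
Local Notation lam := (@lebesgue_rV R n).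

Definition annulus (a b : R) (x : Rn) : R := if a <= enorm x <= b then 1 else 0.

Lemma annulus_ge0 a b x : 0 <= annulus a b x.
Proof. by rewrite /annulus; case: ifP. Qed.

Lemma measurable_annulus a b : measurable_fun setT (annulus a b).
Proof.
apply: measurable_fun_ifT => //.
by apply: measurable_and; apply: measurable_fun_ler => //; exact: measurable_enorm.
Qed.

(** Mathematically ln 2 times the area of the unit sphere, so that [shell_mass / ln 2] is that
    area. *)
Definition shell_mass : R := fine (\int[lam]_e (shell e)%:E)%E.

Lemma integral_box (c d : R) : c <= d ->
  (\int[lam]_x (\prod_(i < n) \1_(`[c, d]%classic) (x ord0 i))%:E = ((d - c) ^+ n)%:E)%E.
Proof.
move=> cd; rewrite (@ge0_integral_prod _ _ (fun _ y => \1_(`[c, d]%classic) y)).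
- rewrite (eq_bigr (fun=> (d - c)%:E)); last first.
    move=> i _; rewrite integral_indic// setIT /= lebesgue_measure_itv /= lte_fin.
    case: ltP => // dc.
    by rewrite (_ : d - c = 0)//; lra.
  by rewrite prodEFin prodr_const card_ord.
- by move=> i; exact: measurable_indic.
- by move=> i x; rewrite indicE.
Qed.

Lemma measurable_box (c d : R) :
  measurable_fun setT (fun x : Rn => (\prod_(i < n) \1_(`[c, d]%classic) (x ord0 i))%:E : \bar R).
Proof.
apply/measurable_EFinP; apply: measurable_prod => i _.
apply: (measurableT_comp _ (measurable_coord i)).
exact: measurable_indic.
Qed.

Lemma indic_prod_ge0 (c d : R) (x : Rn) :
  0 <= \prod_(i < n) \1_(`[c, d]%classic) (x ord0 i) :> R.
Proof. by apply: prodr_ge0 => i _; rewrite indicE. Qed.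

Lemma shell_massE : (0 < n)%N ->
  (\int[lam]_e (shell e)%:E = shell_mass%:E)%E /\ 0 < shell_mass.
Proof.
move=> n0.
have msh : measurable_fun setT (fun e : Rn => (shell e)%:E).
  by apply/measurable_EFinP; exact: measurable_shell.
have fin : (\int[lam]_e (shell e)%:E < +oo)%E.
  apply: (@le_lt_trans _ _ (\int[lam]_x
      (\prod_(i < n) \1_(`[- 2 : R, 2]%classic) (x ord0 i))%:E)%E); last first.
    by rewrite integral_box ?ltry//; lra.
  apply: ge0_le_integral => //.
  - by move=> e _; rewrite lee_fin shell_ge0.
  - exact: measurable_box.
  - move=> e _; rewrite lee_fin /shell; case: ifPn => [/andP[e1 e2]|_]; last first.
      exact: indic_prod_ge0.
    rewrite (eq_bigr (fun=> 1)); last first.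
      move=> i _; rewrite indicE mem_set//= in_itv /= -ler_norml.
      exact: le_trans (coord_le_enorm e i) e2.
    rewrite big1// invf_le1 ?exprn_gt0 ?(lt_trans ltr01)// exprn_ege1//.
    exact: ltW.
have S0 : (0 <= \int[lam]_e (shell e)%:E)%E.
  by apply: integral_ge0 => e _; rewrite lee_fin shell_ge0.
have E : (\int[lam]_e (shell e)%:E = shell_mass%:E)%E.
  by rewrite /shell_mass fineK// ge0_fin_numE.
split=> //; rewrite -lte_fin -E.
pose N : R := n%:R; have N0 : 0 < N by rewrite ltr0n.
(* Positivity is read off a cube inside the shell: if every coordinate lies in [c, d], then 2 <=
   |x|^2 <= 4, and the density there is at least 2^-n. Finiteness was obtained from the cube
   [-2, 2]^n, on which the density is at most 1. *)
pose c := Num.sqrt (2 / N); pose d := Num.sqrt (4 / N).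
have cd : c < d by rewrite ltr_sqrt ?divr_gt0// ltr_pM2r ?invr_gt0//; lra.
have c0 : 0 <= c by exact: sqrtr_ge0.
apply: (@lt_le_trans _ _ (\int[lam]_x ((2 ^- n)%:E *
    (\prod_(i < n) \1_(`[c, d]%classic) (x ord0 i))%:E))%E).
  rewrite ge0_integralZl//; last 2 first.
  - exact: measurable_box.
  - by move=> x _; rewrite lee_fin indic_prod_ge0.
  rewrite integral_box ?ltW// -EFinM lte_fin mulr_gt0 ?invr_gt0 ?exprn_gt0// subr_gt0//.
apply: ge0_le_integral => //.
- by move=> x _; rewrite -EFinM lee_fin mulr_ge0 ?invr_ge0 ?exprn_ge0 ?indic_prod_ge0.
- by apply: measurable_funeM; exact: measurable_box.
- move=> x _; rewrite -EFinM lee_fin.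
  have [H|/forallPn[i ni]] := boolP [forall i : 'I_n, x ord0 i \in `[c, d]]; last first.
    rewrite (bigD1 i)//= indicE memNset ?mul0r ?mulr0 ?shell_ge0//.
    by move=> /= h; move: ni; rewrite h.
  have {}H i : c <= x ord0 i <= d by have := forallP H i; rewrite in_itv.
  have e2 : 2 <= enorm x ^+ 2 <= 4.
    have sc : c ^+ 2 = 2 / N by rewrite sqr_sqrtr// divr_ge0// ltW.
    have sd : d ^+ 2 = 4 / N by rewrite sqr_sqrtr// divr_ge0// ltW.
    have sN (t : R) : \sum_(i < n) (t / N) = t.
      by rewrite sumr_const card_ord -mulr_natr mulfVK// gt_eqF.
    rewrite enorm_sqr /dot; apply/andP.
    split; [rewrite -[leLHS](sN 2)|rewrite -[leRHS](sN 4)];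
      apply: ler_sum => i _; have /andP[h1 h2] := H i.
      by rewrite -sc -expr2; apply: lerXn2r => //; rewrite nnegrE; lra.
    by rewrite -sd -expr2; apply: lerXn2r => //; rewrite nnegrE; lra.
  have e1 : 1 < enorm x <= 2.
    have := enorm_ge0 x; move: e2; set t := enorm x => /andP[h1 h2] h0.
    by apply/andP; split; nra.
  rewrite /shell e1; apply: (@le_trans _ _ (2 ^- n)).
    rewrite ler_piMr ?invr_ge0 ?exprn_ge0//.
    by apply: prodr_ile1 => i _; rewrite indicE; case: (_ \in _); rewrite ?ler01 ?lexx.
  case/andP: e1 => h1 h2.
  rewrite lef_pV2 ?posrE ?exprn_gt0 ?(lt_trans ltr01)//.
    by apply: lerXn2r => //; rewrite nnegrE ?enorm_ge0.
  by rewrite ltr1n.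
Qed.

Hypothesis n0 : (0 < n)%N.

Let kappa : R := shell_mass / ln 2.

Let ln2 : 0 < ln 2 :> R.
Proof. by rewrite ln_gt0// ltr1n. Qed.

Local Open Scope ereal_scope.

(** The bound is asked along almost every direction only, since [phit] and [phi] can be compared on
    almost every ray but not on all. *)
Lemma polar_le (H : Rn -> \bar R) (c : R) : measurable_fun setT H ->
  (forall x, 0 <= H x) -> (0 <= c)%R ->
  {ae lam, forall e, shell e != 0%R ->
     \int[mu]_r ((rho r)%:E * H (r *: ((enorm e)^-1 *: e))%R) <= c%:E} ->
  \int[lam]_x ((enorm x ^- n)%:E * H x) <= (c * (shell_mass / ln 2))%:E.
Proof.
move=> mH H0 c0 Hc.
rewrite -(@lee_pmul2l _ (ln 2)%:E)// ?lte_fin//.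
rewrite polar//.
have [SE S0] := shell_massE n0.
have -> : (ln 2)%:E * (c * (shell_mass / ln 2))%:E = \int[lam]_e ((shell e)%:E * c%:E).
  rewrite ge0_integralZr//.
  - by rewrite SE -!EFinM; congr EFin; field; rewrite gt_eqF.
  - by apply/measurable_EFinP; exact: measurable_shell.
  - by move=> e _; rewrite lee_fin shell_ge0.
have mline : measurable_fun setT (fun e : Rn =>
    \int[mu]_r ((rho r)%:E * H (r *: ((enorm e)^-1 *: e))%R)).
  apply: (@measurable_fun_fubini_tonelli_F _ _ Rn (measurableTypeR R) R mu
    (fun p => (rho p.2)%:E * H (p.2 *: ((enorm p.1)^-1 *: p.1))%R)).
    apply: emeasurable_funM.
      apply/measurable_EFinP; exact: (measurableT_comp (@measurable_rho R) measurable_snd).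
    apply: (measurableT_comp mH); apply: measurable_rVZ => //.
    apply: measurable_rVZ => //; apply: (measurableT_comp (@measurable_invr R)).
    exact: (measurableT_comp (@measurable_enorm R n) measurable_fst).
  by move=> p; rewrite mule_ge0// lee_fin rho_ge0.
apply: ae_ge0_le_integral => //.
- move=> e _; rewrite mule_ge0 ?lee_fin ?shell_ge0//.
  by apply: integral_ge0 => r _; rewrite mule_ge0// lee_fin rho_ge0.
- by apply: emeasurable_funM => //; apply/measurable_EFinP; exact: measurable_shell.
- by move=> e _; rewrite -EFinM lee_fin mulr_ge0 ?shell_ge0.
- by apply: emeasurable_funM => //; apply/measurable_EFinP; exact: measurable_shell.
- apply: filterS Hc => e He _.
  have [->|se] := eqVneq (shell e) 0%R; first by rewrite !mul0e.
  by rewrite lee_wpmul2l ?lee_fin ?shell_ge0// He.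
Qed.

Lemma annulus_ray (a K r : R) (e : Rn) : (0 < a)%R -> (1 < K)%R -> shell e != 0%R -> (0 < r)%R ->
  annulus a (a * K) (r *: ((enorm e)^-1 *: e)) = if (a <= r <= a * K)%R then 1%R else 0%R.
Proof.
move=> a0 K1 se r0; rewrite /annulus !enormZ.
have e0 : (0 < enorm e)%R.
  by move: se; rewrite /shell; case: ifPn => [/andP[/(lt_trans ltr01)]|_ /eqP].
by rewrite (gtr0_norm r0) gtr0_norm ?invr_gt0// mulVf ?gt_eqF// mulr1.
Qed.

Lemma unit_sphere_ray (e : Rn) : shell e != 0%R -> unit_sphere ((enorm e)^-1 *: e)%R.
Proof.
move=> se; have e0 : (0 < enorm e)%R.
  by move: se; rewrite /shell; case: ifPn => [/andP[/(lt_trans ltr01)]|_ /eqP].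
by rewrite /unit_sphere /= enormZ gtr0_norm ?invr_gt0// mulVf ?gt_eqF.
Qed.

Lemma integral_rho_annulus (a K : R) (g : R -> R) (e : Rn) : (0 < a)%R -> (1 < K)%R ->
  shell e != 0%R ->
  \int[mu]_r ((rho r)%:E * (annulus a (a * K) (r *: ((enorm e)^-1 *: e)) * g r)%:E) =
  \int[mu]_(r in `[a, (a * K)%R]) (r^-1 * g r)%:E.
Proof.
move=> a0 K1 se; rewrite [RHS]integral_mkcond; apply: eq_integral => r _.
rewrite patchE mem_setE in_itv /= -EFinM.
rewrite /rho; case: ifPn => [r0|r0]; last first.
  rewrite mul0r ifN//; apply: contra r0 => /andP[ar _]; exact: lt_le_trans ar.
rewrite annulus_ray//; case: ifPn => _; first by rewrite mul1r.
by rewrite mul0r mulr0.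
Qed.

(** On each ray the integral of dr/r over [a, a K] is ln K. The result does not depend on a, which
    is what later leaves a free to be large. *)
Lemma integral_annulus (a K : R) : (0 < a)%R -> (1 < K)%R ->
  \int[lam]_x ((enorm x ^- n)%:E * (annulus a (a * K) x)%:E) =
  (shell_mass / ln 2 * ln K)%:E.
Proof.
move=> a0 K1.
have mH : measurable_fun setT (fun x : Rn => (annulus a (a * K) x)%:E).
  by apply/measurable_EFinP; exact: measurable_annulus.
have := polar n0 mH (fun x => _ : 0 <= (annulus a (a * K) x)%:E).
have [SE S0] := shell_massE n0.
move=> /(_ (fun x => ltac:(by rewrite lee_fin annulus_ge0))) P.
have Q : \int[lam]_e ((shell e)%:E * \int[mu]_r ((rho r)%:E *
    (annulus a (a * K) (r *: ((enorm e)^-1 *: e)))%:E)) = (ln K)%:E * shell_mass%:E.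
  transitivity (\int[lam]_e ((shell e)%:E * (ln K)%:E)).
    apply: eq_integral => e _.
    have [->|se] := eqVneq (shell e) 0%R; first by rewrite !mul0e.
    congr (_ * _); have := @integral_rho_annulus a K (fun=> 1%R) e a0 K1 se.
    under eq_integral do rewrite mulr1; move=> ->.
    under eq_integral do rewrite mulr1; rewrite integral_inv ?ltr_pMr//.
    have K0 : (0 < K)%R by exact: lt_trans K1.
    by congr EFin; rewrite lnM ?posrE//; ring.
  rewrite ge0_integralZr ?SE 1?muleC//.
  - by apply/measurable_EFinP; exact: measurable_shell.
  - by move=> e _; rewrite lee_fin shell_ge0.
  - by rewrite lee_fin ln_ge0// ltW.
move: P; rewrite Q => P.
have lnz : (ln 2)%:E != 0 :> \bar R by rewrite eqe gt_eqF.
have : (ln 2)%:E * \int[lam]_x ((enorm x ^- n)%:E * (annulus a (a * K) x)%:E) =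
  (ln 2)%:E * (shell_mass / ln 2 * ln K)%:E.
  by rewrite P -!EFinM; congr EFin; field; rewrite gt_eqF.
set I := \int[lam]_x _; have I0 : 0 <= I.
  apply: integral_ge0 => x _; rewrite mule_ge0 ?lee_fin ?annulus_ge0//.
  by rewrite invr_ge0 exprn_ge0// enorm_ge0.
(* Cancelling ln 2 among extended reals requires ruling out the value +oo, which would make the left
   side infinite. *)
case: I I0 => [i| |] // _.
  by rewrite -!EFinM => -[] /(mulfI _) H; congr EFin; apply: H; rewrite gt_eqF.
by rewrite gt0_muley ?lte_fin.
Qed.

End annulus.

(** * Smallness of the oscillating integral over an annulus *)

Section annular_weight.
Context {R : realType} {n : nat}.
Local Notation mu := (@lebesgue_measure R).
Local Notation Rn := 'rV[R]_n.
Local Notation lam := (@lebesgue_rV R n).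
Hypothesis n0 : (0 < n)%N.
Local Open Scope complex_scope.

Definition kappa : R := @shell_mass R n / ln 2.

Lemma kappa_gt0 : 0 < kappa.
Proof. by have [_ S0] := @shell_massE R n n0; rewrite divr_gt0// ln_gt0// ltr1n. Qed.

Definition weight (a K : R) (x : Rn) : R := enorm x ^- n * annulus a (a * K) x.

Lemma weight_ge0 a K x : 0 <= weight a K x.
Proof. by rewrite mulr_ge0 ?annulus_ge0// invr_ge0 exprn_ge0// enorm_ge0. Qed.

Lemma measurable_weight a K : measurable_fun setT (weight a K).
Proof. by apply: measurable_funM; [exact: measurable_enormVn|exact: measurable_annulus]. Qed.

Lemma integral_weight a K : 0 < a -> 1 < K ->
  (\int[lam]_x (weight a K x)%:E = (kappa * ln K)%:E)%E.
Proof.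
move=> a0 K1; rewrite -(integral_annulus n0 a0 K1).
by apply: eq_integral => x _; rewrite -EFinM.
Qed.

Lemma integrable_weight a K : 0 < a -> 1 < K ->
  lam.-integrable setT (fun x => (weight a K x)%:E).
Proof.
move=> a0 K1; apply/integrableP; split.
  by apply/measurable_EFinP; exact: measurable_weight.
under eq_integral do rewrite gee0_abs ?lee_fin ?weight_ge0//.
by rewrite integral_weight// ltry.
Qed.

Variables (phi phit : Rn -> R) (N : set Rn).
Hypothesis mphit : measurable_fun setT phit.
Hypothesis mN : measurable N.
Hypothesis N0 : lam N = 0%E.
Hypothesis phitE : forall x, ~ N x -> phit x = phi x.

(** [polar] applied to the indicator of [N] has left side 0, so for almost every e in the shell the
    ray integral vanishes, and with it the indicator at almost every r > 0. *)
Lemma ae_ray_notin : {ae lam, forall e : Rn, shell e != 0 ->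
  {ae mu, forall r : R, 0 < r -> ~ N (r *: ((enorm e)^-1 *: e))}}.
Proof.
pose H (x : Rn) : \bar R := (\1_N x)%:E.
have mH : measurable_fun setT H by apply/measurable_EFinP; exact: measurable_indic.
have H0 x : (0 <= H x)%E by rewrite lee_fin indicE.
pose Z (e : Rn) := (\int[mu]_r ((rho r)%:E * H (r *: ((enorm e)^-1 *: e))))%E.
have mF : measurable_fun setT (fun p : Rn * R => ((rho p.2)%:E * H (p.2 *: ((enorm p.1)^-1 *: p.1)))%E).
  apply: emeasurable_funM.
    apply/measurable_EFinP; exact: (measurableT_comp (@measurable_rho R) measurable_snd).
  apply: (measurableT_comp mH); apply: measurable_rVZ => //.
  apply: measurable_rVZ => //; apply: (measurableT_comp (@measurable_invr R)).
  exact: (measurableT_comp (@measurable_enorm R n) measurable_fst).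
have F0 (p : Rn * R) : (0 <= (rho p.2)%:E * H (p.2 *: ((enorm p.1)^-1 *: p.1)))%E.
  by rewrite mule_ge0// lee_fin rho_ge0.
have mZ : measurable_fun setT Z.
  exact: (@measurable_fun_fubini_tonelli_F _ _ Rn (measurableTypeR R) R mu _ mF F0).
have Z0 e : (0 <= Z e)%E by apply: integral_ge0 => r _; exact: (F0 (e, r)).
have mSZ : measurable_fun setT (fun e => (shell e)%:E * Z e)%E.
  by apply: emeasurable_funM => //; apply/measurable_EFinP; exact: measurable_shell.
have IZ : (\int[lam]_e `|(shell e)%:E * Z e| = 0)%E.
  under eq_integral do rewrite gee0_abs ?mule_ge0 ?lee_fin ?shell_ge0//.
  rewrite -(polar n0 mH H0).
  rewrite (_ : (\int[lam]_x _)%E = 0%E) ?mule0//.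
  rewrite -[RHS](@null_set_integral _ _ _ lam N (fun x => ((enorm x ^- n)%:E * H x)%E) mN)//.
  - rewrite [RHS]integral_mkcond; apply: eq_integral => x _.
    rewrite patchE; case: ifPn => // xN; by rewrite /H indicE (negbTE xN) mule0.
  - by apply: measurable_funTS; apply: emeasurable_funM => //;
      apply/measurable_EFinP; exact: measurable_enormVn.
have /(ae_eq_integral_abs _ measurableT mSZ) := IZ.
apply: filterS => e /(_ I) /= SZ se.
have {SZ} Ze : Z e = 0%E.
  move/eqP : SZ; rewrite mule_eq0 eqe (negbTE se) /=.
  by move/eqP.
have mFe : measurable_fun setT (fun r : R => (rho r)%:E * H (r *: ((enorm e)^-1 *: e)))%E.
  exact: (measurableT_comp mF (measurable_pair1 e)).
have : (\int[mu]_r `|(rho r)%:E * H (r *: ((enorm e)^-1 *: e))| = 0)%E.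
  by rewrite -Ze; apply: eq_integral => r _; rewrite gee0_abs//; exact: (F0 (e, r)).
move=> /(@ae_eq_integral_abs _ (measurableTypeR R) R mu setT measurableT _ mFe).
apply: filterS => r /(_ I) /= + r0 Nr.
rewrite /H indicE mem_set// mule1 /rho r0 => -[] /eqP.
by rewrite invr_eq0 gt_eqF.
Qed.

(** Polar coordinates apply to the nonnegative function 1 + cos; each ray contributes at most ln K +
    del, and subtracting the mass kappa ln K leaves kappa del. The bound is one-sided, the other
    side being obtained from theta + pi. *)
Lemma weight_oscillation_le (a K del : R) (y : Rn) (s theta : R) : 0 < a -> 1 < K -> 0 <= del ->
  (forall w, unit_sphere w ->
    (forall r, a <= r <= a * K -> {for r, continuous
       (fun r : R => theta + dot y (r *: w) + s * phi (r *: w))}) /\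
    `|\int[mu]_(r in `[a, a * K])
        (r^-1 * cos (theta + dot y (r *: w) + s * phi (r *: w)))| <= del) ->
  \int[lam]_x (weight a K x * cos (theta + dot y x + s * phit x)) <= kappa * del.
Proof.
move=> a0 K1 del0 Hw.
have K0 : 0 < K by exact: lt_trans K1.
have aK : a < a * K by rewrite ltr_pMr.
have mcos : measurable_fun setT (fun x : Rn => cos (theta + dot y x + s * phit x)).
  apply: measurableT_comp.
    by apply: continuous_measurable_fun; exact: continuous_cos.
  apply: measurable_funD; last exact: measurable_funM.
  by apply: measurable_funD => //; exact: measurable_dot.
pose g (x : Rn) : R := 1 + cos (theta + dot y x + s * phit x).
have g0 x : 0 <= g x by rewrite /g -lerBlDl sub0r cos_geN1.
have mg : measurable_fun setT g by apply: measurable_funD.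
pose H (x : Rn) : \bar R := (annulus a (a * K) x * g x)%:E.
have mH : measurable_fun setT H.
  by apply/measurable_EFinP; apply: measurable_funM => //; exact: measurable_annulus.
have H0 x : (0 <= H x)%E by rewrite lee_fin mulr_ge0 ?annulus_ge0.
have lnK : 0 < ln K by exact: ln_gt0.
have PL : (\int[lam]_x ((enorm x ^- n)%:E * H x) <= ((ln K + del) * kappa)%:E)%E.
  apply: polar_le => //; first by rewrite addr_ge0// ltW.
  apply: filterS ae_ray_notin => e + se => /(_ se) Ne.
  have sw := unit_sphere_ray se; have [cw iw] := Hw _ sw.
  set w := ((enorm e)^-1 *: e) in Ne sw cw iw *.
  rewrite (integral_rho_annulus (fun r => g (r *: w)) a0 K1 se).
  pose h (r : R) := r^-1 * cos (theta + dot y (r *: w) + s * phi (r *: w)).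
  have cinv (r : R) : a <= r <= a * K -> {for r, continuous (fun r : R => r^-1)}.
    by move=> /andP[ar _]; apply: cvgV; [rewrite gt_eqF// (lt_le_trans a0)|exact: cvg_id].
  have ch (r : R) : a <= r <= a * K -> {for r, continuous h}.
    move=> rab; apply: cvgM; first exact: cinv.
    by apply: continuous_comp; [exact: cw|exact: continuous_cos].
  have I (f : R -> R) : (forall r, a <= r <= a * K -> {for r, continuous f}) ->
      mu.-integrable `[a, a * K] (EFin \o f).
    move=> cf; apply: continuous_compact_integrable; first exact: segment_compact.
    by apply: continuous_in_subspaceT => r; rewrite inE /= in_itv /= => /cf.
  (* Here [phit] is exchanged for [phi]: on this ray they agree for almost every r > 0. *)
  have -> : (\int[mu]_(r in `[a, (a * K)%R]) (r^-1 * g (r *: w))%:E =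
      \int[mu]_(r in `[a, (a * K)%R]) ((r^-1)%:E + (h r)%:E))%E.
    apply: ae_eq_integral => //.
    - apply: measurable_funTS; apply/measurable_EFinP; apply: measurable_funM.
        exact: measurable_invr.
      apply: (measurableT_comp mg); apply/measurable_fun_rVP => i.
      by under eq_fun do rewrite mxE; apply: measurable_funM.
    - by apply: emeasurable_funD; [exact: measurable_int (I _ cinv)|exact: measurable_int (I _ ch)].
    - have [A [mA A0 subA]] := Ne; exists A; split=> // r /= nh.
      apply: subA => Nr; apply: nh; rewrite in_itv /= => /andP[ar _].
      rewrite -EFinD; congr EFin; rewrite /g /h phitE ?mulrDr ?mulr1//.
      by apply: Nr; exact: lt_le_trans ar.
  rewrite integralD//; [|exact: (I _ cinv)|exact: (I _ ch)].
  rewrite integral_inv// lnM ?posrE// addrAC subrr add0r EFinD leeD//.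
  have := le_trans (ler_norm _) iw; rewrite -lee_fin /Rintegral fineK//.
  exact: (integrable_fin_num _ (I _ ch)).
have iw := integrable_weight a0 K1.
have iwg : lam.-integrable setT (fun x => (weight a K x * g x)%:E).
  apply/integrableP; split.
    by apply/measurable_EFinP; apply: measurable_funM => //; exact: measurable_weight.
  apply: (le_lt_trans _ (ltry ((ln K + del) * kappa))); apply: le_trans PL.
  rewrite le_eqVlt; apply/orP; left; apply/eqP; apply: eq_integral => x _.
  rewrite gee0_abs ?lee_fin; first by rewrite /H /weight -EFinM mulrA.
  by rewrite mulr_ge0 ?weight_ge0.
have -> : \int[lam]_x (weight a K x * cos (theta + dot y x + s * phit x)) =
    \int[lam]_x (weight a K x * g x) - \int[lam]_x weight a K x.
  rewrite -RintegralB//; apply: eq_Rintegral => x _.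
  by rewrite /g mulrDr mulr1 [RHS]addrAC subrr add0r.
have -> : \int[lam]_x weight a K x = kappa * ln K by rewrite /Rintegral integral_weight.
rewrite lerBlDl -mulrDr mulrC -lee_fin /Rintegral fineK; last first.
  exact: (integrable_fin_num measurableT iwg).
apply: le_trans PL.
by rewrite le_eqVlt; apply/orP; left; apply/eqP; apply: eq_integral => x _;
  rewrite /H /weight -EFinM mulrA.
Qed.

Variables (R0 C : R).
Hypothesis R1 : 1 <= R0.
Hypothesis phi_rad : forall r w, R0 < r -> unit_sphere w ->
  derivable (radial phi w) r 1 /\ derivable (derive1 (radial phi w)) r 1.
Hypothesis growth : forall M : R, exists r0, forall r w,
  r0 < r -> unit_sphere w -> M <= `|rad1 phi r w|.
Hypothesis curv : forall r w, R0 < r -> unit_sphere w ->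
  r * `|rad2 phi r w| <= C * (rad1 phi r w ^+ 2 * ln r `^ (3 / 4)).
Hypothesis cont2 : forall r w, R0 < r -> unit_sphere w ->
  {for r, continuous (fun t => rad2 phi t w)}.

(** The angles theta and theta + pi bound the integral of the cosine from both sides; theta = 0 is
    the real part and theta = - pi / 2 the imaginary part. Each is allowed del / 2, whence the
    accuracy del / (2 kappa) on rays. *)
Lemma oscillation (B tau K del : R) : 0 <= B -> 0 < tau -> 1 < K -> 0 < del ->
  exists2 a : R, 1 <= a & forall (y : Rn) (s : R), enorm y <= B -> tau <= `|s| ->
    cmod (cint lam (fun x => (weight a K x)%:C * cexpi (dot y x + s * phit x))) <= del.
Proof.
move=> B0 tau0 K1 del0.
have k0 := kappa_gt0.
have d0 : 0 < del / (2 * kappa) by rewrite divr_gt0// mulr_gt0.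
have [a0 Ha0] := @radial_oscillation R n phi R0 C phi_rad growth curv cont2 B tau K _ B0 tau0 K1 d0.
have [a1 aR Ha] := Ha0 a0 (lexx _).
exists a0 => // y s yB ts.
have a00 : 0 < a0 by exact: lt_le_trans a1.
have HC theta : `|\int[lam]_x (weight a0 K x * cos (theta + dot y x + s * phit x))| <= del / 2.
  have HL th : \int[lam]_x (weight a0 K x * cos (th + dot y x + s * phit x)) <= del / 2.
    rewrite (_ : del / 2 = kappa * (del / (2 * kappa))); last first.
      by field; rewrite gt_eqF.
    apply: weight_oscillation_le => //; first exact: ltW.
    by move=> w sw; exact: Ha.
  rewrite ler_norml HL andbT.
  have := HL (theta + pi).
  rewrite (_ : \int[lam]_x _ =
      \int[lam]_x (-1 * (weight a0 K x * cos (theta + dot y x + s * phit x)))); last first.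
    apply: eq_Rintegral => x _.
    rewrite (_ : theta + pi + _ + _ = theta + dot y x + s * phit x + pi); last by ring.
    by rewrite cosDpi mulrN mulN1r.
  rewrite RintegralZl//.
    by rewrite mulN1r lerNl.
  apply: (le_integrable measurableT _ _ (integrable_weight a00 K1)) => //.
    apply/measurable_EFinP; apply: measurable_funM; first exact: measurable_weight.
    apply: measurableT_comp.
      by apply: continuous_measurable_fun; exact: continuous_cos.
    apply: measurable_funD; last exact: measurable_funM.
    by apply: measurable_funD => //; exact: measurable_dot.
  move=> x _; rewrite /= lee_fin normrM -[leRHS]mulr1 ler_wpM2l//.
  by rewrite ler_norml cos_le1 cos_geN1.
apply: (le_trans (cmod_le _)).
rewrite (_ : complex.Re _ = \int[lam]_x (weight a0 K x * cos (0 + dot y x + s * phit x))); last first.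
  by apply: eq_Rintegral => x _; rewrite cRe_realM add0r.
rewrite (_ : complex.Im _ = \int[lam]_x (weight a0 K x * cos (- (pi / 2) + dot y x + s * phit x))); last first.
  apply: eq_Rintegral => x _; rewrite cIm_realM /=; congr (_ * _).
  by rewrite -addrA addrC cosBpihalf.
by have := lerD (HC 0) (HC (- (pi / 2))); rewrite -splitr.
Qed.

End annular_weight.

(** * A sequence of points approaching every boundary point *)

Section point_sequence.
Context {R : realType} {n : nat}.
Local Notation Rn := 'rV[R]_n.

Lemma finite_net (b d : R) : 0 < d -> exists s : seq Rn, (0 < size s)%N /\
  forall x : Rn, enorm x <= b -> exists2 i, (i < size s)%N & enorm (s`_i - x) < d.
Proof.
(* The covering balls are sup-norm balls, and |x| is at most n times the sup norm. *)
move=> d0; pose D := d / n.+1%:R; have D0 : 0 < D by rewrite divr_gt0.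
have cA : compact [set v : Rn | forall i, `[- b, b]%classic (v ord0 i)].
  exact: (@rV_compact R n (fun=> `[- b, b]%classic) (fun=> @segment_compact R _ _)).
move: cA; rewrite compact_cover => /(_ Rn setT (fun y => ball y D)).
case=> [y _|x _|s _ sA]; first exact: ball_open.
  by exists x => //; exact: ballxx.
(* The extra point 0 makes every level nonempty, as the enumeration requires; it shifts the indices
   by one. *)
exists (0 :: finmap.enum_fset s); split=> // x xb.
have Ax : [set v : Rn | forall i, `[- b, b]%classic (v ord0 i)] x.
  by move=> i; rewrite /= in_itv /= -ler_norml; exact: le_trans (coord_le_enorm x i) xb.
have [y /= ys yx] := sA _ Ax.
exists (index y (finmap.enum_fset s)).+1; first by rewrite /= ltnS index_mem.
rewrite /= nth_index//; apply: (le_lt_trans (enorm_le_mx_norm _)).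
move: yx; rewrite -ball_normE /= => yx.
apply: (@le_lt_trans _ _ (n.+1%:R * `|y - x|)).
  by rewrite ler_wpM2r// ler_nat.
by rewrite mulrC -ltr_pdivlMr.
Qed.

Section enumeration.
Variable N : nat -> nat.
Hypothesis N0 : forall k, (0 < N k)%N.

Let next (p : nat * nat) := if (p.2.+1 < N p.1)%N then (p.1, p.2.+1) else (p.1.+1, 0%N).

(* Level [k] runs through [N k] points, at times decreasing from [1/(k+1)] to
   [1/(k+2)] (excluded). *)
Definition level_pos (j : nat) : nat * nat := iter j next (0%N, 0%N).

Lemma level_pos_lt j : ((level_pos j).2 < N (level_pos j).1)%N.
Proof.
elim: j => [|j IH] /=; first exact: N0.
by rewrite /next; case: ifPn => // _; exact: N0.
Qed.

Lemma level_le j : ((level_pos j).1 <= j)%N.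
Proof.
elim: j => [//|j IH] /=; rewrite /next; case: ifPn => _ //=.
exact: leq_trans IH (leqnSn _).
Qed.

(** Reaching the start of a level gives all of that level, and its last position leads to the start
    of the next. *)
Lemma level_pos_surj k i : (i < N k)%N -> exists j, level_pos j = (k, i).
Proof.
have step m : (exists j, level_pos j = (m, 0%N)) ->
    forall i, (i < N m)%N -> exists j, level_pos j = (m, i).
  move=> H0; elim=> [//|i' IH] iN; have [j jE] := IH (ltnW iN).
  by exists j.+1; rewrite /= -/(level_pos j) jE /next /= iN.
suff H0 m : exists j, level_pos j = (m, 0%N) by exact: step.
elim: m => [|m IH]; first by exists 0%N.
have [|j jE] := step m IH (N m).-1; first by rewrite prednK.
by exists j.+1; rewrite /= -/(level_pos j) jE /next /= prednK// ltnn.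
Qed.

Definition level_time (j : nat) : R :=
  let: (k, i) := level_pos j in
  k.+1%:R^-1 - i%:R / (N k)%:R * (k.+1%:R^-1 - k.+2%:R^-1).

Lemma level_time_bounds j :
  (level_pos j).1.+2%:R^-1 < level_time j <= (level_pos j).1.+1%:R^-1.
Proof.
rewrite /level_time; have := level_pos_lt j; case: (level_pos j) => k i /= iN.
have Np : 0 < (N k)%:R :> R by rewrite ltr0n N0.
have q0 : 0 <= i%:R / (N k)%:R :> R by rewrite divr_ge0.
have q1 : i%:R / (N k)%:R < 1 :> R by rewrite ltr_pdivrMr// mul1r ltr_nat.
have g0 : k.+2%:R^-1 < k.+1%:R^-1 :> R by rewrite ltf_pV2 ?posrE// ltr_nat.
set q := i%:R / _ in q0 q1 *; set g := _ - k.+2%:R^-1.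
have gp : 0 < g by rewrite subr_gt0.
have qg : q * g < g by rewrite gtr_pMl.
have qg0 : 0 <= q * g by rewrite mulr_ge0// ltW.
rewrite lerBlDr lerDl qg0 andbT.
by rewrite ltrBrDr -ltrBrDl.
Qed.

Lemma level_time_decr j : level_time j.+1 < level_time j.
Proof.
have := level_time_bounds j; rewrite /level_time /= -/(level_pos j).
have := level_pos_lt j; case: (level_pos j) => k i /= iN.
have Np : 0 < (N k)%:R :> R by rewrite ltr0n N0.
have g0 : k.+2%:R^-1 < k.+1%:R^-1 :> R by rewrite ltf_pV2 ?posrE// ltr_nat.
move=> /andP[h _]; rewrite /next /=; case: ifPn => _.
  rewrite ltrD2l ltrN2 ltr_pM2r ?subr_gt0// ltr_pM2r ?invr_gt0//.
  by rewrite ltr_nat.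
by rewrite mul0r mul0r subr0.
Qed.

End enumeration.

Lemma dense_sequence (gamma : R -> R) :
  {in `[0, +oo[ &, {homo gamma : s t / s < t}} -> gamma 0 = 0 ->
  exists (x : nat -> Rn) (t : nat -> R), [/\ forall j, 0 < t j,
    forall i j, (i < j)%N -> t j < t i,
    forall e, 0 < e -> exists J, forall j, (J <= j)%N -> t j < e &
    forall z J, exists2 j, (J <= j)%N & enorm (x j - z) < gamma (t j)].
Proof.
move=> gincr g0.
have gpos s : 0 < s -> 0 < gamma s.
  move=> s0; rewrite -g0; apply: gincr => //; rewrite in_itv /= ?lexx//.
  by rewrite ltW.
(* Times on level k exceed 1/(k+2), so a net of mesh gamma(1/(k+2)) is finer than gamma(t) for each
   of them. It covers the ball of radius k. *)
have /choice[net Hnet] (k : nat) := finite_net k%:R (gpos k.+2%:R^-1 (ltac:(by rewrite invr_gt0))).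
pose N k := size (net k).
have N0 k : (0 < N k)%N by case: (Hnet k).
have td := level_time_decr N0.
have mono i j : (i < j)%N -> level_time N j < level_time N i.
  elim: j => [//|j IH]; rewrite ltnS leq_eqVlt => /orP[/eqP->|/IH]; first exact: td.
  by apply: lt_trans.
exists (fun j => (net (level_pos N j).1)`_(level_pos N j).2), (level_time N); split.
- by move=> j; have /andP[h _] := level_time_bounds N0 j; apply: lt_trans h; rewrite invr_gt0.
- exact: mono.
- move=> e e0; pose k := Num.truncn e^-1.
  have ke : k.+1%:R^-1 < e.
    by rewrite invf_plt ?posrE//; exact: truncnS_gt.
  have [J JE] := level_pos_surj N0 (N0 k).
  have tJ : level_time N J < e.
    have /andP[_ h] := level_time_bounds N0 J; apply: le_lt_trans h _.
    by rewrite JE.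
  exists J => j; rewrite leq_eqVlt => /orP[/eqP<-//|/mono h].
  exact: lt_trans tJ.
(* Level k contains z in its ball, and it is reached only at indices j >= k >= J, by [level_le]. *)
- move=> z J; pose k := (J + (Num.truncn (enorm z)).+1)%N.
  have zk : enorm z <= k%:R.
    apply: ltW; apply: lt_le_trans (truncnS_gt _) _.
    by rewrite ler_nat leq_addl.
  have [_ /(_ z zk)[i iN iz]] := Hnet k.
  have [j jE] := level_pos_surj N0 iN.
  exists j.
    by have := level_le N j; rewrite jE /= => /(leq_trans _); apply; exact: leq_addr.
  rewrite jE /=; apply: (lt_trans iz).
  have /andP[h _] := level_time_bounds N0 j; rewrite jE /= in h.
  have p0 : 0 < k.+2%:R^-1 :> R by rewrite invr_gt0.
  apply: gincr => //; rewrite in_itv /= andbT ltW//.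
  exact: lt_trans h.
Qed.

End point_sequence.

(** * Tails of geometrically dominated series, and Lipschitz bounds *)

Section csum_tail.
Context {R : realType}.
Implicit Types z : nat -> R[i].

Lemma cpsumD z N M : cpsum z (N + M) = cpsum z N + cpsum (fun l => z (N + l)%N) M.
Proof. by rewrite /cpsum big_split_ord. Qed.

Lemma csum_shift z (B : R) N : (forall l, cmod (z l) <= B * 2^-1 ^+ l) ->
  csum z = cpsum z N + csum (fun l => z (N + l)%N) /\
  cmod (csum (fun l => z (N + l)%N)) <= 2 * (B * 2^-1 ^+ N).
Proof.
move=> zB.
have zB' l : cmod (z (N + l)%N) <= B * 2^-1 ^+ N * 2^-1 ^+ l.
  by rewrite -mulrA -exprD.
split; last exact: csum_le.
have c1 := csum_cvg zB; have c2 := csum_cvg zB'.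
apply: (@ccvg_unique _ (fun M => cpsum z (N + M))).
  case: c1 => r1 j1; split.
    rewrite -(cvg_shiftn N) in r1.
    by move: r1; under eq_fun do rewrite addnC.
  rewrite -(cvg_shiftn N) in j1.
  by move: j1; under eq_fun do rewrite addnC.
apply: (eq_ccvg (fun M => esym (cpsumD z N M))).
case: c2 => r2 j2; split.
  under eq_fun do rewrite cReD; rewrite cReD.
  by apply: cvgD => //; exact: cvg_cst.
under eq_fun do rewrite cImD; rewrite cImD.
by apply: cvgD => //; exact: cvg_cst.
Qed.

Lemma cos_lipschitz (a b : R) : `|cos a - cos b| <= `|a - b|.
Proof.
wlog ab : a b / b <= a => [H|].
  by have [/H//|/ltW/H] := leP b a; rewrite distrC (distrC b).
have [|c _ ->] := @MVT_segment R cos (fun x => - sin x) b a ab.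
  by apply: continuous_subspaceT; exact: continuous_cos.
by rewrite normrM normrN ler_piMl// ler_norml sin_le1 sin_geN1.
Qed.

Lemma sin_lipschitz (a b : R) : `|sin a - sin b| <= `|a - b|.
Proof. by rewrite -!cosBpihalf; apply: le_trans (cos_lipschitz _ _) _; rewrite opprB addrA subrK. Qed.

Lemma cexpi_lipschitz (a b : R) : cmod (cexpi a - cexpi b) <= 2 * `|a - b|.
Proof.
apply: (le_trans (cmod_le _)) => /=.
by have := lerD (cos_lipschitz a b) (sin_lipschitz a b); rewrite mulr_natl mulr2n.
Qed.

End csum_tail.

(** * Wave packets *)

Section packet.
Context {R : realType} {n : nat}.
Local Notation mu := (@lebesgue_measure R).
Local Notation Rn := 'rV[R]_n.
Local Notation lam := (@lebesgue_rV R n).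
Local Notation kappa := (@kappa R n).
Hypothesis n0 : (0 < n)%N.
Variables (phit : Rn -> R) (a K eps t0 : R) (x0 : Rn).
Hypothesis mphit : measurable_fun setT phit.
Hypothesis a1 : 1 <= a.
Hypothesis K1 : 1 < K.
Hypothesis eps0 : 0 <= eps.
Local Open Scope complex_scope.

Let a0 : 0 < a. Proof. exact: lt_le_trans a1. Qed.
Let iw := integrable_weight n0 a0 K1.

(** The spectrum at time t. The factor exp(-i t0 phit - i x0.xi) makes all frequencies interfere
    constructively at (x0, t0), and passing from time 0 to t multiplies by exp(i t phit). *)
Definition packet (t : R) (xi : Rn) : R[i] :=
  (eps * weight a K xi)%:C * cexpi ((t - t0) * phit xi - dot x0 xi).

Definition wave (p : Rn * R) : R[i] := inv_fourier (packet p.2) p.1.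

Definition wave_cst : R := (2 * pi) ^- n * eps.

Lemma cRealM (r s : R) : (r * s)%:C = r%:C * s%:C.
Proof. by apply: complex_ext; rewrite ?cRe_realM ?cIm_realM /= ?mulr0. Qed.

Lemma pi2n : 0 < ((2 * pi) ^- n : R) <= 1.
Proof.
have p2 : 1 <= 2 * pi :> R.
  by have := pi_ge2 R; have := @ler1n R 2; nra.
rewrite invr_gt0 exprn_gt0//=; last exact: lt_le_trans p2.
by rewrite invf_le1 ?exprn_ege1// exprn_gt0//; exact: lt_le_trans p2.
Qed.

Lemma wave_cst_ge0 : 0 <= wave_cst.
Proof. by rewrite mulr_ge0//; have /andP[/ltW] := pi2n. Qed.

Lemma measurable_wave_phase (y : Rn) (s : R) :
  measurable_fun setT (fun xi : Rn => dot y xi + s * phit xi).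
Proof. by apply: measurable_funD; [exact: measurable_dot|exact: measurable_funM]. Qed.

Lemma cmeas_wave_phase (y : Rn) (s : R) : cmeas (fun xi : Rn => cexpi (dot y xi + s * phit xi)).
Proof. by apply: cmeas_cexpi; exact: measurable_wave_phase. Qed.

Lemma cintg_weight : cintg lam (fun xi : Rn => (weight a K xi)%:C).
Proof. exact: cintg_real iw. Qed.

Lemma cintg_weight_phase (y : Rn) (s : R) :
  cintg lam (fun xi => (weight a K xi)%:C * cexpi (dot y xi + s * phit xi)).
Proof.
apply: cintg_le cintg_weight => [|x]; last by rewrite cmodM cmod_cexpi mulr1.
by apply: cmeasM; [case: cintg_weight|exact: cmeas_wave_phase].
Qed.

Lemma waveE (x : Rn) (t : R) : wave (x, t) = wave_cst%:C *
  cint lam (fun xi => (weight a K xi)%:C * cexpi (dot (x - x0) xi + (t - t0) * phit xi)).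
Proof.
rewrite /wave /inv_fourier /= /wave_cst.
rewrite (_ : cintegral _ = cint lam (fun xi => eps%:C *
    ((weight a K xi)%:C * cexpi (dot (x - x0) xi + (t - t0) * phit xi)))).
  rewrite cintZ; last exact: cintg_weight_phase.
  by rewrite mulrA -cRealM.
apply: eq_cint => xi; rewrite /packet cRealM.
rewrite (_ : dot (x - x0) xi + _ = dot x xi + ((t - t0) * phit xi - dot x0 xi)).
  by rewrite cexpiD -!mulrA mulrCA; congr (_ * _); rewrite mulrCA.
by rewrite dotBl; ring.
Qed.

Lemma cmod_packet t xi : cmod (packet t xi) = eps * weight a K xi.
Proof. by rewrite cmodM cmod_cexpi mulr1 cmodC ger0_norm// mulr_ge0 ?weight_ge0. Qed.

Lemma weight_le1 (xi : Rn) : weight a K xi <= 1.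
Proof.
rewrite /weight /annulus; case: ifPn => [/andP[axi _]|_]; last by rewrite mulr0.
rewrite mulr1; have x1 := le_trans a1 axi.
by rewrite invf_le1 ?exprn_ege1// exprn_gt0//; exact: lt_le_trans x1.
Qed.

Lemma cmeas_packet t : cmeas (packet t).
Proof.
apply: cmeasM.
  by apply: cmeas_real; apply: measurable_funM => //; exact: measurable_weight.
apply: cmeas_cexpi; apply: measurable_funB; last exact: measurable_dot.
exact: measurable_funM.
Qed.

Lemma packet_bounded_cintg t : bounded_cintg (packet t).
Proof.
split.
  apply: (cintg_le _ _ (cintgZ eps%:C cintg_weight)); first exact: cmeas_packet.
  move=> xi; rewrite cmod_packet cmodM !cmodC ger0_norm// ger0_norm//.
  exact: weight_ge0.
by exists eps => xi; rewrite cmod_packet ler_piMr// weight_le1.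
Qed.

Lemma cmod_wave_le p : cmod (wave p) <= wave_cst * (kappa * ln K).
Proof.
case: p => x t; rewrite waveE cmodM cmodC ger0_norm ?wave_cst_ge0// ler_wpM2l ?wave_cst_ge0//.
apply: (le_trans (cmod_cint_le (cintg_weight_phase _ _))).
rewrite (_ : \int[lam]_x0 _ = \int[lam]_x0 weight a K x0).
  by rewrite /Rintegral integral_weight.
apply: eq_Rintegral => xi _.
by rewrite cmodM cmod_cexpi mulr1 cmodC ger0_norm// weight_ge0.
Qed.

Lemma wave_peak : wave (x0, t0) = (wave_cst * (kappa * ln K))%:C.
Proof.
rewrite waveE cRealM; congr (_ * _).
rewrite -[RHS](_ : cint lam (fun xi : Rn => (weight a K xi)%:C) = _).
  apply: eq_cint => xi.
  by rewrite !subrr mul0r addr0 -(scale0r (0 : Rn)) dotZl mul0r cexpi0 mulr1.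
by rewrite cint_real /Rintegral integral_weight.
Qed.

(** On the support |xi| >= 1, and |xi|^(-2n) m^2 <= 2^n |xi|^-n: the squared weight against a
    multiplier of order n/2 is again the weight, of known mass kappa ln K. The choices m = 1 and m =
    [sobolev_weight] give the L^2 and the H^(n/2) energies. *)
Lemma packet_energy (m : Rn -> R) t : measurable_fun setT m ->
  (forall xi, 1 <= enorm xi -> m xi ^+ 2 <= (2 * enorm xi) ^+ n) ->
  (\int[lam]_xi (cmod ((m xi)%:C * packet t xi) ^+ 2)%:E <=
   (2 ^+ n * eps ^+ 2 * (kappa * ln K))%:E)%E.
Proof.
move=> mm Hm.
have c0 : 0 <= 2 ^+ n * eps ^+ 2 by rewrite mulr_ge0 ?sqr_ge0// exprn_ge0.
rewrite EFinM -(integral_weight n0 a0 K1) -ge0_integralZl//; last 2 first.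
- by apply/measurable_EFinP; exact: measurable_weight.
- by move=> x _; rewrite lee_fin weight_ge0.
apply: ge0_le_integral => //.
- by move=> x _; rewrite lee_fin sqr_ge0.
- by apply: measurable_funTS; apply: measurable_sqr_cmod; apply: cmeasM;
    [exact: cmeas_real|exact: cmeas_packet].
- by apply: emeasurable_funM => //; apply/measurable_EFinP; exact: measurable_weight.
move=> xi _; rewrite -EFinM lee_fin cmodM cmod_packet cmodC exprMn real_normK ?num_real//.
rewrite exprMn mulrCA (mulrC (2 ^+ n)) -[leRHS]mulrA.
apply: ler_wpM2l; first exact: sqr_ge0.
rewrite /weight /annulus; case: ifPn => [/andP[axi _]|_]; last by rewrite !(mulr0, expr0n).
have x1 := le_trans a1 axi.
have xn : 0 < enorm xi ^+ n by rewrite exprn_gt0//; exact: lt_le_trans x1.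
rewrite mulr1 expr2 mulrA ler_wpM2r ?invr_ge0 ?(ltW xn)//.
by rewrite ler_pdivrMr// -exprMn; exact: Hm.
Qed.

Let Lip : R := wave_cst * (2 * (a * K) * (kappa * ln K)).
Let gap (s : R) : R := \int[lam]_xi (weight a K xi * cmod (cexpi (s * phit xi) - 1)).

Let measurable_gap s : measurable_fun setT (fun xi : Rn => cmod (cexpi (s * phit xi) - 1)).
Proof.
apply: measurable_cmod; apply: cmeasD; last exact: cmeas_cst.
by apply: cmeas_cexpi; exact: measurable_funM.
Qed.

Let gap_le2 s (xi : Rn) : cmod (cexpi (s * phit xi) - 1) <= 2.
Proof. by apply: (le_trans (cmodD _ _)); rewrite cmodN cmod_cexpi -cexpi0 cmod_cexpi. Qed.

Let integrable_gap s :
  lam.-integrable setT (fun xi => (weight a K xi * cmod (cexpi (s * phit xi) - 1))%:E).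
Proof.
apply: (le_integrable measurableT _ _ (integrableZl measurableT 2 iw)).
  by apply/measurable_EFinP; apply: measurable_funM => //; exact: measurable_weight.
move=> xi _; rewrite -EFinM !abse_EFin lee_fin ger0_norm; last first.
  by rewrite mulr_ge0 ?weight_ge0 ?cmod_ge0.
rewrite (ger0_norm (mulr_ge0 (ler0n _ 2) (weight_ge0 _ _ _))) [leRHS]mulrC.
by rewrite ler_wpM2l ?weight_ge0.
Qed.

(** As [phit] may be unbounded on the annulus, there is no Lipschitz bound in time; dominated
    convergence, with majorant twice the weight, replaces it. *)
Let gap_cvg : gap s @[s --> 0] --> 0.
Proof.
(* Dominated convergence speaks of sequences, so the limit is tested along sequences tending to
   0. *)
apply/(@cvg_nbhsP _ R^o) => s s0.
pose F (m : nat) (xi : Rn) := (weight a K xi * cmod (cexpi (s m * phit xi) - 1))%:C.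
have mF m : cmeas (F m).
  by apply: cmeas_real; apply: measurable_funM => //; exact: measurable_weight.
have [||||] := @cint_dominated_everywhere R n F (fun=> 0) (fun xi => 2 * weight a K xi) mF.
- exact: cmeas_cst.
- move=> xi; split; last exact: cvg_cst.
  change ((fun m => weight a K xi * cmod (cexpi (s m * phit xi) - 1)) @ \oo --> (0 : R)).
  rewrite -[X in _ --> X](mulr0 (weight a K xi)).
  apply: cvgM; first exact: cvg_cst.
  apply: (@squeeze_cvgr _ _ _ _ (fun=> 0) (fun m => 2 * `|s m * phit xi|)).
  + apply: nearW => m; rewrite cmod_ge0 /=.
    by have := cexpi_lipschitz (s m * phit xi) 0; rewrite cexpi0 subr0.
  + exact: cvg_cst.
  + rewrite -[X in _ --> X](mulr0 2); apply: cvgM; first exact: cvg_cst.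
    rewrite -[X in _ --> X](@normr0 _ R); apply: cvg_norm.
    by rewrite -[X in _ --> X](mul0r (phit xi)); apply: cvgM => //; exact: cvg_cst.
- by have := integrableZl measurableT 2 iw; apply: eq_integrable.
- move=> m xi; rewrite /F cmodC ger0_norm; last by rewrite mulr_ge0 ?weight_ge0 ?cmod_ge0.
  by rewrite mulrC ler_wpM2r ?weight_ge0.
rewrite cint0 => + _; apply: cvg_trans; apply: near_eq_cvg; apply: nearW => m.
by rewrite /F cint_real.
Qed.

(** The increment is split at the intermediate point (x, s). The space part is Lipschitz because
    |xi| <= a K on the support, the time part is measured by [gap]. *)
Lemma wave_modulus (x y : Rn) (s t : R) :
  cmod (wave (y, s) - wave (x, t)) <= Lip * enorm (y - x) + wave_cst * gap (s - t).
Proof.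
rewrite !waveE -mulrBr cmodM cmodC ger0_norm ?wave_cst_ge0//.
rewrite /Lip -mulrA -mulrDr ler_wpM2l ?wave_cst_ge0//.
have i1 := cintg_weight_phase (y - x0) (s - t0).
have i2 := cintgZ (-1) (cintg_weight_phase (x - x0) (t - t0)).
rewrite -[X in _ - X]mul1r -mulNr -cintZ; last exact: cintg_weight_phase.
rewrite -cintD//; apply: (le_trans (cmod_cint_le (cintgD i1 i2))).
have iL := integrableZl measurableT (2 * (a * K) * enorm (y - x)) iw.
have iG := integrable_gap (s - t).
rewrite (_ : 2 * (a * K) * (kappa * ln K) * enorm (y - x) =
    \int[lam]_xi (2 * (a * K) * enorm (y - x) * weight a K xi)); last first.
  rewrite RintegralZl//.
  by rewrite mulrAC /Rintegral integral_weight.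
rewrite -RintegralD//; apply: le_Rintegral => //.
- exact: cintg_cmod (cintgD i1 i2).
- by have := integrableD measurableT iL iG; apply: eq_integrable.
move=> xi _; rewrite mulN1r -mulrBr cmodM cmodC ger0_norm ?weight_ge0//.
rewrite [_ * weight a K xi]mulrC -mulrDr.
have [axi|nxi] := boolP (a <= enorm xi <= a * K); last first.
  by rewrite /weight /annulus (negbTE nxi) mulr0 !mul0r.
rewrite ler_wpM2l ?weight_ge0//.
set A := dot (x - x0) xi + (s - t0) * phit xi.
apply: le_trans (_ : _ <= cmod (cexpi (dot (y - x0) xi + (s - t0) * phit xi) - cexpi A) +
    cmod (cexpi A - cexpi (dot (x - x0) xi + (t - t0) * phit xi))) _.
  by apply: le_trans (cmodD _ _); rewrite addrA subrK.
apply: lerD.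
  apply: (le_trans (cexpi_lipschitz _ _)).
  rewrite (_ : _ - A = dot (y - x) xi); last by rewrite /A !dotBl; ring.
  rewrite -(mulrA 2) ler_wpM2l//; apply: (le_trans (normr_dot_le _ _)).
  by rewrite mulrC ler_wpM2r ?enorm_ge0//; case/andP: axi.
rewrite (_ : A = (s - t) * phit xi + (dot (x - x0) xi + (t - t0) * phit xi)); last first.
  by rewrite /A; ring.
set E := cexpi (dot _ _ + _); rewrite cexpiD -/E.
rewrite (_ : _ * E - E = (cexpi ((s - t) * phit xi) - 1) * E); last by ring.
by rewrite cmodM cmod_cexpi mulr1.
Qed.

Lemma wave_continuous (x : Rn) (t d : R) : 0 < d ->
  \forall p \near (x, t), cmod (wave p - wave (x, t)) < d.
Proof.
move=> d0.
have L0 : 0 <= Lip.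
  have K0 : 0 < K by exact: lt_trans K1.
  apply: mulr_ge0; first exact: wave_cst_ge0.
  apply: mulr_ge0; first by rewrite !mulr_ge0// ltW.
  by rewrite mulr_ge0// ?ltW ?ln_gt0// kappa_gt0.
pose F (p : Rn * R) := Lip * (n%:R * `|p.1 - x|) + wave_cst * gap (p.2 - t).
have F0 : F p @[p --> (x, t)] --> 0.
  rewrite -[X in _ --> X](addr0 0); apply: cvgD.
    rewrite -[X in _ --> X](mulr0 Lip); apply: cvgM; first exact: cvg_cst.
    rewrite -[X in _ --> X](mulr0 n%:R); apply: cvgM; first exact: cvg_cst.
    rewrite -[X in _ --> X](@normr0 _ Rn) -(subrr x); apply: cvg_norm.
    by apply: cvgB; [exact: cvg_fst|exact: cvg_cst].
  rewrite -[X in _ --> X](mulr0 wave_cst); apply: cvgM; first exact: cvg_cst.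
  apply: (@cvg_comp _ _ _ (fun p : Rn * R => p.2 - t) gap _ (nbhs (0 : R)) _ _ gap_cvg).
  rewrite -(subrr t); apply: cvgB; [exact: cvg_snd|exact: cvg_cst].
have : \forall p \near (x, t), F p < d by apply: (cvgr_lt 0 F0).
apply: filterS => -[y s]; apply: le_lt_trans.
apply: (le_trans (wave_modulus _ _ _ _)); rewrite lerD2r ler_wpM2l//.
exact: enorm_le_mx_norm.
Qed.

End packet.

(** * The series of waves: continuity for t > 0 and blow-up at t = 0 *)

Section wave_series.
Context {R : realType} {n : nat}.
Local Notation Rn := 'rV[R]_n.
Local Notation lam := (@lebesgue_rV R n).
Local Notation kappa := (@kappa R n).
Hypothesis n0 : (0 < n)%N.
Variables (phit : Rn -> R) (xs : nat -> Rn) (ts a : nat -> R).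
Hypothesis mphit : measurable_fun setT phit.
Hypothesis a1 : forall l, 1 <= a l.
Hypothesis ts0 : forall j, 0 < ts j.
Hypothesis ts_decr : forall i j, (i < j)%N -> ts j < ts i.
Hypothesis ts_cvg : forall e, 0 < e -> exists J, forall j, (J <= j)%N -> ts j < e.
Local Open Scope complex_scope.

(* The energy [amplitude^2 * log_width = 16^-l] is summable, although the peak
   height [amplitude * log_width = 4^l] is not bounded. *)
Definition log_width (l : nat) : R := 256 ^+ l.
Definition amplitude (l : nat) : R := 64^-1 ^+ l.
Definition packet_seq (l : nat) : R -> Rn -> R[i] :=
  packet phit (a l) (expR (log_width l)) (amplitude l) (ts l) (xs l).
Definition wave_seq (l : nat) : Rn * R -> R[i] :=
  wave phit (a l) (expR (log_width l)) (amplitude l) (ts l) (xs l).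
(** The first term makes the radii exhaust R^n; the second ensures that wave l is already controlled
    at all focal points x_j with j <= l. *)
Definition reach (l : nat) : R := l%:R + \sum_(j < l.+1) enorm (xs j).
(** For t >= t_(l-1) the distance to the focal time t_l is at least this. The value at l = 0 is an
    arbitrary positive number. *)
Definition time_gap (l : nat) : R := if l is m.+1 then ts m - ts l else 1.
Definition peak_cst : R := (2 * pi) ^- n * kappa.

Hypothesis osc : forall l (y : Rn) s, enorm y <= reach l + enorm (xs l) ->
  time_gap l <= `|s| ->
  cmod (cint lam (fun x => (weight (a l) (expR (log_width l)) x)%:C *
    cexpi (dot y x + s * phit x))) <= 2^-1 ^+ l.

Lemma amplitude_ge0 l : 0 <= amplitude l.
Proof. by rewrite exprn_ge0// invr_ge0. Qed.

Lemma expR_log_width_gt1 l : 1 < expR (log_width l) :> R.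
Proof. by rewrite expR_gt1 exprn_gt0. Qed.

Lemma peak_cst_gt0 : 0 < peak_cst.
Proof. by rewrite mulr_gt0 ?kappa_gt0//; have /andP[] := @pi2n R n. Qed.

Lemma wave_cst_peak l :
  @wave_cst R n (amplitude l) * (kappa * ln (expR (log_width l))) = peak_cst * 4 ^+ l.
Proof.
have E : amplitude l * log_width l = 4 ^+ l.
  by rewrite /amplitude /log_width -exprMn; congr (_ ^+ _); field.
by rewrite expRK /wave_cst /peak_cst -E mulrACA [_ * kappa]mulrC mulrA -mulrA mulrC mulrA mulrC.
Qed.

Lemma cmod_wave_seq_le l p : cmod (wave_seq l p) <= peak_cst * 4 ^+ l.
Proof.
rewrite -wave_cst_peak; apply: cmod_wave_le => //; first exact: expR_log_width_gt1.
exact: amplitude_ge0.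
Qed.

Lemma wave_seq_peak l : wave_seq l (xs l, ts l) = (peak_cst * 4 ^+ l)%:C.
Proof.
by rewrite -wave_cst_peak /wave_seq wave_peak//; exact: expR_log_width_gt1.
Qed.

Lemma wave_seq_small l (x : Rn) t : (0 < l)%N -> enorm x <= reach l -> ts l.-1 <= t ->
  cmod (wave_seq l (x, t)) <= 2^-1 ^+ l.
Proof.
case: l => // l _ xl tl.
rewrite /wave_seq waveE//; last exact: expR_log_width_gt1.
rewrite cmodM cmodC ger0_norm; last exact/wave_cst_ge0/amplitude_ge0.
rewrite -[leRHS]mul1r ler_pM ?cmod_ge0//; first exact/wave_cst_ge0/amplitude_ge0.
  have /andP[p0 p1] := @pi2n R n.
  rewrite -[leRHS]mulr1 ler_pM ?(ltW p0)// ?amplitude_ge0//.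
  by rewrite exprn_ile1// ?invr_ge0// invf_le1// ler1n.
apply: osc; first by apply: (le_trans (enormB _ _)); rewrite lerD2r.
by rewrite /= ger0_norm ?lerD2r// subr_ge0 (le_trans _ tl)// ltW// ts_decr.
Qed.

Lemma reach_ge l : l%:R <= reach l.
Proof. by rewrite lerDl sumr_ge0// => j _; exact: enorm_ge0. Qed.

Lemma near_dist (x : Rn) (t d : R) : 0 < d ->
  \forall p \near (x, t), enorm (p.1 - x) < d.
Proof.
move=> d0.
have F0 : n%:R * `|p.1 - x| @[p --> (x, t)] --> (0 : R).
  rewrite -[X in _ --> X](mulr0 n%:R); apply: cvgM; first exact: cvg_cst.
  rewrite -[X in _ --> X](@normr0 _ Rn) -(subrr x); apply: cvg_norm.
  by apply: cvgB; [exact: cvg_fst|exact: cvg_cst].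
have : \forall p \near (x, t), n%:R * `|p.1 - x| < d by apply: (cvgr_lt 0 F0).
by apply: filterS => p; apply: le_lt_trans; exact: enorm_le_mx_norm.
Qed.

(** The same geometric majorant holds throughout a neighbourhood, so the series converges locally
    uniformly in t > 0: from some rank on the waves are small there, and the finitely many others
    are absorbed by the constant. *)
Lemma wave_seq_near (x : Rn) (t : R) : 0 < t -> exists B,
  \forall p \near (x, t), forall l, cmod (wave_seq l p) <= B * 2^-1 ^+ l.
Proof.
move=> t0; have t2 : 0 < t / 2 by rewrite divr_gt0.
have [J HJ] := ts_cvg t2.
(* For l >= l0 the unit ball around x lies within [reach l], and l - 1 >= J gives t_(l-1) < t / 2;
   the outer successor pays for the shift to l - 1. *)
pose l0 := (J + (Num.truncn (enorm x + 1)).+1).+1.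
have c0 := peak_cst_gt0.
exists (1 + peak_cst * 8 ^+ l0).
have H1 : \forall p \near (x, t), t / 2 < p.2.
  have S0 : p.2 @[p --> (x, t)] --> t by exact: cvg_snd.
  apply: (cvgr_gt t S0).
  by rewrite ltr_pdivrMr// mulr_natr mulr2n ltrDl.
apply: filterS2 H1 (near_dist x t ltr01) => -[y s] ts2 yx l.
have [l0l|ll0] := leqP l0 l.
  apply: (@le_trans _ _ (2^-1 ^+ l)); last first.
    rewrite ler_peMl ?exprn_ge0// ?invr_ge0// lerDl mulr_ge0 ?(ltW c0)//.
  apply: wave_seq_small.
  - exact: leq_trans l0l.
  - apply: le_trans (reach_ge l).
    apply: (@le_trans _ _ (enorm x + 1)).
      rewrite -[y](subrK x) addrC; apply: (le_trans (enormD _ _)).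
      by rewrite lerD2l ltW.
    apply: ltW; apply: (lt_le_trans (truncnS_gt _)); rewrite ler_nat.
    apply: leq_trans l0l; apply: leq_trans (leqnSn _); exact: leq_addl.
  - apply: ltW; apply: lt_trans ts2; apply: HJ.
    rewrite -ltnS prednK; last exact: leq_trans l0l.
    by apply: leq_trans l0l; rewrite ltnS leq_addr.
apply: (le_trans (cmod_wave_seq_le _ _)).
(* For l < l0 the crude bound 4^l = 8^l 2^-l is at most 8^l0 2^-l. *)
have -> : peak_cst * 4 ^+ l = peak_cst * 8 ^+ l * 2^-1 ^+ l.
  by rewrite -mulrA -exprMn; congr (_ * _ ^+ _); field.
rewrite ler_wpM2r ?exprn_ge0 ?invr_ge0//.
apply: (@le_trans _ _ (peak_cst * 8 ^+ l0)); last by rewrite lerDr.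
by rewrite ler_pM2l// ler_weXn2l// ?ler1n// ltnW.
Qed.

Definition wave_sum (p : Rn * R) : R[i] := csum (fun l => wave_seq l p).

Lemma half_expn_lt (C d : R) : 0 < d -> exists N, C * 2^-1 ^+ N < d.
Proof.
move=> d0; have : C * 2^-1 ^+ N @[N --> \oo] --> (0 : R).
  rewrite -[X in _ --> X](mulr0 C); apply: cvgM; first exact: cvg_cst.
  by apply: cvg_expr; rewrite ger0_norm ?invr_ge0// invf_lt1// ltr1n.
by move=> /(cvgr_lt 0) /(_ _ d0) [N _ HN]; exists N; apply: HN => /=.
Qed.

Lemma cpsum_wave_near (x : Rn) (t d : R) N : 0 < d ->
  \forall p \near (x, t), cmod (cpsum (wave_seq^~ p) N - cpsum (wave_seq^~ (x, t)) N) < d.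
Proof.
elim: N d => [|N IH] d d0.
  by apply: filterS (near_dist x t d0) => p _; rewrite /cpsum !big_ord0 subrr cmod0.
have d2 : 0 < d / 2 by rewrite divr_gt0.
have := wave_continuous n0 (ts N) (xs N) mphit (a1 N) (expR_log_width_gt1 N)
  (amplitude_ge0 N) x t d2.
apply: filterS2 (IH _ d2) => p h1 h2.
rewrite /cpsum !big_ord_recr /= opprD addrACA [ltRHS]splitr.
by apply: (le_lt_trans (cmodD _ _)); rewrite ltrD.
Qed.

(** Partial sums of a fixed length are continuous, and the common majorant bounds both tails
    together by 4 B 2^-N. *)
Lemma wave_sum_near (x : Rn) (t d : R) : 0 < t -> 0 < d ->
  \forall p \near (x, t), cmod (wave_sum p - wave_sum (x, t)) < d.
Proof.
have aux (b q r s : R) : r <= 2 * (b * q) -> s <= 2 * (b * q) -> s + r <= 4 * b * q.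
  by move=> h1 h2; lra.
move=> t0 d0; have [B HB] := wave_seq_near x t0.
have B0 := nbhs_singleton HB.
have d2 : 0 < d / 2 by rewrite divr_gt0.
have [N HN] := half_expn_lt (4 * B) d2.
apply: filterS2 HB (cpsum_wave_near x t N d2) => p HBp Hp.
have [E1 E2] := csum_shift N B0; have [E3 E4] := csum_shift N HBp.
rewrite /wave_sum E1 E3 opprD addrACA [ltRHS]splitr.
apply: (le_lt_trans (cmodD _ _)); rewrite ltrD//.
apply: le_lt_trans HN; apply: (le_trans (cmodD _ _)); rewrite cmodN.
exact: aux E2 E4.
Qed.

Lemma wave_sum_continuous : {within [set p : Rn * R | 0 < p.2],
  continuous (wave_sum : Rn * R -> R[i]^o)}.
Proof.
apply: continuous_in_subspaceT => -[x t]; rewrite inE /= => t0.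
(* In the partial order of [R[i]] a positive e has zero imaginary part, so this is an estimate by a
   positive real. *)
apply/(@cvgrPdist_lt R[i] R[i]^o) => e; rewrite ltcE => /andP[/eqP e1 e0].
apply: filterS (wave_sum_near x t0 e0) => p.
rewrite -cmodN opprB => h.
rewrite ltcE /=; apply/andP; split; first by rewrite e1.
exact: h.
Qed.

Lemma sum_expr4 j : \sum_(l < j) (4 : R) ^+ l <= 4 ^+ j / 3.
Proof.
elim: j => [|j IH]; first by rewrite big_ord0 divr_ge0.
by rewrite big_ord_recr /= exprS; lra.
Qed.

(** Wave j is at its peak. The earlier ones add up to at most a third of it, by the geometric sum of
    4^l. The later ones are small, since t_j >= t_(l-1) and |x_j| <= [reach l] for l > j, and they
    add up to at most 2. What remains is 2/3 of the peak minus 2. *)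
Lemma wave_sum_peak j : peak_cst * 4 ^+ j / 2 - 2 <= cmod (wave_sum (xs j, ts j)).
Proof.
have [B /nbhs_singleton HB] := wave_seq_near (xs j) (ts0 j).
have [E _] := csum_shift j.+1 HB.
have T : cmod (csum (fun l => wave_seq (j.+1 + l) (xs j, ts j))) <= 2 * 1.
  apply: csum_le => l; rewrite mul1r.
  apply: le_trans (_ : 2^-1 ^+ (j.+1 + l) <= _); last first.
    rewrite exprD ler_piMl ?exprn_ge0 ?invr_ge0//.
    by rewrite exprn_ile1// ?invr_ge0// invf_le1// ler1n.
  apply: wave_seq_small; rewrite ?addSn//.
    rewrite /reach; have jl : (j < (j + l).+2)%N by rewrite ltnS ltnW// ltnS leq_addr.
    rewrite (bigD1 (Ordinal jl))//= addrCA lerDl addr_ge0// sumr_ge0// => i _.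
    exact: enorm_ge0.
  have := leq_addr l j; rewrite leq_eqVlt => /orP[/eqP<-//|h] /=.
  by apply: ltW; exact: ts_decr.
have L : cmod (cpsum (wave_seq^~ (xs j, ts j)) j) <= peak_cst * (4 ^+ j / 3).
  apply: (le_trans (cmod_sum _ _ _)).
  apply: (@le_trans _ _ (\sum_(l < j) peak_cst * 4 ^+ l)).
    by apply: ler_sum => l _; exact: cmod_wave_seq_le.
  by rewrite -mulr_sumr ler_pM2l ?peak_cst_gt0//; exact: sum_expr4.
rewrite /wave_sum E /cpsum big_ord_recr /= -/(cpsum _ j) wave_seq_peak.
set S := cpsum _ _ in L *; set V := csum _ in T *; set P := (_)%:C.
have PE : cmod P = peak_cst * 4 ^+ j.
  by rewrite cmodC ger0_norm// mulr_ge0 ?(ltW peak_cst_gt0)// exprn_ge0.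
have : cmod P <= cmod (S + P + V) + (cmod S + cmod V).
  rewrite -(cmodN S) -(cmodN V).
  have PD : P = (S + P + V) + (- S - V) by ring.
  rewrite {1}PD; apply: (le_trans (cmodD _ _)).
  by rewrite lerD2l; exact: cmodD.
rewrite PE => H.
have c4 : 0 <= peak_cst * 4 ^+ j by rewrite mulr_ge0 ?(ltW peak_cst_gt0)// exprn_ge0.
by move: T L H; rewrite mulrA; lra.
Qed.

(** Focal points with |x_j - x| < gamma(t_j) occur for arbitrarily large j. They tend to (x, 0),
    since t_j tends to 0 and gamma is continuous at 0 with gamma(0) = 0, and the peaks there are
    unbounded. *)
Lemma wave_sum_limsup (gamma : R -> R) (x : Rn) :
  {within `[0, +oo[, continuous gamma} -> gamma 0 = 0 ->
  (forall J, exists2 j, (J <= j)%N & enorm (xs j - x) < gamma (ts j)) ->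
  limf_esup (fun p : Rn * R => (cmod (wave_sum p))%:E)
    (within [set p : Rn * R | enorm (p.1 - x) < gamma p.2 /\ 0 < p.2] (nbhs (x, 0 : R)))
    = +oo%E.
Proof.
move=> cg g0 Hx; rewrite limf_esupE; apply/eqP; rewrite eq_le leey andTb.
apply: le_ereal_inf_tmp => _ [V HV <-].
rewrite leye_eq; apply/eqP; apply: eq_infty => A.
have [e e0 He] : exists2 e : R, 0 < e & forall p : Rn * R,
    enorm (p.1 - x) < e -> `|p.2| < e ->
    enorm (p.1 - x) < gamma p.2 -> 0 < p.2 -> V p.
  move: HV => /nbhs_ballP[e /= e0 He]; exists e => // -[y t] /= yx te h1 h2.
  apply: He => //; split => /=; last by rewrite -ball_normE /= sub0r normrN.
  rewrite -ball_normE /= distrC; apply: le_lt_trans yx; exact: mx_norm_le_enorm.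
have [d d0 Hd] : exists2 d, 0 < d & forall t, 0 < t -> t < d -> gamma t < e.
  have := cg; rewrite continuous_within_itvcyP => -[_ gr].
  move: gr; rewrite g0 => /(cvgr_lt 0) /(_ _ e0) [d /= d0 hd]; exists d => // t t0 td.
  by apply: hd => //=; rewrite sub0r normrN gtr0_norm.
have [J1 HJ1] := ts_cvg d0; have [J2 HJ2] := ts_cvg e0.
have c0 := peak_cst_gt0.
(* For j >= J3, 4^j >= j makes the lower bound [peak_cst] 4^j / 2 - 2 at least |A|. *)
pose J3 := (Num.truncn ((`|A| + 2) * 2 / peak_cst)).+1.
have [j] := Hx (J1 + J2 + J3)%N; rewrite -addnA => Jj hj.
have j1 : (J1 <= j)%N by apply: leq_trans Jj; exact: leq_addr.
have j2 : (J2 <= j)%N by apply: leq_trans Jj; rewrite addnCA leq_addr.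
have j3 : (J3 <= j)%N by apply: leq_trans Jj; rewrite addnA leq_addl.
have Vj : V (xs j, ts j).
  apply: He => //=; last by rewrite gtr0_norm// HJ2.
  by apply: lt_trans hj _; apply: Hd => //; exact: HJ1.
apply: (@le_trans _ _ (cmod (wave_sum (xs j, ts j)))%:E); last first.
  by apply: ereal_sup_ubound; exists (xs j, ts j).
rewrite lee_fin; apply: le_trans (wave_sum_peak j).
have : (`|A| + 2) * 2 / peak_cst <= 4 ^+ j.
  apply: (@le_trans _ _ J3%:R); first exact/ltW/truncnS_gt.
  apply: (@le_trans _ _ j%:R); first by rewrite ler_nat.
  by rewrite -natrX ler_nat ltnW// ltn_expl.
rewrite ler_pdivrMr// => h.
by have := ler_norm A; lra.
Qed.

End wave_series.

(** * Identification of the series with S^phi f *)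

Section packet_limits.
Context {R : realType} {n : nat}.
Local Notation Rn := 'rV[R]_n.
Local Notation lam := (@lebesgue_rV R n).
Local Notation kappa := (@kappa R n).
Hypothesis n0 : (0 < n)%N.
Variables (phi phit : Rn -> R) (N : set Rn) (xs : nat -> Rn) (ts a : nat -> R).
Hypothesis mphit : measurable_fun setT phit.
Hypothesis mN : measurable N.
Hypothesis N0 : lam N = 0%E.
Hypothesis phitE : forall x, ~ N x -> phit x = phi x.
Hypothesis a1 : forall l, 1 <= a l.
Local Open Scope complex_scope.
Local Notation pk := (packet_seq phit xs ts a).
Local Notation wv := (wave_seq phit xs ts a).

(** The normalization c = (2 pi)^-n enters squared, the Plancherel bound loses 1 / c, and the
    remaining factor c is at most 1. *)
Lemma inv_fourier_L2 (f : Rn -> R[i]) : bounded_cintg f ->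
  cmeas (inv_fourier f) /\
  (\int[lam]_x (cmod (inv_fourier f x) ^+ 2)%:E <= \int[lam]_x (cmod (f x) ^+ 2)%:E)%E.
Proof.
move=> bf; rewrite inv_fourierE.
have /andP[c0 c1] := @pi2n R n; set c := _ ^- n in c0 c1 *.
have mF : cmeas (FT 1 f) by apply: cmeas_FT; case: bf.
split; first by apply: cmeasM => //; exact: cmeas_cst.
under eq_integral do rewrite cmodM cmodC (gtr0_norm c0) exprMn EFinM.
rewrite ge0_integralZl//; last 3 first.
- exact: measurable_sqr_cmod.
- by move=> x _; rewrite lee_fin sqr_ge0.
- by rewrite lee_fin sqr_ge0.
apply: (@le_trans _ _ ((c ^+ 2)%:E * (((2 * pi) ^+ n)%:E * \int[lam]_x (cmod (f x) ^+ 2)%:E))%E).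
  by rewrite lee_wpmul2l ?lee_fin ?sqr_ge0//; apply: plancherel_le => //; rewrite normr1.
rewrite muleA -EFinM expr2 -mulrA mulVf ?mulr1; last by rewrite -invr_eq0 gt_eqF.
rewrite -[leRHS]mul1e lee_wpmul2r ?lee_fin//.
by apply: integral_ge0 => x _; rewrite lee_fin sqr_ge0.
Qed.

Lemma packet_seq_bounded_cintg l t : bounded_cintg (pk l t).
Proof.
by apply: packet_bounded_cintg => //; [exact: expR_log_width_gt1|exact: amplitude_ge0].
Qed.

Lemma packet_seq_energy (m : Rn -> R) t l : measurable_fun setT m ->
  (forall xi, 1 <= enorm xi -> m xi ^+ 2 <= (2 * enorm xi) ^+ n) ->
  (\int[lam]_xi (cmod ((m xi)%:C * pk l t xi) ^+ 2)%:E <=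
   (2 ^+ n * kappa * 16 ^- l)%:E)%E.
Proof.
move=> mm Hm.
have := packet_energy n0 (ts l) (xs l) mphit (a1 l) (expR_log_width_gt1 l) (amplitude_ge0 l)
  t mm Hm.
rewrite expRK -[X in (_ <= X%:E)%E -> _]mulrA (mulrCA (amplitude l ^+ 2)).
rewrite (_ : amplitude l ^+ 2 * log_width l = 16 ^- l :> R); first by rewrite mulrA.
rewrite /amplitude /log_width -exprM mulnC exprM -exprMn -exprVn; congr (_ ^+ _).
by field.
Qed.

Lemma packet_seq_energy1 t l :
  (\int[lam]_xi (cmod (pk l t xi) ^+ 2)%:E <= (2 ^+ n * kappa * 16 ^- l)%:E)%E.
Proof.
have H1 (xi : Rn) : 1 <= enorm xi -> 1 ^+ 2 <= (2 * enorm xi) ^+ n.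
  by move=> x1; rewrite expr1n exprn_ege1//; lra.
have := @packet_seq_energy (fun=> 1) t l (measurable_cst _) H1.
by under eq_integral do rewrite mul1r.
Qed.

Lemma packet_limit t : exists k h : Rn -> R[i],
  [/\ L2 k, L2 h,
    {ae lam, forall xi, ccvg (cpsum (fun l => pk l t xi)) (k xi)},
    {ae lam, forall x, ccvg (cpsum (fun l => wv l (x, t))) (h x)} &
    forall psi, schwartz psi ->
      cint lam (fun x => h x * psi x) = cint lam (fun x => k x * inv_fourier psi x) /\
      cint lam (fun x => h x * fourier psi x) = cint lam (fun x => k x * psi x)].
Proof.
have bp l := packet_seq_bounded_cintg l t.
have [|k [k2 kae kp]] := L2_series (z := fun l => pk l t) _ (packet_seq_energy1 t).
  by move=> l; case: (bp l) => -[].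
have mw l : cmeas (fun x => wv l (x, t)) by have [] := inv_fourier_L2 (bp l).
have [|h [h2 hae hp]] := L2_series (z := fun l x => wv l (x, t)) (C := 2 ^+ n * kappa) mw.
  move=> l; apply: le_trans (packet_seq_energy1 t l).
  by have [] := inv_fourier_L2 (bp l).
exists k, h; split=> // psi sp.
have bs := schwartz_bounded_cintg sp; have s2 := bounded_cintg_L2 bs.
have F2 : L2 (fourier psi) by rewrite fourierE; apply: FT_L2 => //; rewrite normrN1.
have I2 : L2 (inv_fourier psi).
  have [mi Hi] := inv_fourier_L2 bs; split=> //.
  by apply: le_lt_trans Hi _; case: s2.
have n1 : `|1 : R| = 1 by rewrite normr1.
have T1 (f : Rn -> R[i]) : bounded_cintg f -> L2 (FT 1 f) by exact: FT_L2 n1.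
have P2 l : L2 (pk l t) by exact: bounded_cintg_L2.
pose c : R[i] := ((2 * pi) ^- n : R)%:C.
split.
  apply: (ccvg_unique (hp _ s2)); apply: eq_ccvg (kp _ I2) => M.
  apply: eq_bigr => l _; rewrite /wave_seq /wave !inv_fourierE.
  transitivity (c * cint lam (fun x => pk l t x * FT 1 psi x)).
    rewrite -cintZ; last exact: L2_cintgM (P2 l) (T1 _ bs).
    by apply: eq_cint => x; rewrite mulrCA.
  rewrite -(FT_multiplication 1 (proj1 (bp l)) (proj1 bs)) -cintZ.
    by apply: eq_cint => x; rewrite inv_fourierE mulrA.
  exact: L2_cintgM (T1 _ (bp l)) s2.
apply: (ccvg_unique (hp _ F2)); apply: eq_ccvg (kp _ s2) => M.
apply: eq_bigr => l _; rewrite /wave_seq /wave fourierE.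
transitivity (c * cint lam (fun x => FT 1 (pk l t) x * FT (-1) psi x)).
  rewrite (FT_inversion n1 (bp l) bs (schwartz_cvg_line sp)) mulrA -cRealM mulVf ?mul1r//.
  by have /andP[] := @pi2n R n; rewrite -invr_eq0 => /gt_eqF ->.
rewrite -cintZ; first by apply: eq_cint => x; rewrite inv_fourierE mulrA.
by apply: L2_cintgM (T1 _ (bp l)) _; rewrite -fourierE.
Qed.

(** The square root of the H^(n/2) weight, so that it multiplies the spectrum itself; for |xi| >= 1
    its square is at most (2 |xi|)^n because 1 + |xi|^2 <= (2 |xi|)^2. *)
Definition sobolev_weight (xi : Rn) : R := (1 + enorm xi ^+ 2) `^ (n%:R / 4).

Lemma sobolev_weight_sqr xi : sobolev_weight xi ^+ 2 = (1 + enorm xi ^+ 2) `^ (n%:R / 2).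
Proof.
by rewrite -powR_mulrn ?powR_ge0// -powRrM; congr (_ `^ _); field.
Qed.

Lemma sobolev_weight_le xi : 1 <= enorm xi -> sobolev_weight xi ^+ 2 <= (2 * enorm xi) ^+ n.
Proof.
move=> x1; have e2 : 0 <= 2 * enorm xi by rewrite mulr_ge0 ?enorm_ge0.
rewrite sobolev_weight_sqr -(powR_mulrn n e2).
rewrite (_ : (2 * enorm xi) `^ n%:R = ((2 * enorm xi) ^+ 2) `^ (n%:R / 2)); last first.
  by rewrite -(powR_mulrn 2 e2) -powRrM; congr (_ `^ _); field.
by apply: ge0_ler_powR; rewrite ?divr_ge0// ?nnegrE ?addr_ge0 ?sqr_ge0//; nra.
Qed.

Lemma measurable_sobolev_weight : measurable_fun setT sobolev_weight.
Proof.
apply: (measurableT_comp (measurable_powR (n%:R / 4))).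
by apply: measurable_funD => //; apply: measurable_funX; exact: measurable_enorm.
Qed.

Lemma ae_ccvg_unique (z : nat -> Rn -> R[i]) (w w' : Rn -> R[i]) :
  {ae lam, forall x, ccvg (z ^~ x) (w x)} -> {ae lam, forall x, ccvg (z ^~ x) (w' x)} ->
  {ae lam, forall x, w x = w' x}.
Proof. by move=> h h'; apply: filterS2 h h' => x; exact: ccvg_unique. Qed.

(** The weighted packets satisfy the same energy bound and are summed anew in L^2; pointwise
    uniqueness of limits identifies their sum with the weight times k almost everywhere. *)
Lemma packet_limit_sobolev t k : L2 k ->
  {ae lam, forall xi, ccvg (cpsum (fun l => pk l t xi)) (k xi)} ->
  (sobolev_norm_hat (n%:R / 2) k < +oo)%E.
Proof.
move=> [mk _] kae; apply: poweR_lty.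
have mp l : cmeas (pk l t) by case: (packet_seq_bounded_cintg l t) => -[].
have mm := measurable_sobolev_weight.
have mz l : cmeas (fun xi => (sobolev_weight xi)%:C * pk l t xi).
  by apply: cmeasM => //; exact: cmeas_real.
have [S [[mS S2] Sae _]] := L2_series mz
  (fun l => packet_seq_energy t l mm sobolev_weight_le).
apply: le_lt_trans S2; rewrite le_eqVlt; apply/orP; left; apply/eqP.
apply: ae_eq_integral => //.
- apply/measurable_EFinP; apply: measurable_funM.
    apply: (measurableT_comp (measurable_powR (n%:R / 2))).
    by apply: measurable_funD => //; apply: measurable_funX; exact: measurable_enorm.
  by apply: measurable_funX; exact: measurable_cmod.
- exact: measurable_sqr_cmod.
apply: filterS2 kae Sae => xi ck cS _.
rewrite (_ : S xi = (sobolev_weight xi)%:C * k xi).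
  by rewrite cmodM cmodC exprMn real_normK ?num_real// sobolev_weight_sqr.
apply: (ccvg_unique cS); apply: eq_ccvg (ccvgZ _ ck) => M.
by rewrite /cpsum mulr_sumr.
Qed.

(** Each packet at time t is exp(i t [phit]) times the packet at time 0; this survives in the
    pointwise limit, and [phit] is [phi] off the null set [N]. *)
Lemma packet_limit_phase t k g :
  {ae lam, forall xi, ccvg (cpsum (fun l => pk l t xi)) (k xi)} ->
  {ae lam, forall xi, ccvg (cpsum (fun l => pk l 0 xi)) (g xi)} ->
  {ae lam, forall xi, k xi = cexpi (t * phi xi) * g xi}.
Proof.
move=> kae gae.
have Nae : {ae lam, forall x, ~ N x}.
  by exists N; split=> // x /= /contrapT.
apply: filterS3 kae gae Nae => xi ck cg nN.
apply: (ccvg_unique ck); apply: eq_ccvg (ccvgZ _ cg) => M.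
rewrite /cpsum mulr_sumr; apply: eq_bigr => l _.
rewrite /packet_seq /packet mulrCA -cexpiD; congr (_ * cexpi _).
by rewrite phitE//; ring.
Qed.

End packet_limits.

Theorem theorem1p1 (R : realType) (n : nat) (gamma : R -> R) (R0 C : R)
    (phi : 'rV[R]_n -> R)
    (n_ge1 : (1 <= n)%N)
    (gamma_ge0 : forall s, 0 <= s -> 0 <= gamma s)
    (gamma_incr : {in `[0, +oo[ &, {homo gamma : s t / s < t}})
    (gamma_cont : {within `[0, +oo[, continuous gamma})
    (gamma0 : gamma 0 = 0)
    (R0_ge1 : 1 <= R0)
    (phi_meas : lebesgue_measurable phi)
    (phi_rad : forall r w, R0 < r -> unit_sphere w ->
       derivable (radial phi w) r 1 /\
       derivable (derive1 (radial phi w)) r 1)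
    (phi_rad1_cont : {within [set p : R * 'rV[R]_n | R0 < p.1 /\ unit_sphere p.2],
       continuous (fun p => rad1 phi p.1 p.2)})
    (phi_rad2_cont : {within [set p : R * 'rV[R]_n | R0 < p.1 /\ unit_sphere p.2],
       continuous (fun p => rad2 phi p.1 p.2)})
    (phi_liminf :
       limf_einf
         (fun r : R => ereal_inf [set `|rad1 phi r w|%:E | w in unit_sphere])
         (pinfty_nbhs R) = +oo%E)
    (phi_rad1_neq0 : forall r w, R0 < r -> unit_sphere w -> rad1 phi r w != 0)
    (phi_sup :
       (ereal_sup [set ereal_sup
          [set ((r * `|rad2 phi r w|) /
                (`|rad1 phi r w| ^+ 2 * ln r `^ (3 / 4)))%:E
          | w in unit_sphere] | r in `]R0, +oo[] < C%:E)%E) :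
  exists f : 'rV[R]_n -> R[i],
    [/\ L2 f, sobolev (n%:R / 2) (distr_of f) &
      exists u : 'rV[R]_n * R -> R[i],
        [/\ {within [set p : 'rV[R]_n * R | 0 < p.2],
               continuous (u : 'rV[R]_n * R -> R[i]^o)},
            forall t, 0 < t -> exists2 h : 'rV[R]_n -> R[i],
              is_S phi f t h & {ae @lebesgue_rV R n, forall x, u (x, t) = h x}
          & forall x : 'rV[R]_n,
              limf_esup (fun p : 'rV[R]_n * R => (cmod (u p))%:E)
                (within [set p : 'rV[R]_n * R |
                           enorm (p.1 - x) < gamma p.2 /\ 0 < p.2]
                        (nbhs (x, 0 : R)))
              = +oo%E]].
Proof.
have [phit [N [mphit mN N0 phitE]]] := lebesgue_measurable_borel phi_meas.
have [xs [ts [ts0 ts_decr ts_cvg dense]]] := @dense_sequence R n gamma gamma_incr gamma0.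
have gap0 l : 0 < time_gap ts l.
  by case: l => [|l] /=; rewrite ?ltr01// subr_gt0 ts_decr.
have reach0 l : 0 <= reach xs l + enorm (xs l).
  by rewrite addr_ge0 ?enorm_ge0// (le_trans _ (reach_ge xs l)).
have half0 l : 0 < 2^-1 ^+ l :> R by rewrite exprn_gt0// invr_gt0.
have /choice[a Ha] (l : nat) : exists b, 1 <= b /\ forall (y : 'rV[R]_n) s,
    enorm y <= reach xs l + enorm (xs l) -> time_gap ts l <= `|s| ->
    cmod (cint (@lebesgue_rV R n) (fun x => (weight b (expR (log_width l)) x)%:C%C *
      cexpi (dot y x + s * phit x))) <= 2^-1 ^+ l.
  have [b b1 Hb] := oscillation n_ge1 mphit mN N0 phitE phi_rad (rad1_growth phi_liminf)
    (rad2_le R0_ge1 phi_rad1_neq0 phi_sup) (rad2_continuous phi_rad2_cont)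
    (reach0 l) (gap0 l) (expR_log_width_gt1 l) (half0 l).
  by exists b.
have a1 l := (Ha l).1; have osc l := (Ha l).2.
have lim := packet_limit n_ge1 xs ts mphit a1.
(* The initial datum f is the sum of the waves at time 0, in the L^2 sense, and g is its
   transform. *)
have [g [f [g2 f2 gae fae gf]]] := lim 0.
have Ff : deq (fourier_distr (distr_of f)) (distr_of g) by move=> psi /gf[_].
exists f; split=> //.
  split; first exact: tempered_L2.
  exists g; split=> //; first by case: g2.
  exact: (@packet_limit_sobolev R n n_ge1 phit xs ts a mphit a1 0 g g2 gae).
exists (wave_sum phit xs ts a); split.
- exact: (wave_sum_continuous n_ge1 mphit a1 ts_decr ts_cvg osc).
- move=> t t0; have [k [h [k2 h2 kae hae kh]]] := lim t.
  exists h.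
    split=> //; exists g, k; split=> //; last by move=> psi /kh[].
    exact: (@packet_limit_phase R n phi phit N xs ts a mN N0 phitE t k g kae gae).
  (* For t > 0 the same partial sums converge everywhere to [wave_sum] and almost everywhere to the
     L^2 sum h. *)
  apply: (@ae_ccvg_unique R n (fun M x => cpsum (fun l => wave_seq phit xs ts a l (x, t)) M) _ h _ hae); apply: nearW => x.
  have [B /nbhs_singleton HB] := wave_seq_near n_ge1 mphit a1 ts_decr ts_cvg osc x t0.
  exact: csum_cvg HB.
- move=> x; apply: (wave_sum_limsup n_ge1 mphit a1 ts0 ts_decr ts_cvg osc gamma_cont gamma0).
  exact: dense.
Qed.
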